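(* Let $L\in\mathcal{L}(L_0)$ and let $\{L_n\}_{n\in\mathbb{N}}\subset\mathcal{L}(L_0)$ be a sequence of Lagrangians in the cylinder $\Sigma=S^1\times(-1,1)$, each transverse to $L$, that $C^0$-converges to $L$. If the sequence $k_n:=\#(L\cap L_n)$ is bounded, then $\{L_n\}$ converges to $L$ in the Lagrangian Hofer metric, i.e. $d_H(L,L_n)\to0$ as $n\to\infty$.
   Context: Setting. $\Sigma=S^1\times(-1,1)$ with coordinates $(q,p)$ and symplectic form $\omega=\mathrm{d}q\wedge\mathrm{d}p$. $L_0=S^1\times\{0\}$, and $\mathcal{L}(L_0)$ is the set of all Lagrangians $L\subset\Sigma$ that are Hamiltonian isotopic to $L_0$, i.e. $L=\phi(L_0)$ with $\phi\in\mathrm{Ham}(\Sigma)$, the group of time-one maps of compactly supported Hamiltonians $H\in C^\infty([0,1]\times\Sigma)$. Hofer distance. For $\phi\in\mathrm{Ham}(\Sigma)$, $\|\phi\|_H=\inf\{\int_0^1(\max_x H_t(x)-\min_x H_t(x))\,\mathrm{d}t\mid \phi_1^H=\phi\}$, where $\phi^H_t$ is the Hamiltonian flow of $H$. $d_H(L,L')=\inf\{\|\phi\|_H\mid\phi\in\mathrm{Ham}(\Sigma),\ \phi(L)=L'\}$. $C^0$-convergence. $L_n$ $C^0$-converges to $L$ if there are $\phi_n\in\mathrm{Ham}(\Sigma)$ with $\phi_n(L)=L_n$ and $\sup_{x\in\Sigma}d(\phi_n(x),x)\to0$, where $d$ is the standard flat product distance on $S^1\times(-1,1)$. *)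

(* Defs.v *)
From HB Require Import structures.
From mathcomp Require Import all_boot all_order all_algebra.
From mathcomp Require Import generic_quotient ring_quotient.
From mathcomp Require Import all_classical all_reals all_analysis.

Set Implicit Arguments.
Unset Strict Implicit.
Unset Printing Implicit Defensive.

Import Order.TTheory GRing.Theory Num.Theory.
Import numFieldNormedType.Exports.

Local Open Scope classical_set_scope.
Local Open Scope ring_scope.

(* For finite-dimensional V and open U, [Ck k U f] says that f is C^k on U:
   all iterated directional derivatives of order at most k exist and are
   continuous on U. *)
Fixpoint Ck (R : realType) (V W : normedModType R) (k : nat) (U : set V)
    (f : V -> W) : Prop :=
  match k with
  | 0%N => forall x, U x -> {for x, continuous f}
  | k'.+1 => (forall x, U x -> differentiable f x) /\
             forall v : V, Ck k' U (fun x => 'D_v f x)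
  end.

Definition smooth (R : realType) (V W : normedModType R) (U : set V)
    (f : V -> W) : Prop :=
  forall k, Ck k U f.

(* Smoothness on a set that need not be open: local smooth extensions. *)
Definition smooth_on (R : realType) (V W : normedModType R) (A : set V)
    (f : V -> W) : Prop :=
  forall x, A x -> exists U : set V, exists g : V -> W,
    [/\ open U, U x, smooth U g & forall y, (A `&` U) y -> f y = g y].

Definition integers (R : realType) : zmodClosed R :=
  GRing.ZmodClosed.clone R (@Num.int_num_subdef R) _.

(* S^1 = R / Z. *)
Definition circle (R : realType) : Type := Quotient.quot (integers R).

Definition to_circle (R : realType) (q : R) : circle R :=
  \pi_(Quotient.quot (integers R))%qT q.

Definition open_interval (R : realType) : Type := {p : R | -1 < p < 1}.

Lemma open_interval0 (R : realType) : -1 < (0 : R) < 1.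
Proof. by rewrite ltrN10 ltr01. Qed.

Definition cylinder (R : realType) : Type := (circle R * open_interval R)%type.

(* The open strip R x (-1, 1), universal cover of the cylinder. *)
Definition strip (R : realType) : set (R * R) := [set a | -1 < a.2 < 1].

(* The covering map; its values outside [strip] are irrelevant. *)
Definition proj (R : realType) (a : R * R) : cylinder R :=
  (to_circle a.1, insubd (exist _ 0 (open_interval0 R) : open_interval R) a.2).

Definition is_lift (R : realType) (a : R * R) (x : cylinder R) : Prop :=
  strip a /\ proj a = x.

(* The flat product distance: the distance on S^1 is the quotient distance. *)
Definition circle_dist (R : realType) (x y : circle R) : R :=
  inf [set r | exists a b : R,
         [/\ to_circle a = x, to_circle b = y & r = `|a - b|]].

Definition cyl_dist (R : realType) (x y : cylinder R) : R :=
  Num.sqrt (circle_dist x.1 y.1 ^+ 2 + (val x.2 - val y.2) ^+ 2).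

(* H in C^oo([0,1] x Sigma) with compact support; only the values H t with
   0 <= t <= 1 matter. Every compact subset of the cylinder lies in some
   S^1 x [-r, r] with r < 1. *)
Definition is_hamiltonian (R : realType) (H : R -> cylinder R -> R) : Prop :=
  smooth_on [set y : R * (R * R) | 0 <= y.1 <= 1 /\ strip y.2]
    (fun y : R * (R * R) => H y.1 (proj y.2)) /\
  exists2 r : R, r < 1 &
    forall t x, 0 <= t <= 1 -> r < `|val x.2| -> H t x = 0.

(* Hamiltonian vector field for omega = dq /\ dp (convention
   iota_X omega = dH), in the coordinates of the strip. *)
Definition ham_vf (R : realType) (h : cylinder R -> R) (a : R * R) : R * R :=
  ('D_((0, 1) : R * R) (fun b : R * R => h (proj b)) a,
   - 'D_((1, 0) : R * R) (fun b : R * R => h (proj b)) a).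

(* [c] is an integral curve of H over [0,1]. The lift [g] is a function on the
   whole line; at t = 0 and t = 1 its two-sided differentiability is no
   restriction, since its values outside [0,1] are arbitrary. *)
Definition integral_curve (R : realType) (H : R -> cylinder R -> R)
    (c : R -> cylinder R) : Prop :=
  exists g : R -> R * R, forall t : R, 0 <= t <= 1 ->
    is_lift (g t) (c t) /\ is_derive t 1 g (ham_vf (H t) (g t)).

Definition is_flow (R : realType) (H : R -> cylinder R -> R)
    (Phi : R -> cylinder R -> cylinder R) : Prop :=
  forall x, Phi 0 x = x /\ integral_curve H (fun t => Phi t x).

(* [phi] is the time-one map of the compactly supported Hamiltonian H. *)
Definition generates (R : realType) (H : R -> cylinder R -> R)
    (phi : cylinder R -> cylinder R) : Prop :=
  is_hamiltonian H /\ exists2 Phi, is_flow H Phi & Phi 1 = phi.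

Definition Ham (R : realType) : set (cylinder R -> cylinder R) :=
  [set phi | exists H, generates H phi].
Arguments Ham {R}.

(* For a compactly supported Hamiltonian the supremum and the infimum are
   attained. *)
Definition osc (R : realType) (h : cylinder R -> R) : R :=
  sup (range h) - inf (range h).

Definition hofer_norm (R : realType) (phi : cylinder R -> cylinder R) : \bar R :=
  ereal_inf [set (\int[lebesgue_measure]_(t in `[0%R, 1%R]) (osc (H t))%:E)%E
            | H in [set H | generates H phi]].

Definition hofer_dist (R : realType) (L L' : set (cylinder R)) : \bar R :=
  ereal_inf [set hofer_norm phi
            | phi in [set phi | Ham phi /\ phi @` L = L']].

Definition zero_section (R : realType) : set (cylinder R) :=
  [set x | val x.2 = 0].

(* The Lagrangians Hamiltonian isotopic to the zero section. *)
Definition Lag (R : realType) : set (set (cylinder R)) :=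
  [set L | exists2 phi, Ham phi & L = phi @` @zero_section R].
Arguments Lag {R}.

(* Velocities at x of smooth curves in the cylinder that stay in L. *)
Definition tangent (R : realType) (L : set (cylinder R)) (x : cylinder R) :
    set (R * R) :=
  [set v | exists U : set R, exists g : R -> R * R,
     [/\ open U /\ U 0,
         smooth U g,
         forall t, U t -> exists2 y, L y & is_lift (g t) y,
         is_lift (g 0) x &
         is_derive (0 : R) (1 : R) g v]].

Definition transverse (R : realType) (L L' : set (cylinder R)) : Prop :=
  forall x, L x -> L' x -> forall w : R * R,
    exists u v, [/\ tangent L x u, tangent L' x v & w = u + v].

Definition C0_dist_id (R : realType) (phi : cylinder R -> cylinder R) : R :=
  sup [set cyl_dist (phi x) x | x in [set: cylinder R]].

Definition C0_converges (R : realType) (Ln : nat -> set (cylinder R))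
    (L : set (cylinder R)) : Prop :=
  exists phin : nat -> cylinder R -> cylinder R,
    (forall n, Ham (phin n) /\ phin n @` L = Ln n) /\
    C0_dist_id (phin n) @[n --> \oo] --> (0 : R).

(* Main.v *)
(* Conjugating by a Hamiltonian map that carries the zero section L_0 to L, one
   may take L = L_0 and must bound the distance from L_0 to m(L_0), where m is
   C^0-small and m(L_0) meets L_0 transversally in at most N points.

   Let λ = p dq. Since m is Hamiltonian, λ - (m^-1)^*λ = dF. Between consecutive
   intersection points m(L_0) is an arc in a thin strip on one side of L_0, and
   by Stokes' theorem the action of such an arc is at most a constant times the
   C^0-size of m; hence F is nearly constant, say nearly 0, on L_0 ∩ m(L_0).
   Cut F off near L_0, and near L_0 and m(L_0) differently, so as to obtain F_0
   and F_1 with F_0 = 0 near L_0, F_1 = F near m(L_0), and F_1 - F_0 supported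
   near L_0 ∩ m(L_0), hence small. The Liouville fields of λ - dF_0 and
   λ - dF_1 vanish on L_0 and on m(L_0) respectively. Conjugating the Hamiltonian
   isotopy of m by their flows ψ_0, ψ_1, namely
     ψ_1(s t) ∘ ψ_0(s (1 - t)) ∘ m_t ∘ ψ_0(- s),
   gives an isotopy whose end still carries L_0 to m(L_0), while its
   Hamiltonian is bounded by
     s e^(- s t) sup |F_1 - F_0| + e^(- s) sup |H|,
   whose integral over [0, 1] is small once s is large. *)

Require Import Defs.
From HB Require Import structures.
From mathcomp Require Import all_boot all_order all_algebra.
From mathcomp Require Import all_classical all_reals all_analysis.
From mathcomp Require Import ring lra.

Set Implicit Arguments.
Unset Strict Implicit.
Unset Printing Implicit Defensive.

Import Order.TTheory GRing.Theory Num.Theory.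
Import numFieldNormedType.Exports.

Local Open Scope classical_set_scope.
Local Open Scope ring_scope.

(** [C^0]-closeness controls neither the derivatives of [m] nor the size of [H], so the parameter
    [s] is chosen last, once [H] is known. The weight [s e^(- s t)] has integral less than 1 for
    every [s], while [H] is damped by [e^(- s)] because both Liouville flows contract area and their
    times [s t] and [s (1 - t)] add up to [s]. A single primitive of the area form vanishing on both
    curves exists only if [F] is constant on their intersection; two primitives that differ by the
    small defect of [F] there replace it. The number of intersection points matters because the
    defect accumulates along the arcs between them.

    Stokes' theorem for an arc calls for the region that the arc cuts off. In its place stands a
    smooth function with values between -1 and 1 that jumps by one across the arc; integrated over a
    strip of height [2 * eps] and bounded width, it yields the action bound. The analysis takes
    place on the universal cover, with maps extended by the identity to the whole plane, so that
    periodicity and bounded vertical support provide all uniform bounds. *)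

(** * Smooth maps between normed spaces *)

(* The differential is taken jointly in the point and the direction, so that the
   chain rule follows by induction on [k]. *)
Fixpoint Cn (R : realType) (k : nat) :
    forall V W : normedModType R, set V -> (V -> W) -> Prop :=
  match k with
  | 0%N => fun V W U f => forall x, U x -> {for x, continuous f}
  | k'.+1 => fun V W U f => (forall x, U x -> differentiable f x) /\
     Cn k' (U `*` [set: V]) (fun z : V * V => 'd f (z.1) z.2)
  end.

Section Cn_theory.
Context {R : realType}.
Implicit Types V W X : normedModType R.

Lemma open_setXT V W (U : set V) : open U -> open (U `*` [set: W]).
Proof.
move=> oU; rewrite openE => -[x y] [/= Ux _].
exists (U, setT) => //=; split; first exact: open_nbhs_nbhs.
exact: filterT.
Qed.

Lemma near_open V (U : set V) x : open U -> U x -> \forall y \near x, U y.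
Proof. by move=> oU Ux; apply: open_nbhs_nbhs. Qed.

Lemma near_eq_differentiable V W (f g : V -> W) x :
  (\forall y \near x, f y = g y) -> differentiable f x ->
  differentiable g x /\ 'd g x = 'd f x :> (V -> W).
Proof.
move=> fg df.
have Hg : g \o shift x = cst (g x) + 'd f x +o_ (0 : V) id.
  rewrite -(nbhs_singleton fg).
  apply/eqaddoP => e e0.
  have /eqaddoP/(_ e e0) := diff_locally df.
  have fg0 : \forall y \near (0 : V), f (y + x) = g (y + x).
    by move: fg; rewrite [\forall y \near x, _](near_shift 0) subr0.
  move: fg0; apply: filterS2 => y fgy; rewrite !fctE /= => H.
  by rewrite -fgy.
split.
  apply/diff_locallyP.
  have E := diff_unique (@diff_continuous _ _ _ (nbhs_filter_on x) f df) Hg.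
  split; first by rewrite E; exact: (@diff_continuous _ _ _ (nbhs_filter_on x) f df).
  by rewrite E.
exact: (diff_unique (@diff_continuous _ _ _ (nbhs_filter_on x) f df) Hg).
Qed.

Lemma Cn_eq k V W (U : set V) (f g : V -> W) : open U ->
  (forall x, U x -> f x = g x) -> Cn k U f -> Cn k U g.
Proof.
elim: k V W U f g => [|k IH] V W U f g oU fg /=.
  move=> cf x Ux; rewrite /prop_for /continuous_at -(fg _ Ux).
  apply: cvg_trans (cf x Ux); apply: near_eq_cvg.
  by near=> y; apply: fg; near: y; apply: near_open.
move=> [df Cdf].
have H x (Ux : U x) : differentiable g x /\ 'd g x = 'd f x :> (V -> W).
  apply: near_eq_differentiable; last exact: df.
  by near=> y; apply: fg; near: y; apply: near_open.
split=> [x Ux|]; first by have [] := H x Ux.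
apply: IH Cdf; first exact: open_setXT.
by move=> [x h] [/= Ux _]; have [_ ->] := H x Ux.
Unshelve. all: by end_near. Qed.

Lemma Cn_sub k V W (U U' : set V) (f : V -> W) :
  U' `<=` U -> Cn k U f -> Cn k U' f.
Proof.
elim: k V W U U' f => [|k IH] V W U U' f UU' /=; first by move=> H x /UU'/H.
move=> [df Cdf]; split; first by move=> x /UU'/df.
by apply: IH Cdf => -[x h] [/= /UU' Ux _].
Qed.

Lemma CnW k V W (U : set V) (f : V -> W) : Cn k.+1 U f -> Cn k U f.
Proof.
elim: k V W U f => [|k IH] V W U f /= [df Cdf].
  by move=> x Ux; apply: differentiable_continuous; exact: df.
by split=> //; apply: IH.
Qed.

Lemma Cn_linear k V W (U : set V) (f : {linear V -> W}) :
  continuous f -> Cn k U f.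
Proof.
elim: k V W U f => [|k IH] V W U f cf /=; first by move=> x _; exact: cf.
split=> [x _|]; first exact: linear_differentiable.
have -> : (fun z : V * V => 'd f (z.1) z.2) = (f \o snd).
  by apply/funext => z /=; rewrite diff_lin.
apply: IH => x; apply: continuous_comp; last exact: cf.
exact: cvg_snd.
Qed.

Lemma Cn_fst k V W (U : set (V * W)) : Cn k U fst.
Proof. by apply: (@Cn_linear _ _ _ _ fst) => x; exact: cvg_fst. Qed.

Lemma Cn_snd k V W (U : set (V * W)) : Cn k U snd.
Proof. by apply: (@Cn_linear _ _ _ _ snd) => x; exact: cvg_snd. Qed.

Lemma Cn_id k V (U : set V) : Cn k U id.
Proof. by apply: (@Cn_linear _ _ _ _ idfun) => x; exact: cvg_id. Qed.

Lemma Cn_cst k V W (U : set V) (a : W) : Cn k U (cst a).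
Proof.
elim: k V W U a => [|k IH] V W U a /=; first by move=> x _; exact: cvg_cst.
split=> [x _|]; first exact: differentiable_cst.
have -> : (fun z : V * V => 'd (cst a : V -> W) (z.1) z.2) = cst 0.
  by apply/funext => z /=; rewrite diff_cst.
exact: IH.
Qed.

Lemma diff_pairE V W X (f : V -> W) (g : V -> X) x h :
  differentiable f x -> differentiable g x ->
  'd (fun y => (f y, g y)) x h = ('d f x h, 'd g x h).
Proof. by move=> df dg; rewrite diff_pair. Qed.

Lemma Cn_pair k V W X (U : set V) (f : V -> W) (g : V -> X) : open U ->
  Cn k U f -> Cn k U g -> Cn k U (fun x => (f x, g x)).
Proof.
elim: k V W X U f g => [|k IH] V W X U f g oU /=.
  by move=> cf cg x Ux; apply: cvg_pair => /=; [exact: cf|exact: cg].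
move=> [df Cdf] [dg Cdg]; split=> [x Ux|].
  by apply: differentiable_pair; [exact: df|exact: dg].
apply: (Cn_eq _ _ (IH _ _ _ _ _ _ _ Cdf Cdg)); try exact: open_setXT.
by move=> [x h] [/= Ux _]; rewrite diff_pairE //; [exact: df|exact: dg].
Qed.

Lemma diff_compE V W X (g : V -> W) (f : W -> X) x h :
  differentiable g x -> differentiable f (g x) ->
  'd (fun y => f (g y)) x h = 'd f (g x) ('d g x h).
Proof. by move=> dg df; rewrite (diff_comp dg df). Qed.

Lemma Cn_comp k V W X (U : set V) (U' : set W) (g : V -> W) (f : W -> X) :
  open U -> open U' -> (forall x, U x -> U' (g x)) ->
  Cn k U g -> Cn k U' f -> Cn k U (f \o g).
Proof.
elim: k V W X U U' g f => [|k IH] V W X U U' g f oU oU' UU'.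
  by move=> cg cf x Ux; apply: continuous_comp; [exact: cg|exact/cf/UU'].
move=> Cg Cf; have Cgk := CnW Cg.
move: Cg Cf => [dg Cdg] [df Cdf]; split=> [x Ux|].
  by apply: differentiable_comp; [exact: dg|exact/df/UU'].
have H : Cn k (U `*` [set: V])
  ((fun z : W * W => 'd f (z.1) z.2) \o (fun z : V * V => (g z.1, 'd g (z.1) z.2))).
  apply: (IH _ _ _ _ (U' `*` [set: W])) => //; try exact: open_setXT.
    by move=> [x h] [/= Ux _]; split => //; exact: UU'.
  apply: Cn_pair => //; first exact: open_setXT.
  apply: (IH _ _ _ _ U fst g) => //; first exact: open_setXT.
    by move=> z [].
  exact: Cn_fst.
apply: Cn_eq H; first exact: open_setXT.
move=> [x h] [/= Ux _]; by rewrite (diff_compE _ (dg x Ux) (df _ (UU' _ Ux))).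
Qed.

Definition sm V W (U : set V) (f : V -> W) := forall k, Cn k U f.

Lemma sm_diff V W (U : set V) (f : V -> W) : sm U f ->
  sm (U `*` [set: V]) (fun z : V * V => 'd f (z.1) z.2).
Proof. by move=> sf k; have [] := sf k.+1. Qed.

Lemma sm_differentiable V W (U : set V) (f : V -> W) x : sm U f -> U x ->
  differentiable f x.
Proof. by move=> sf Ux; have [+ _] := sf 1%N; exact. Qed.

Lemma sm_continuous V W (U : set V) (f : V -> W) x : sm U f -> U x ->
  {for x, continuous f}.
Proof. by move=> sf Ux; apply: (sf 0%N). Qed.

Lemma sm_sub V W (U U' : set V) (f : V -> W) : U' `<=` U -> sm U f -> sm U' f.
Proof. by move=> UU' sf k; exact: Cn_sub UU' (sf k). Qed.

Lemma sm_pair V W X (U : set V) (f : V -> W) (g : V -> X) : open U ->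
  sm U f -> sm U g -> sm U (fun x => (f x, g x)).
Proof. by move=> oU sf sg k; exact: Cn_pair. Qed.

Lemma sm_comp V W X (U : set V) (U' : set W) (g : V -> W) (f : W -> X) :
  open U -> open U' -> (forall x, U x -> U' (g x)) ->
  sm U g -> sm U' f -> sm U (fun x => f (g x)).
Proof. by move=> oU oU' H sg sf k; exact: (Cn_comp oU oU' H). Qed.

Lemma sm_compT V W X (U : set V) (g : V -> W) (f : W -> X) :
  open U -> sm U g -> sm [set: W] f -> sm U (fun x => f (g x)).
Proof. by move=> oU; apply: sm_comp => //; exact: openT. Qed.

Lemma sm_linear V W (U : set V) (f : {linear V -> W}) : continuous f -> sm U f.
Proof. by move=> cf k; exact: Cn_linear. Qed.

Lemma sm_cst V W (U : set V) (a : W) : sm U (fun=> a).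
Proof. by move=> k; exact: Cn_cst. Qed.

Lemma sm_id V (U : set V) : sm U (fun x => x).
Proof. by move=> k; exact: Cn_id. Qed.

Lemma sm_fst V W (U : set (V * W)) : sm U fst.
Proof. by move=> k; exact: Cn_fst. Qed.

Lemma sm_snd V W (U : set (V * W)) : sm U snd.
Proof. by move=> k; exact: Cn_snd. Qed.

Lemma Cn_add k V W (U : set V) (f g : V -> W) : open U ->
  Cn k U f -> Cn k U g -> Cn k U (fun x => f x + g x).
Proof.
elim: k V U f g => [|k IH] V U f g oU.
  by move=> cf cg x Ux; apply: cvgD; [exact: cf|exact: cg].
move=> [df Cdf] [dg Cdg].
split=> [x Ux|]; first by apply: differentiableD; [exact: df|exact: dg].
apply: (Cn_eq (open_setXT oU) _ (IH _ _ _ _ (open_setXT oU) Cdf Cdg)).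
move=> [x h] [/= Ux _].
exact: esym (congr1 (fun F : V -> W => F h) (diffD (df _ Ux) (dg _ Ux))).
Qed.

Lemma sm_add V W (U : set V) (f g : V -> W) : open U ->
  sm U f -> sm U g -> sm U (fun x => f x + g x).
Proof. by move=> oU sf sg k; exact: Cn_add. Qed.

Lemma sm_opp V W (U : set V) (f : V -> W) : open U ->
  sm U f -> sm U (fun x => - f x).
Proof.
move=> oU sf; apply: (@sm_compT _ _ _ _ f (fun y => - y)) => //.
apply: (@sm_linear _ _ _ (-%R : {linear W -> W})) => x.
exact: opp_continuous.
Qed.

Lemma sm_mul V (U : set V) (f g : V -> R) : open U ->
  sm U f -> sm U g -> sm U (fun x => f x * g x).
Proof.
(* The induction concerns multiplication itself: its differential is a sum of two products of
   coordinates, to which the induction hypothesis applies after composition. *)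
suff H : sm [set: R * R] (fun z : R * R => z.1 * z.2).
  move=> oU sf sg.
  apply: (@sm_compT _ _ _ _ (fun x => (f x, g x)) (fun z : R * R => z.1 * z.2)) => //.
  exact: sm_pair.
elim=> [|k IH]; first by move=> z _; apply: differentiable_continuous.
split=> [z _ //|].
have P (a b : (R * R) * (R * R) -> R) : sm setT a -> sm setT b ->
    Cn k setT (fun z => a z * b z).
  move=> sa sb; apply: (@Cn_comp _ _ _ _ setT setT (fun z => (a z, b z))
    (fun z : R * R => z.1 * z.2)) => //; try exact: openT.
  by apply: Cn_pair => //; exact: openT.
have sf V1 V2 : sm [set: V1 * V2] fst by exact: sm_fst.
have ss V1 V2 : sm [set: V1 * V2] snd by exact: sm_snd.
have oT V1 : open [set: V1] by exact: openT.
apply: (@Cn_sub k _ _ setT) => //.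
apply: (Cn_eq (oT _) _ (Cn_add (oT _) (P (fun z => z.1.1) (fun z => z.2.2) _ _)
  (P (fun z => z.2.1) (fun z => z.1.2) _ _))).
- by move=> [z h] _; rewrite diff_val /= [z.1 * _ + _]addrC addrC mulrC [h.1 * _]mulrC.
- exact: (sm_compT (oT _) (sf _ _) (sf _ _)).
- exact: (sm_compT (oT _) (ss _ _) (ss _ _)).
- exact: (sm_compT (oT _) (ss _ _) (sf _ _)).
- exact: (sm_compT (oT _) (sf _ _) (ss _ _)).
Qed.

End Cn_theory.

(** * Differentiable curves and Gronwall's inequality *)

Section curves.
Context {R : realType}.
Implicit Types V W : normedModType R.

(** The first-order expansion without division, the form in which increments of curves are added up
    below. *)
Lemma is_derive_approxP V (c : R -> V) (t : R) (d : V) : is_derive t 1 c d <->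
  forall e, 0 < e -> exists2 r, 0 < r &
    forall h, `|h| < r -> `|c (t + h) - c t - h *: d| <= e * `|h|.
Proof.
split=> [[dc dE] e e0|H].
  have /cvgrPdist_le /(_ e e0) :
      (fun h : R => h^-1 *: (c (h *: 1 + t) - c t)) @ 0^' --> d by rewrite -dE; exact: dc.
  move=> /nbhs_ballP[r /= r0 Hr]; exists r => // h hr.
  have [->|h0] := eqVneq h 0; first by rewrite addr0 subrr scale0r subr0 normr0 normr0 mulr0.
  have := Hr h; rewrite /ball /= sub0r normrN => /(_ hr h0).
  have -> : c (t + h) - c t - h *: d = - (h *: (d - h^-1 *: (c (h *: 1 + t) - c t))).
    by rewrite scalerBr opprB scalerA divff// scale1r /GRing.scale/= mulr1 [h + t]addrC.
  by rewrite normrN normrZ mulrC ler_pM2r ?normr_gt0.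
have cd : (fun h : R => h^-1 *: (c (h *: 1 + t) - c t)) @ 0^' --> d.
  apply/cvgrPdist_le => e e0; have [r r0 Hr] := H e e0.
  exists r => //= h; rewrite /ball /= sub0r normrN => hr h0.
  have := Hr h hr; rewrite mulrC -ler_pdivrMl ?normr_gt0//.
  apply: le_trans; rewrite -normfV -normrZ distrC.
  have -> : h *: 1 + t = t + h by rewrite /GRing.scale/= mulr1 addrC.
  by rewrite [_ *: (_ - h *: d)]scalerBr scalerA mulVf// scale1r.
split; first by apply/cvg_ex; exists d.
exact: cvg_lim cd.
Qed.

Lemma is_derive_continuous V (c : R -> V) (t : R) (d : V) :
  is_derive t 1 c d -> {for t, continuous c}.
Proof.
by case=> dc _; apply/differentiable_continuous/derivable1_diffP.
Qed.

Lemma is_derive_diff V (c : R -> V) (t : R) (d : V) : is_derive t 1 c d ->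
  differentiable c t /\ forall h, 'd c t h = h *: d.
Proof.
move=> [dc <-]; have cd : differentiable c t by apply/derivable1_diffP.
by split => // h; rewrite diff1E // derive1E.
Qed.

Lemma is_derive_comp V W (f : V -> W) (c : R -> V) (t : R) (d : V) :
  differentiable f (c t) -> is_derive t 1 c d ->
  is_derive t 1 (fun s => f (c s)) ('d f (c t) d).
Proof.
move=> df dc; have [cd cE] := is_derive_diff dc.
have fcd : differentiable (f \o c) t by exact: differentiable_comp.
split; first exact/derivable1_diffP.
by rewrite deriveE // diff_compE // cE scale1r.
Qed.

Lemma is_derive_pair V W (f : R -> V) (g : R -> W) (t : R) (df : V) (dg : W) :
  is_derive t 1 f df -> is_derive t 1 g dg ->
  is_derive t 1 (fun s => (f s, g s)) (df, dg).
Proof.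
move=> Df Dg; have [fd fE] := is_derive_diff Df; have [gd gE] := is_derive_diff Dg.
have d : differentiable (fun s => (f s, g s)) t by exact: differentiable_pair.
split; first exact/derivable1_diffP.
by rewrite deriveE // diff_pairE // fE gE !scale1r.
Qed.

Lemma is_derive_fst V W (f : R -> V * W) (t : R) (d : V * W) :
  is_derive t 1 f d -> is_derive t 1 (fun s => (f s).1) d.1.
Proof.
move=> Df.
have c : continuous (fst : V * W -> V) by move=> x; exact: cvg_fst.
have := is_derive_comp (linear_differentiable (f t) c) Df.
by rewrite (@diff_lin _ _ _ fst).
Qed.

Lemma is_derive_snd V W (f : R -> V * W) (t : R) (d : V * W) :
  is_derive t 1 f d -> is_derive t 1 (fun s => (f s).2) d.2.
Proof.
move=> Df.
have c : continuous (snd : V * W -> W) by move=> x; exact: cvg_snd.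
have := is_derive_comp (linear_differentiable (f t) c) Df.
by rewrite (@diff_lin _ _ _ snd).
Qed.

Lemma is_deriveE V (c : R -> V) (t : R) (d d' : V) :
  d = d' -> is_derive t 1 c d -> is_derive t 1 c d'.
Proof. by move=> ->. Qed.

Lemma is_derive_add V (f g : R -> V) (t : R) (df dg : V) :
  is_derive t 1 f df -> is_derive t 1 g dg ->
  is_derive t 1 (fun s => f s + g s) (df + dg).
Proof. by move=> ? ?; exact: is_deriveD. Qed.

Lemma is_derive_sub V (f g : R -> V) (t : R) (df dg : V) :
  is_derive t 1 f df -> is_derive t 1 g dg ->
  is_derive t 1 (fun s => f s - g s) (df - dg).
Proof. by move=> ? ?; exact: is_deriveB. Qed.

Lemma is_derive_mul (f g : R -> R) (t df dg : R) :
  is_derive t 1 f df -> is_derive t 1 g dg ->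
  is_derive t 1 (fun s => f s * g s) (f t * dg + g t * df).
Proof. by move=> ? ?; exact: is_deriveM. Qed.

Lemma is_derive_scale V (x : V) (t : R) : is_derive t 1 (fun s : R => s *: x) x.
Proof.
apply/is_derive_approxP => e e0; exists 1 => // h _.
by rewrite scalerDl addrAC addrK subrr normr0 mulr_ge0// ltW.
Qed.

Lemma is_derive_line V (x h : V) (t : R) : is_derive t 1 (fun s => x + s *: h) h.
Proof.
by apply: (is_deriveE (add0r h)); apply: is_derive_add; exact: is_derive_scale.
Qed.

Lemma is_derive_1comp V (f : R -> V) (g : R -> R) (t : R) (df : V) (dg : R) :
  is_derive (g t) 1 f df -> is_derive t 1 g dg ->
  is_derive t 1 (fun s => f (g s)) (dg *: df).
Proof.
move=> Df Dg; have [fd fE] := is_derive_diff Df.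
by rewrite -fE; exact: is_derive_comp.
Qed.

(** At the supremum of the times up to which [f] stays nonnegative, continuity gives [0 <= f], and
    the last hypothesis carries the inequality further. *)
Lemma continuous_induction (f : R -> R) :
  (forall t : R, 0 <= t <= 1 -> {for t, continuous f}) -> 0 <= f 0 ->
  (forall t : R, 0 <= t < 1 -> 0 <= f t ->
     exists2 r, 0 < r & forall h, 0 < h < r -> 0 <= f (t + h)) ->
  forall t : R, 0 <= t <= 1 -> 0 <= f t.
Proof.
move=> cf f0 step t1 t1I; rewrite leNgt; apply/negP => ft1.
pose S := [set s | 0 <= s <= t1 /\ forall s', 0 <= s' <= s -> 0 <= f s'].
have S0 : S 0.
  split; first by rewrite lexx; lra.
  by move=> s' s'0; have -> : s' = 0 by lra.
have supS : has_sup S by split; [exists 0|exists t1 => s [/andP[]]].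
pose t0 := sup S.
have t0_ge0 : 0 <= t0 by apply: sup_upper_bound.
have t0_le : t0 <= t1 by apply: ge_sup; [exists 0|move=> s [/andP[]]].
have fS s : 0 <= s < t0 -> 0 <= f s.
  move=> /andP[s0 st0]; have [x Sx sx] := @sup_adherent _ S (t0 - s) ltac:(lra) supS.
  by have [_] := Sx; apply; rewrite /t0 in st0 sx *; lra.
have ft0 : 0 <= f t0.
  rewrite leNgt; apply/negP => ft0.
  have t00 : 0 < t0.
    rewrite lt_neqAle t0_ge0 andbT; apply/eqP => E; move: ft0; rewrite -E; lra.
  have := cf t0 ltac:(lra) => /cvgr_lt/(_ 0 ft0) /nbhs_ballP[r /= r0 Hr].
  pose h := Num.min (t0 / 2) (r / 2).
  have h1 : h <= t0 / 2 by rewrite ge_min lexx.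
  have h2 : h <= r / 2 by rewrite ge_min lexx orbT.
  have h0 : 0 < h by rewrite lt_min !divr_gt0.
  have := fS (t0 - h) ltac:(lra); rewrite leNgt => /negP; apply.
  by apply: Hr; rewrite /ball /= opprB addrC subrK gtr0_norm; lra.
have t0_lt : t0 < t1.
  by rewrite lt_neqAle t0_le andbT; apply/eqP => E; move: ft1; rewrite -E; lra.
have [r r0 Hr] := step t0 ltac:(lra) ft0.
pose h := Num.min (t1 - t0) (r / 2).
have h1 : h <= t1 - t0 by rewrite ge_min lexx.
have h2 : h <= r / 2 by rewrite ge_min lexx orbT.
have h0 : 0 < h by rewrite lt_min subr_gt0 t0_lt divr_gt0.
suff : S (t0 + h) by move=> /(sup_upper_bound supS); rewrite -/t0; lra.
split; first by lra.
move=> s' /andP[s'0 s'h]; have [s't0|] := ltP s' t0; first by apply: fS; lra.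
rewrite le_eqVlt => /orP[/eqP <- //|t0s'].
by rewrite -(subrK t0 s') addrC; apply: Hr; lra.
Qed.

(** The norm can exceed [B] only by crossing it at a time when the two agree, and at such times [B]
    grows strictly faster. Comparing speeds at contact times only is what allows a bound on [u'] in
    terms of [u], as in Gronwall's inequality and in Picard iteration. *)
Lemma norm_le_of_derive V (u u' : R -> V) (B B' : R -> R) :
  (forall t : R, 0 <= t <= 1 -> is_derive t 1 u (u' t)) ->
  (forall t : R, 0 <= t <= 1 -> is_derive t 1 B (B' t)) ->
  `|u 0| <= B 0 ->
  (forall t : R, 0 <= t <= 1 -> `|u t| = B t -> `|u' t| < B' t) ->
  forall t : R, 0 <= t <= 1 -> `|u t| <= B t.
Proof.
move=> du dB u0 H t tI; rewrite -subr_ge0.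
apply: (@continuous_induction (fun t => B t - `|u t|)); rewrite ?subr_ge0 //.
  move=> s sI; have := is_derive_continuous (du s sI) => cu.
  have := is_derive_continuous (dB s sI) => cB.
  by apply: cvgB => //; exact: cvg_norm.
move=> s sI; rewrite subr_ge0 le_eqVlt => /orP[/eqP us|us].
  have sI' : 0 <= s <= 1 by lra.
  have Hs := H s sI' us.
  (* Half of the gap between the speeds absorbs the first-order error of [u], the other half that of
     [B]. *)
  pose e := (B' s - `|u' s|) / 2.
  have e0 : 0 < e by rewrite divr_gt0 // subr_gt0.
  have [r1 r10 H1] := (is_derive_approxP _ _ _).1 (du s sI') e e0.
  have [r2 r20 H2] := (is_derive_approxP _ _ _).1 (dB s sI') e e0.
  exists (Num.min r1 r2) => [|h /andP[h0]]; first by rewrite lt_min r10.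
  rewrite lt_min => /andP[hr1 hr2].
  have := H1 h; rewrite gtr0_norm // => /(_ hr1) {}H1.
  have := H2 h; rewrite gtr0_norm // => /(_ hr2) {}H2.
  rewrite subr_ge0.
  have : `|u (s + h)| <= `|u s| + h * `|u' s| + e * h.
    have -> : u (s + h) = u s + h *: u' s + (u (s + h) - u s - h *: u' s).
      by rewrite [RHS]addrC -[_ - u s - _]addrA -opprD subrK.
    apply: le_trans (ler_normD _ _) _; apply: lerD => //.
    apply: le_trans (ler_normD _ _) _; apply: lerD => //.
    by rewrite normrZ gtr0_norm.
  move: H2; rewrite ler_norml => /andP[H2 _]; rewrite /GRing.scale /= in H2.
  rewrite /e in H2 *; move: us H2; nra.
have sI' : 0 <= s <= 1 by lra.
have cf : {for s, continuous (fun t => B t - `|u t|)}.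
  have := is_derive_continuous (du s sI') => cu.
  have := is_derive_continuous (dB s sI') => cB.
  by apply: cvgB => //; exact: cvg_norm.
have /cvgr_gt/(_ 0) := cf; rewrite subr_gt0 => /(_ us) /nbhs_ballP[r /= r0 Hr].
exists r => // h /andP[h0 hr]; apply: ltW; apply: Hr.
by rewrite /ball /= opprD addrA subrr add0r normrN gtr0_norm.
Qed.

Lemma is_derive_expM (a k t : R) :
  is_derive t 1 (fun s => a * expR (k * s)) (k * (a * expR (k * t))).
Proof.
have H : is_derive t 1 (fun s => k * s) k.
  by apply: is_deriveE (is_derive_mul (is_derive_cst k t 1) (is_derive_id t 1)); rewrite /cst /=; ring.
have := is_derive_1comp (is_derive_expR (k * t)) H.
move=> /(is_derive_mul (is_derive_cst a t 1)).
by apply: is_deriveE; rewrite /cst /GRing.scale /=; ring.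
Qed.

(** The growth bound is available only while [u] stays in a tube of radius [r], and the conclusion
    itself keeps [u] there. The exponent [C + 1] in place of [C] absorbs the forcing term [e] and
    makes the comparison strict. *)
Lemma gronwall V (u u' : R -> V) (C e r : R) : 0 <= C -> 0 <= e ->
  (forall t : R, 0 <= t <= 1 -> is_derive t 1 u (u' t)) ->
  (`|u 0| + e) * expR (C + 1) < r ->
  (forall t : R, 0 <= t <= 1 -> `|u t| <= r -> `|u' t| <= C * `|u t| + e) ->
  forall t : R, 0 <= t <= 1 -> `|u t| <= (`|u 0| + e) * expR (C + 1).
Proof.
move=> C0 e0 du ur Hu t tI; rewrite leNgt; apply/negP => Ht.
set K := expR (C + 1) in ur Ht *; have K0 : 0 < K by exact: expR_gt0.
set A0 := `|u 0| + e in ur Ht.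
pose m := Num.min `|u t| r.
have A0m : A0 * K < m by rewrite lt_min Ht.
(* A midpoint: the comparison function [A * expR ((C + 1) * s)] starts strictly above [|u 0| + e]
   and still ends below both [r] and the value assumed for [|u t|]. *)
pose A := (A0 + m / K) / 2.
have A0A : A0 < m / K by rewrite ltr_pdivlMr.
have AKm : A * K < m by rewrite -ltr_pdivlMr // /A; lra.
have u00 : 0 <= `|u 0| by [].
have A0p : 0 <= A0 by rewrite /A0; lra.
have A_gt : A0 < A by rewrite /A; lra.
have BK (s : R) : 0 <= s <= 1 -> A <= A * expR ((C + 1) * s) <= A * K.
  move=> /andP[s0 s1].
  have C1 : 0 <= C + 1.

    by lra.
  have e1 : 1 <= expR ((C + 1) * s) by rewrite -[leLHS]expR0 ler_expR mulr_ge0.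
  have e2 : expR ((C + 1) * s) <= K by rewrite ler_expR; nra.
  have A_ge0 : 0 <= A by lra.
  by apply/andP; split; nra.
have : `|u t| <= A * expR ((C + 1) * t).
  apply: (norm_le_of_derive du (B := fun s => A * expR ((C + 1) * s)) (B' := fun s => (C + 1) * (A * expR ((C + 1) * s)))) => //.
  - by move=> s sI; exact: is_derive_expM.
  - by rewrite mulr0 expR0 mulr1; rewrite /A0 in A_gt; lra.
  - move=> s sI E; have /andP[B1 B2] := BK s sI.
    have mr : m <= r by rewrite ge_min lexx orbT.
    have := Hu s sI; rewrite E => /(_ ltac:(lra)) H; apply: le_lt_trans H _.
    have : e < A by rewrite /A0 in A_gt; lra.
    lra.
have /andP[_ B2] := BK t tI => H.
have mr : m <= `|u t| by rewrite ge_min lexx.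
lra.
Qed.

Lemma mean_value_le V W (f : V -> W) x h C :
  (forall t : R, 0 <= t <= 1 -> differentiable f (x + t *: h)) ->
  (forall t : R, 0 <= t <= 1 -> `|'d f (x + t *: h) h| <= C) ->
  `|f (x + h) - f x| <= C.
Proof.
move=> df dC; apply/ler_addgt0Pr => e e0.
pose u t := f (x + t *: h) - f x.
have du (t : R) : 0 <= t <= 1 -> is_derive t 1 u ('d f (x + t *: h) h).
  move=> tI; apply: (is_deriveE (subr0 _)); apply: is_derive_sub.
  exact: is_derive_comp (df _ tI) (is_derive_line _ _ _).
have dB (t : R) : 0 <= t <= 1 -> is_derive t 1 (fun s : R => s *: (C + e)) (C + e).
  by move=> _; exact: is_derive_scale.
have := norm_le_of_derive du dB; rewrite /u scale0r addr0 subrr normr0 scale0r.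
move=> /(_ (lexx _)) H.
have := H _ 1; rewrite !scale1r; apply; last by rewrite ler01 lexx.
by move=> t tI _; apply: le_lt_trans (dC t tI) _; rewrite ltrDl.
Qed.

End curves.

(** * Time-dependent fields *)

(* A time-dependent field on [0, 1] which near each of its points is the
   restriction of a field that is smooth in time and space: at the end points
   of [0, 1] no two-sided regularity in time is available. *)
Definition loc (R : realType) (V W : normedModType R) (v : R -> V -> W) :=
  forall (t : R) x, 0 <= t <= 1 -> exists U : set (R * V), exists g : R * V -> W,
    [/\ open U, U (t, x), sm U g &
        forall (t' : R) x', 0 <= t' <= 1 -> U (t', x') -> v t' x' = g (t', x')].

Section loc_theory.
Context {R : realType}.
Implicit Types V W X : normedModType R.

Lemma pair_continuous V W (t : V) : continuous (fun x : W => (t, x)).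
Proof. by move=> x; apply: cvg_pair => /=; [exact: cvg_cst|exact: cvg_id]. Qed.

Lemma continuous_pair (T : topologicalType) V W (f : T -> V) (g : T -> W) s :
  {for s, continuous f} -> {for s, continuous g} ->
  {for s, continuous (fun s => (f s, g s))}.
Proof. by move=> cf cg; exact: cvg_pair cf cg. Qed.

Lemma near_slice V W (U : set (V * W)) t x : open U -> U (t, x) ->
  \forall y \near x, U (t, y).
Proof. by move=> oU Ux; exact: (@pair_continuous V W t x U (near_open oU Ux)). Qed.

Lemma diff_slice V W X (g : V * W -> X) t x : differentiable g (t, x) ->
  differentiable (fun y => g (t, y)) x /\
  forall h, 'd (fun y => g (t, y)) x h = 'd g (t, x) (0, h).
Proof.
move=> dg.
have dp : differentiable (fun y : W => (t, y)) x by exact: differentiable_pair.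
split; first exact: (differentiable_comp dp).
move=> h; rewrite (diff_compE _ dp) // diff_pairE //.
by rewrite (diff_cst t) diff_val.
Qed.

Lemma loc_diffE V W (v : R -> V -> W) U g (t : R) x : 0 <= t <= 1 ->
  open U -> U (t, x) -> sm U g ->
  (forall (t' : R) x', 0 <= t' <= 1 -> U (t', x') -> v t' x' = g (t', x')) ->
  differentiable (v t) x /\ forall h, 'd (v t) x h = 'd g (t, x) (0, h).
Proof.
move=> tI oU Ux sg vg.
have [dg dgE] := diff_slice (sm_differentiable sg Ux).
have E : \forall y \near x, g (t, y) = v t y.
  by apply: filterS (near_slice oU Ux) => y Uy; rewrite vg.
have [dv dvE] := near_eq_differentiable E dg.
split; first exact: dv.
by move=> h; rewrite -dgE; exact: (congr1 (fun F : V -> W => F h) dvE).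
Qed.

Lemma loc_differentiable V W (v : R -> V -> W) (t : R) x : loc v ->
  0 <= t <= 1 -> differentiable (v t) x.
Proof.
move=> lv tI; have [U [g [oU Ux sg vg]]] := lv t x tI.
by have [] := loc_diffE tI oU Ux sg vg.
Qed.

Lemma loc_sm V W (g : R * V -> W) : sm setT g -> loc (fun t x => g (t, x)).
Proof. by move=> sg t x tI; exists setT, g; split => //; exact: openT. Qed.

Lemma loc_precomp V W X (v : R -> V -> W) (f : R * X -> V) :
  loc v -> sm setT f -> loc (fun t x => v t (f (t, x))).
Proof.
move=> lv sf t x tI; have [U [g [oU Ux sg vg]]] := lv t (f (t, x)) tI.
have sF : sm [set: R * X] (fun z => (z.1, f z)).
  by apply: sm_pair => //; [exact: openT|exact: sm_fst].
pose U' : set (R * X) := (fun z => (z.1, f z)) @^-1` U.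
have oU' : open U' by apply: open_comp => // z _; exact: sm_continuous sF _.
exists U', (fun z => g (z.1, f z)); split=> //.
- by apply: (sm_comp oU' oU _ (sm_sub _ sF) sg).
- by move=> t' x' t'I; exact: vg.
Qed.

Lemma loc_postcomp V W X (v : R -> V -> W) (f : W -> X) :
  loc v -> sm setT f -> loc (fun t x => f (v t x)).
Proof.
move=> lv sf t x tI; have [U [g [oU Ux sg vg]]] := lv t x tI.
exists U, (fun z => f (g z)); split=> //; first exact: sm_compT oU sg sf.
by move=> t' x' t'I Ux'; rewrite vg.
Qed.

Lemma loc_pair V W X (v : R -> V -> W) (w : R -> V -> X) :
  loc v -> loc w -> loc (fun t x => (v t x, w t x)).
Proof.
move=> lv lw t x tI; have [U [g [oU Ux sg vg]]] := lv t x tI.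
have [U' [g' [oU' Ux' sg' wg]]] := lw t x tI.
have oI := openI oU oU'.
exists (U `&` U'), (fun z => (g z, g' z)); split=> //.
  apply: sm_pair => //; [exact: sm_sub sg|exact: sm_sub sg'].
by move=> t' x' t'I [Uy Uy']; rewrite vg // wg.
Qed.

Lemma loc_diff V W (v : R -> V -> W) : loc v ->
  loc (fun t (z : V * V) => 'd (v t) (z.1) z.2).
Proof.
move=> lv t [x h] tI; have [U [g [oU Ux sg vg]]] := lv t x tI.
pose F (z : R * (V * V)) : (R * V) * (R * V) := ((z.1, z.2.1), (0, z.2.2)).
have oT (X : normedModType R) : open [set: X] by exact: openT.
have s1 : sm [set: R * (V * V)] (fun z => z.2.1).
  exact: (sm_compT (oT _) (sm_snd _) (@sm_fst _ _ _ _)).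
have s2 : sm [set: R * (V * V)] (fun z => z.2.2).
  exact: (sm_compT (oT _) (sm_snd _) (@sm_snd _ _ _ _)).
have s3 : sm [set: R * (V * V)] (fun z => z.1) by exact: sm_fst.
have sF : sm setT F.
  by apply: sm_pair => //; apply: sm_pair => //; exact: sm_cst.
pose U' : set (R * (V * V)) := F @^-1` (U `*` setT).
have oU' : open U'.
  apply: open_comp; last exact: open_setXT.
  by move=> z _; exact: sm_continuous sF _.
exists U', (fun z => 'd g ((F z).1) (F z).2); split=> //.
  exact: (sm_comp oU' (open_setXT oU) _ (sm_sub _ sF) (sm_diff sg)).
move=> t' [x' h'] t'I [/= Ux' _].
by have [_ ->] := loc_diffE t'I oU Ux' sg vg.
Qed.

(** Retracts the line onto [0, 1]. Fields are meaningful for these times only, whereas primitives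
    are taken of curves that are continuous on the whole line. *)
Definition clamp (s : R) : R := Num.max 0 (Num.min 1 s).

Lemma clamp01 s : 0 <= clamp s <= 1.
Proof. by rewrite /clamp le_max lexx /= ge_max ler01 ge_min lexx. Qed.

Lemma clamp_id s : 0 <= s <= 1 -> clamp s = s.
Proof. by move=> /andP[s0 s1]; rewrite /clamp (min_idPr s1) (max_idPr s0). Qed.

Lemma clamp_continuous : continuous clamp.
Proof.
move=> s; apply: (@continuous_max R R (cst 0) (fun s => Num.min 1 s)).
  exact: cvg_cst.
by apply: (@continuous_min R R (cst 1) id); [exact: cvg_cst|exact: cvg_id].
Qed.

Lemma loc_curve_continuous V W (v : R -> V -> W) (c : R -> V) :
  loc v -> continuous c -> continuous (fun s => v (clamp s) (c s)).
Proof.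
move=> lv cc s; have [U [g [oU Ux sg vg]]] := lv (clamp s) (c s) (clamp01 s).
have cF : {for s, continuous (fun s => (clamp s, c s))}.
  by apply: continuous_pair; [exact: clamp_continuous|exact: cc].
rewrite /prop_for /continuous_at (vg _ _ (clamp01 s) Ux).
have cg : {for s, continuous (fun s => g (clamp s, c s))}.
  by apply: (continuous_comp cF); exact: sm_continuous sg Ux.
apply: cvg_trans cg; apply: near_eq_cvg.
have : \forall z \near s, U (clamp z, c z) by exact: (cF U (near_open oU Ux)).
by apply: filterS => z Uz; rewrite vg //; exact: clamp01.
Qed.

Lemma norm_pair_lt V W (x : V) (y : W) r : (`|(x, y)| < r) = (`|x| < r) && (`|y| < r).
Proof. by rewrite prod_normE gt_max. Qed.

Lemma norm_pair_le V W (x : V) (y : W) r : (`|(x, y)| <= r) = (`|x| <= r) && (`|y| <= r).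
Proof. by rewrite prod_normE ge_max. Qed.

(** By homogeneity [h] may be rescaled to norm [d / 2], inside the open ball; hence the factor 2. *)
Lemma scaled_bound V W (f : V -> W) (d C : R) : 0 < d -> 0 <= C ->
  (forall a h, f (a *: h) = a *: f h) ->
  (forall h, `|h| < d -> `|f h| <= C) -> forall h, `|f h| <= (2 * C / d) * `|h|.
Proof.
move=> d0 C0 fZ H h; have [->|h0] := eqVneq h 0.
  by rewrite -(scale0r (0 : V)) fZ !scale0r normr0 normr0 mulr0.
have nh : 0 < `|h| by rewrite normr_gt0.
pose k := d / (2 * `|h|).
have k0 : 0 < k by rewrite divr_gt0 // mulr_gt0.
have := H (k *: h); rewrite normrZ (gtr0_norm k0).
have -> : k * `|h| = d / 2 by rewrite /k; field; rewrite gt_eqF.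
move=> /(_ ltac:(lra)); rewrite fZ normrZ (gtr0_norm k0).
rewrite -ler_pdivlMl // => /le_trans; apply.
by rewrite le_eqVlt; apply/orP; left; apply/eqP; rewrite /k; field; rewrite !gt_eqF.
Qed.

(** The differential is jointly continuous in time, point and direction, and zero in direction 0;
    near each time it is therefore below 1 for small directions, and homogeneity turns this into an
    operator bound. Compactness of [0, 1] makes it uniform, with one integer [n] serving as bound
    and as inverse radius. *)
Lemma loc_diff_bound V W (v : R -> V -> W) (c : R -> V) : loc v ->
  (forall t : R, 0 <= t <= 1 -> {for t, continuous c}) ->
  exists r, exists2 C, 0 < r /\ 0 <= C &
    forall (t : R) y, 0 <= t <= 1 -> `|y - c t| <= r ->
      forall h, `|'d (v t) y h| <= C * `|h|.
Proof.
move=> lv cc.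
pose P (n : nat) (t : R) := 0 <= t <= 1 -> forall y, `|y - c t| <= n.+1%:R^-1 ->
  forall h, `|'d (v t) y h| <= n.+1%:R * `|h|.
have : \forall n \near \oo, `[0, 1]%classic `<=` P n.
  have /compact_near_coveringP := @segment_compact R 0 1.
  apply => t0; rewrite /= in_itv /= => t0I.
  have [U [g [oU Ux sg vg]]] := loc_diff lv (c t0, 0) t0I.
  have g0 : g (t0, (c t0, 0)) = 0 by rewrite -vg //= linear0.
  have cg := sm_continuous sg Ux.
  have : \forall z \near (t0, (c t0, 0 : V)), U z /\ `|g z| < 1.
    apply: filterI; first exact: (near_open oU Ux).
    by apply: (cvgr_norm_lt _ cg); rewrite g0 normr0 ltr01.
  move=> /nbhs_ballP[d /= d0 Hd].
  have /cvgr_dist_lt /(_ (d / 2)) := cc t0 t0I.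
  rewrite divr_gt0 // => /(_ isT) Hc.
  have Ht : \forall t \near t0, `|t0 - t| < d by apply/nbhs_ballP; exists d.
  have nN : \forall n \near \oo, 2 / d < n%:R.
    near=> n; apply: lt_le_trans (_ : (Num.truncn (2 / d)).+1%:R <= _).
      by have := truncnS_gt (2 / d).
    by rewrite ler_nat; near: n; exact: nbhs_infty_ge.
  near=> t n => tI y yc h.
  have dc : `|c t0 - c t| < d / 2 by near: t.
  have dt : `|t0 - t| < d by near: t; exact: Ht.
  have n2 : 2 / d < n%:R by near: n.
  have n1 : n%:R < n.+1%:R :> R by rewrite ltr_nat.
  have nV : n.+1%:R^-1 < d / 2.
    rewrite invf_plt ?posrE ?divr_gt0 //; rewrite invf_div; lra.
  have H h' : `|h'| < d -> `|'d (v t) y h'| <= 1.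
    move=> h'd; have [Uz gz] : U (t, (y, h')) /\ `|g (t, (y, h'))| < 1.
      apply: Hd; rewrite -ball_normE /=.
      rewrite !norm_pair_lt dt /= sub0r normrN h'd andbT.
      rewrite -(subrK (c t) y) opprD addrA addrAC.
      apply: le_lt_trans (ler_normD _ _) _; rewrite normrN; have := le_lt_trans yc nV; lra.
    by have /= -> := vg _ (y, h') tI Uz; exact: ltW.
  have fZ a h' : 'd (v t) y (a *: h') = a *: 'd (v t) y h' by rewrite linearZ.
  apply: le_trans (scaled_bound d0 ler01 fZ H h) _.
  by apply: ler_wpM2r => //; lra.
move=> [N _ /(_ N (leqnn N)) HN].
exists (N.+1%:R^-1), N.+1%:R; first by rewrite invr_gt0 ltr0n ler0n.
by move=> t y tI; apply: HN => //; rewrite /= in_itv.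
Unshelve. all: by end_near. Qed.

Lemma ball_segment V (a x y : V) r (s : R) : 0 <= s <= 1 ->
  `|x - a| <= r -> `|y - a| <= r -> `|x + s *: (y - x) - a| <= r.
Proof.
move=> /andP[s0 s1] xr yr.
have -> : x + s *: (y - x) - a = (1 - s) *: (x - a) + s *: (y - a).
  have -> : s *: (y - x) = s *: (y - a) - s *: (x - a).
    by rewrite -scalerBr opprB addrA subrK.
  by rewrite scalerBl scale1r [in LHS]addrAC [_ *: _ - _ in LHS]addrC addrA.
apply: le_trans (ler_normD _ _) _; rewrite !normrZ (ger0_norm s0) ger0_norm; last lra.
have -> : r = (1 - s) * r + s * r by ring.
by apply: lerD; apply: ler_wpM2l => //; lra.
Qed.

Lemma loc_lipschitz V W (v : R -> V -> W) (c : R -> V) : loc v ->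
  (forall t : R, 0 <= t <= 1 -> {for t, continuous c}) ->
  exists r, exists2 C, 0 < r /\ 0 <= C &
    forall (t : R) x y, 0 <= t <= 1 -> `|x - c t| <= r -> `|y - c t| <= r ->
      `|v t y - v t x| <= C * `|y - x|.
Proof.
move=> lv cc; have [r [C rC H]] := loc_diff_bound lv cc.
exists r, C => // t x y tI xr yr.
rewrite -[y in v t y](subrK x) [y - x + x]addrC.
apply: mean_value_le => s sI; first exact: loc_differentiable.
by apply: H => //; exact: ball_segment.
Qed.

(** The differential of [v] is again a [loc] field, hence Lipschitz along the curve, so the mean
    value inequality for [v t] minus its linear part leaves a quadratic error, uniformly in time. *)
Lemma loc_remainder V W (v : R -> V -> W) (c : R -> V) : loc v ->
  (forall t : R, 0 <= t <= 1 -> {for t, continuous c}) ->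
  exists r, exists2 C, 0 < r /\ 0 <= C &
    forall (t : R) k, 0 <= t <= 1 -> `|k| <= r ->
      `|v t (c t + k) - v t (c t) - 'd (v t) (c t) k| <= C * `|k| ^+ 2.
Proof.
move=> lv cc.
have cc0 (t : R) : 0 <= t <= 1 -> {for t, continuous (fun t => (c t, 0 : V))}.
  by move=> tI; apply: continuous_pair; [exact: cc|exact: cvg_cst].
have [r [C [r0 C0] H]] := loc_lipschitz (loc_diff lv) cc0.
exists r, (2 * C / r) => [|t k tI kr].
  by split => //; rewrite divr_ge0 ?mulr_ge0 // ltW.
pose L : {linear V -> W} := 'd (v t) (c t).
have cL : continuous L by apply: diff_continuous; exact: loc_differentiable.
have dL y : differentiable L y by exact: linear_differentiable.
have dv y : differentiable (v t) y by exact: loc_differentiable.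
have -> : v t (c t + k) - v t (c t) - L k =
    (fun y => v t y - L y) (c t + k) - (fun y => v t y - L y) (c t).
  by rewrite /= linearD opprB opprD !addrA [_ - L (c t) - _]addrAC subrK addrAC.
apply: (@mean_value_le _ _ _ (fun y => v t y - L y)) => s sI.
  exact: differentiableB.
have -> : 'd (fun y => v t y - L y) (c t + s *: k) k = 'd (v t) (c t + s *: k) k - L k.
  apply: etrans (congr1 (fun F : V -> W => F k) (diffB (dv _) (dL _))) _.
  by congr (_ - _); exact: (congr1 (fun F : V -> W => F k) (diff_lin _ _)).
have sk (y : V) : `|y| <= r -> `|s *: y| <= r.
  move=> yr; rewrite normrZ ger0_norm; last lra.
  by apply: le_trans yr; rewrite ler_piMl //; lra.
have key h : `|h| < r -> `|'d (v t) (c t + s *: k) h - L h| <= C * `|k|.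
  move=> hr; have := H t (c t, h) (c t + s *: k, h) tI.
  rewrite !norm_pair_le subrr normr0 subr0 (ltW hr) (ltW r0) /= => /(_ isT).
  rewrite addrAC subrr add0r sk // => /(_ isT) /le_trans; apply.
  apply: ler_wpM2l => //; rewrite norm_pair_le addrAC subrr add0r subrr normr0 normr_ge0 andbT.
  by rewrite normrZ ger0_norm ?ler_piMl //; lra.
have Ck : 0 <= C * `|k| by rewrite mulr_ge0.
have fZ a h : 'd (v t) (c t + s *: k) (a *: h) - L (a *: h) =
    a *: ('d (v t) (c t + s *: k) h - L h) by rewrite scalerBr /L !linearZ.
have := scaled_bound r0 Ck fZ key k.
by have -> : 2 * (C * `|k|) / r * `|k| = 2 * C / r * `|k| ^+ 2 by ring.
Qed.

End loc_theory.

(** * Existence and smooth dependence for ordinary differential equations *)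

(* What Picard iteration needs of the state space: primitives of curves, and
   completeness for geometric series. Both are stable under products. *)
Definition good (R : realType) (V : normedModType R) :=
  (forall c : R -> V, continuous c -> exists P : R -> V,
     forall t : R, 0 <= t <= 1 -> is_derive t 1 P (c t)) /\
  (forall (x : nat -> V) (M : R),
     (forall n, `|x n.+1 - x n| <= M * 2^-1 ^+ n) ->
     exists l, forall n, `|x n - l| <= 2 * M * 2^-1 ^+ n).

Section picard.
Context {R : realType}.
Implicit Types V W : normedModType R.

Lemma good_prod V W : good V -> good W -> good (V * W)%type.
Proof.
move=> [pV cV] [pW cW]; split=> [c cc|x M Hx].
  have [P HP] := pV (fun t => (c t).1) ltac:(by move=> t;
    apply: (continuous_comp (cc t)); exact: cvg_fst).
  have [Q HQ] := pW (fun t => (c t).2) ltac:(by move=> t;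
    apply: (continuous_comp (cc t)); exact: cvg_snd).
  exists (fun t => (P t, Q t)) => t tI.
  by apply: (is_deriveE _ (is_derive_pair (HP t tI) (HQ t tI))); case: (c t).
have [l Hl] : exists l, forall n, `|(x n).1 - l| <= 2 * M * 2^-1 ^+ n.
  apply: cV => n; have := Hx n; rewrite -[x n.+1 - x n]/((_, _)) norm_pair_le.
  by case/andP.
have [m Hm] : exists l, forall n, `|(x n).2 - l| <= 2 * M * 2^-1 ^+ n.
  apply: cW => n; have := Hx n; rewrite -[x n.+1 - x n]/((_, _)) norm_pair_le.
  by case/andP.
exists (l, m) => n; have -> : x n - (l, m) = ((x n).1 - l, (x n).2 - m) by case: (x n).
by rewrite norm_pair_le Hl Hm.
Qed.

Lemma good_real : good R.
Proof.
split=> [c cc|x M Hx].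
  (* Integrating from -1, on the interval [-1, 2], makes 0 and 1 interior points, where the
     derivative is two-sided. *)
  pose P x : R := (\int[@lebesgue_measure R]_(t in [set` `[(-1)%R, x]]) (c t))%R.
  exists P => t tI.
  have ci : (@lebesgue_measure R).-integrable `[(-1)%R, 2%R] (EFin \o c).
    apply: continuous_compact_integrable; first exact: segment_compact.
    exact: continuous_subspaceT.
  have t2 : t < 2 by lra.
  have t1 : -1 < t by lra.
  have [dP PE] := continuous_FTC1_closed t2 ci t1 (cc t).
  by split; [exact: dP|rewrite -derive1E].
have H0 : 0 <= M by have := Hx 0%N; rewrite expr0 mulr1; apply: le_trans.
pose h n : R := 2^-1 ^+ n.
have hS n : h n.+1 = h n / 2 by rewrite /h exprS mulrC.
have h0 n : 0 < h n by rewrite /h exprn_gt0.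
(* Nested intervals: the lower ends [x m - 2 * M * h m] increase, the upper ends decrease, and the
   limit is the supremum of the lower ends. *)
have inc : forall m n, (m <= n)%N -> x m - 2 * M * h m <= x n - 2 * M * h n.
  move=> m n /subnK <-; elim: (n - m)%N => // k; rewrite addSn => /le_trans; apply.
  have := Hx (k + m)%N; rewrite -/(h _) hS ler_norml => /andP[+ _]; lra.
have dec : forall m n, (m <= n)%N -> x n + 2 * M * h n <= x m + 2 * M * h m.
  move=> m n /subnK <-; elim: (n - m)%N => // k; rewrite addSn; apply: le_trans.
  have := Hx (k + m)%N; rewrite -/(h _) hS ler_norml => /andP[_ +]; lra.
have cross m n : x m - 2 * M * h m <= x n + 2 * M * h n.
  have P k : 0 <= 2 * M * h k by rewrite !mulr_ge0 // ltW.
  have [mn|/ltnW nm] := leqP m n.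
    by have := inc m n mn; have := P n; lra.
  by have := dec n m nm; have := P m; lra.
pose S := range (fun m => x m - 2 * M * h m).
have S0 : S !=set0 by exists (x 0%N - 2 * M * h 0%N); exists 0%N.
exists (sup S) => n; rewrite ler_norml; apply/andP; split.
  suff : sup S <= x n + 2 * M * h n by rewrite /h; lra.
  by apply: ge_sup => // _ [m _ <-]; exact: cross.
suff : x n - 2 * M * h n <= sup S by rewrite /h; lra.
apply: sup_upper_bound; last by exists n.
by split => //; exists (x 0%N + 2 * M * h 0%N) => _ [m _ <-]; exact: cross.
Qed.

Lemma continuous_bounded01 V (c : R -> V) : continuous c ->
  exists2 M, 0 < M & forall t : R, 0 <= t <= 1 -> `|c t| <= M.
Proof.
move=> cc.
have cn : {within `[0 : R, 1], continuous (fun t => `|c t|)}.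
  by apply: continuous_subspaceT => t; apply: cvg_norm; exact: cc.
have [t0 _ H] := EVT_max ler01 cn.
exists (`|c t0| + 1) => [|t tI]; first by rewrite ltr_wpDl.
by apply: le_trans (H t _) _; [rewrite in_itv|rewrite lerDl].
Qed.

Lemma picard V (f : R -> V -> V) (C : R) x0 : good V -> 0 <= C ->
  (forall c : R -> V, continuous c -> continuous (fun s => f (clamp s) (c s))) ->
  (forall (t : R) x y, 0 <= t <= 1 -> `|f t x - f t y| <= C * `|x - y|) ->
  exists c : R -> V, c 0 = x0 /\
    forall t : R, 0 <= t <= 1 -> is_derive t 1 c (f t (c t)).
Proof.
move=> [prim compl] C0 cf lf.
have I0 : 0 <= (0 : R) <= 1 by rewrite lexx ler01.
have step (c : R -> V) : continuous c -> exists P : R -> V, P 0 = x0 /\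
    forall t : R, 0 <= t <= 1 -> is_derive t 1 P (f t (c t)).
  move=> cc; have [P HP] := prim _ (cf c cc).
  exists (fun t => x0 + (P t - P 0)); split; first by rewrite subrr addr0.
  move=> t tI; apply: (is_deriveE (add0r _)); apply: is_derive_add.
  apply: (is_deriveE (subr0 _)); apply: is_derive_sub.
  by have := HP t tI; rewrite clamp_id.
have cclamp (P : R -> V) : (forall t : R, 0 <= t <= 1 -> {for t, continuous P}) ->
    continuous (fun s => P (clamp s)).
  move=> cP s; apply: (continuous_comp (clamp_continuous (x := s))).
  exact/cP/clamp01.
pose T (c : {c : R -> V | continuous c}) : R -> V := sval (cid (step _ (svalP c))).
have T0 c : T c 0 = x0 by rewrite /T; case: cid => P [].
have Td c (t : R) : 0 <= t <= 1 -> is_derive t 1 (T c) (f t (sval c t)).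
  by rewrite /T; case: cid => P /= [_ HP]; exact: HP.
have Tc c : continuous (fun s => T c (clamp s)).
  by apply: cclamp => t tI; exact: is_derive_continuous (Td c t tI).
have ccst : continuous (cst x0 : R -> V) by move=> t; exact: cvg_cst.
(* Each iterate is precomposed with [clamp], which keeps it continuous on the whole line without
   changing it on [0, 1]. *)
pose X n := iter n (fun c => exist (fun c : R -> V => continuous c) _ (Tc c))
  (exist (fun c : R -> V => continuous c) _ ccst).
have XS n (t : R) : 0 <= t <= 1 -> sval (X n.+1) t = T (X n) t.
  by move=> tI; change (T (X n) (clamp t) = T (X n) t); rewrite clamp_id.
have [M M0 HM] := continuous_bounded01 (cf _ ccst).
(* With the weight [expR (K * t)] the Picard map contracts by a factor 2 on all of [0, 1], so no
   subdivision of the time interval is needed. *)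
pose K := 2 * C + 2.
have K0 : 0 < K by rewrite /K; lra.
pose b n (t : R) := (M * 2^-1 ^+ n) * expR (K * t).
have b0 n t : 0 < b n t by rewrite mulr_gt0 ?expR_gt0 // mulr_gt0 ?exprn_gt0.
have db n (t : R) : 0 <= t <= 1 -> is_derive t 1 (b n) (K * b n t).
  by move=> _; exact: is_derive_expM.
have Xb n : forall t : R, 0 <= t <= 1 -> `|sval (X n.+1) t - sval (X n) t| <= b n t.
  elim: n => [|n IH] t tI.
    rewrite XS //; apply: (norm_le_of_derive (u := fun t => T (X 0%N) t - x0)
      (u' := fun s => f s x0) _ (db 0%N)) => //.
    - move=> s sI; apply: (is_deriveE (subr0 _)); apply: is_derive_sub.
      exact: (Td (X 0%N)).
    - by rewrite T0 subrr normr0 ltW.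
    - move=> s sI _; have := HM s sI; rewrite clamp_id // => Hs.
      apply: le_lt_trans Hs _; rewrite /b expr0 mulr1.
      have e1 : 1 <= expR (K * s).
        by rewrite -[leLHS]expR0 ler_expR mulr_ge0 ?(ltW K0) //; case/andP: sI.
      have K2 : 2 <= K by rewrite /K; lra.
      have : M <= M * expR (K * s) by rewrite ler_peMr // ltW.
      have : 0 < M * expR (K * s) by rewrite mulr_gt0 ?expR_gt0.
      nra.
  rewrite !XS //; apply: (norm_le_of_derive (u := fun t => T (X n.+1) t - T (X n) t)
    (u' := fun s => f s (sval (X n.+1) s) - f s (sval (X n) s)) _ (db n.+1)) => //.
  - by move=> s sI; apply: is_derive_sub; exact: Td.
  - by rewrite !T0 subrr normr0 ltW.
  - move=> s sI _; apply: le_lt_trans (lf _ _ _ sI) _.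
    apply: le_lt_trans (_ : C * b n s < _); first by rewrite ler_wpM2l ?IH.
    have -> : b n s = 2 * b n.+1 s by rewrite /b exprS; field.
    have := b0 n.+1 s; rewrite /K; lra.
have eK : 0 < expR K by exact: expR_gt0.
have Xb' n (t : R) : 0 <= t <= 1 -> `|sval (X n.+1) t - sval (X n) t| <= (M * expR K) * 2^-1 ^+ n.
  move=> tI; apply: le_trans (Xb n t tI) _; rewrite /b mulrAC ler_wpM2r ?exprn_ge0 //.
  rewrite ler_wpM2l ?(ltW M0) // ler_expR; case/andP: tI => t0 t1; nra.
have [y Hy] : exists y : R -> V, forall t : R, 0 <= t <= 1 -> forall n,
    `|sval (X n) t - y t| <= 2 * (M * expR K) * 2^-1 ^+ n.
  have E (t : R) : exists l : V, 0 <= t <= 1 -> forall n,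
      `|sval (X n) t - l| <= 2 * (M * expR K) * 2^-1 ^+ n.
    have [tI|tI] := pselect (0 <= t <= 1 : Prop); last by exists x0.
    by have [l Hl] := compl _ _ (fun n => Xb' n t tI); exists l.
  by exists (fun t => sval (cid (E t))) => t; case: cid.
set D := 2 * (M * expR K) in Hy.
have D0 : 0 < D by rewrite !mulr_gt0.
have small e : 0 < e -> exists n, D * 2^-1 ^+ n < e.
  move=> e0; have : (2^-1 ^+ n : R) @[n --> \oo] --> 0 by apply: cvg_expr; rewrite ger0_norm //; lra.
  move=> /cvgr_lt/(_ (e / D)); rewrite divr_gt0 // => /(_ isT) [n _ /(_ n (leqnn n)) Hn].
  by exists n; rewrite mulrC -ltr_pdivlMr.
have cy : continuous (fun s => y (clamp s)).
  move=> s; apply/cvgrPdist_lt => e e0; have [n Hn] := small (e / 3) ltac:(lra).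
  have := svalP (X n.+1) s; rewrite /continuous_at /= => /cvgrPdist_lt/(_ (e / 3) ltac:(lra)).
  apply: filterS => s' Hs'.
  have H1 := Hy _ (clamp01 s) n.+1; have H2 := Hy _ (clamp01 s') n.+1.
  rewrite !XS ?clamp01 // in H1 H2.
  have hn : D * 2^-1 ^+ n.+1 < e / 3.
    apply: le_lt_trans Hn; rewrite ler_pM2l // exprS ler_piMl ?exprn_ge0 //; lra.
  have -> : y (clamp s) - y (clamp s') = - (T (X n) (clamp s) - y (clamp s)) +
     ((T (X n) (clamp s) - T (X n) (clamp s')) + (T (X n) (clamp s') - y (clamp s'))).
    by rewrite opprB addrA [y _ - _ + _]addrA subrK addrA subrK.
  apply: le_lt_trans (ler_normD _ _) _; rewrite normrN.
  have := ler_normD (T (X n) (clamp s) - T (X n) (clamp s')) (T (X n) (clamp s') - y (clamp s')).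
  lra.
(* One more Picard step, applied to the uniform limit [y], gives a differentiable curve [Y];
   comparison with the iterates shows that [Y = y], so that [Y] solves the equation. *)
have [Y [Y0 dY]] := step _ cy.
have YE (t : R) : 0 <= t <= 1 -> Y t = y t.
  move=> tI; apply/eqP; rewrite -subr_eq0 -normr_le0; apply/ler_addgt0Pr => e e0; rewrite add0r.
  have [n Hn] := small (e / (C + 2)) ltac:(by rewrite divr_gt0 //; lra).
  have C2 : 0 < C + 2 by lra.
  rewrite ltr_pdivlMr // in Hn.
  pose d := D * 2^-1 ^+ n; have d0 : 0 < d by rewrite mulr_gt0 ?exprn_gt0.
  have : `|Y t - T (X n) t| <= t *: (C * d + d / 2).
    apply: (norm_le_of_derive (u := fun t => Y t - T (X n) t)
      (u' := fun s => f s (y (clamp s)) - f s (sval (X n) s)) (B := fun t => t *: (C * d + d / 2)) (B' := fun=> C * d + d / 2)) => //.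
    - by move=> s sI; apply: is_derive_sub; [exact: dY|exact: Td].
    - by move=> s _; exact: is_derive_scale.
    - by rewrite Y0 T0 subrr normr0 scale0r.
    - move=> s sI _; apply: le_lt_trans (lf _ _ _ sI) _.
      have := Hy s sI n; rewrite -/d distrC clamp_id // => H.
      by have := ler_wpM2l C0 H; lra.
  have := Hy t tI n.+1; rewrite XS // => H2 H1.
  have -> : Y t - y t = (Y t - T (X n) t) + (T (X n) t - y t) by rewrite addrA subrK.
  apply: le_trans (ler_normD _ _) _.
  have hn : D * 2^-1 ^+ n.+1 = d / 2 by rewrite exprS /d; field.
  have : t *: (C * d + d / 2) <= C * d + d / 2.
    by rewrite ler_piMl //; [nra|case/andP: tI].
  rewrite -/d in Hn; nra.
exists Y; split => // t tI; have := dY t tI.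
by rewrite clamp_id // YE.
Qed.

End picard.

Section flows.
Context {R : realType}.
Implicit Types V W : normedModType R.

Definition solves V (v : R -> V -> V) (c : R -> V) :=
  forall t : R, 0 <= t <= 1 -> is_derive t 1 c (v t (c t)).

Lemma solves_continuous V (v : R -> V -> V) (c : R -> V) : solves v c ->
  forall t : R, 0 <= t <= 1 -> {for t, continuous c}.
Proof. by move=> sc t tI; exact: is_derive_continuous (sc t tI). Qed.

Lemma ode_stable V (v : R -> V -> V) (c : R -> V) : loc v -> solves v c ->
  exists r, exists2 K, 0 < r /\ 0 <= K & forall c', solves v c' ->
    `|c' 0 - c 0| < r ->
    forall t : R, 0 <= t <= 1 -> `|c' t - c t| <= K * `|c' 0 - c 0|.
Proof.
move=> lv sc; have [r [C [r0 C0] H]] := loc_lipschitz lv (solves_continuous sc).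
set K := expR (C + 1); have K0 : 0 < K by exact: expR_gt0.
exists (r / K), K; first by rewrite divr_gt0 // ltW.
move=> c' sc' c'r t tI.
have := @gronwall _ _ (fun t => c' t - c t) (fun t => v t (c' t) - v t (c t)) C 0 r.
rewrite addr0 -/K mulrC; apply => //.
- by move=> s sI; apply: is_derive_sub; [exact: sc'|exact: sc].
- by rewrite mulrC -ltr_pdivlMr.
move=> s sI sr; rewrite addr0; apply: H => //.
by rewrite subrr normr0 ltW.
Qed.

Lemma ode_unique V (v : R -> V -> V) (c c' : R -> V) : loc v -> solves v c ->
  solves v c' -> c' 0 = c 0 -> forall t : R, 0 <= t <= 1 -> c' t = c t.
Proof.
move=> lv sc sc' cc t tI; have [r [K [r0 K0] H]] := ode_stable lv sc.
have := H c' sc'; rewrite cc subrr normr0 => /(_ r0 t tI).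
by rewrite mulr0 normr_le0 subr_eq0 => /eqP.
Qed.

(** The lift of the field to the tangent bundle: its flow is the flow of [v] together with its
    differential. *)
Definition prolong V (v : R -> V -> V) (t : R) (z : V * V) : V * V :=
  (v t z.1, 'd (v t) (z.1) z.2).

Lemma loc_prolong V (v : R -> V -> V) : loc v -> loc (prolong v).
Proof.
move=> lv; apply: loc_pair; last exact: loc_diff.
have s2 : sm [set: R * (V * V)] (fun z => z.2.1).
  by apply: (@sm_compT _ _ _ _ _ snd fst); [exact: openT|exact: sm_snd|exact: sm_fst].
exact: (loc_precomp lv s2).
Qed.

Lemma ode_variation V (v : R -> V -> V) (c : R -> V) h : good V -> loc v ->
  solves v c -> exists D : R -> V, D 0 = h /\
    forall t : R, 0 <= t <= 1 -> is_derive t 1 D ('d (v t) (c t) (D t)).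
Proof.
move=> gV lv sc.
have [r [C [r0 C0] H]] := loc_diff_bound lv (solves_continuous sc).
apply: (@picard _ _ (fun t => 'd (v t) (c t)) C) => //.
  move=> D cD.
  apply: (@loc_curve_continuous _ _ _ _ (fun s => (c (clamp s), D s)) (loc_diff lv)).
  move=> s; apply: continuous_pair; last exact: cD.
  apply: (continuous_comp (clamp_continuous (x := s))).
  exact/(solves_continuous sc)/clamp01.
move=> t x y tI; rewrite -linearB; apply: H => //.
by rewrite subrr normr0 ltW.
Qed.

Lemma diff_of_remainder V W (f : V -> W) (L : {linear V -> W}) x (r Q : R) :
  continuous L -> 0 < r -> 0 <= Q ->
  (forall h, `|h| < r -> `|f (x + h) - f x - L h| <= Q * `|h| ^+ 2) ->
  differentiable f x /\ forall h, 'd f x h = L h.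
Proof.
move=> cL r0 Q0 H.
have Hf : f \o shift x = cst (f x) + L +o_ (0 : V) id.
  apply/eqaddoP => e e0.
  have d0 : 0 < Num.min r (e / (Q + 1)) by rewrite lt_min r0 divr_gt0 //; lra.
  apply/nbhs_ballP; exists (Num.min r (e / (Q + 1))) => //= y.
  rewrite -ball_normE /= sub0r normrN lt_min => /andP[yr ye].
  rewrite !fctE /= opprD addrA [y + x]addrC; apply: le_trans (H y yr) _.
  rewrite expr2 mulrA ler_wpM2r //.
  rewrite ltr_pdivlMr in ye; last lra.
  have := normr_ge0 y; nra.
have E := diff_unique cL Hf.
by split; [apply/diff_locallyP; rewrite E|move=> h; rewrite E].
Qed.

(** Linearity in [h] comes from uniqueness for the prolonged field. The error
    [Phi (x + h) - Phi x - D h] starts at zero and solves the variational equation with a forcing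
    quadratic in [h], so by Gronwall it is quadratic in [h] at time one. *)
Lemma flow_diff V (v : R -> V -> V) (Phi : V -> R -> V) x (D : V -> R -> V) :
  loc v -> (forall y, Phi y 0 = y /\ solves v (Phi y)) ->
  (forall h, D h 0 = h /\
    forall t : R, 0 <= t <= 1 -> is_derive t 1 (D h) ('d (v t) (Phi x t) (D h t))) ->
  differentiable (fun y => Phi y 1) x /\
  forall h, 'd (fun y => Phi y 1) x h = D h 1.
Proof.
move=> lv HPhi HD.
have I1 : 0 <= (1 : R) <= 1 by rewrite lexx ler01.
have sx := (HPhi x).2.
have dvx (t : R) : 0 <= t <= 1 -> differentiable (v t) (Phi x t).
  by move=> tI; exact: loc_differentiable.
have linD : linear (fun h => D h 1).
  move=> a h h' /=.
  pose c t := (Phi x t, D (a *: h + h') t).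
  pose c' t := (Phi x t, a *: D h t + D h' t).
  suff /(congr1 snd) /= : c 1 = c' 1 by [].
  apply: (ode_unique (loc_prolong lv)) => //.
  - move=> t tI; apply: is_derive_pair; first exact: sx.
    rewrite /= linearP; apply: is_derive_add; last exact: (HD h').2.
    by have := (HD h).2 t tI => dh; exact: is_deriveZ.
  - by move=> t tI; apply: is_derive_pair; [exact: sx|exact: (HD _).2].
  - by rewrite /c /c' !(HD _).1.
pose L : {linear V -> V} := HB.pack (fun h => D h 1)
  (GRing.isLinear.Build _ _ _ _ _ linD).
have [r1 [C1 [r10 C10] H1]] := loc_diff_bound lv (solves_continuous sx).
have [r2 [C2 [r20 C20] H2]] := loc_remainder lv (solves_continuous sx).
have [r3 [K [r30 K0] H3]] := ode_stable lv sx.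
set E := expR (C1 + 1); have E0 : 0 < E by exact: expR_gt0.
have dvC (t : R) h : 0 <= t <= 1 -> `|'d (v t) (Phi x t) h| <= C1 * `|h|.
  by move=> tI; apply: H1 => //; rewrite subrr normr0 ltW.
have bD h : `|L h| <= E * `|h|.
  have := @gronwall _ _ (D h) (fun t => 'd (v t) (Phi x t) (D h t)) C1 0
    (`|h| * E + 1) C10 (lexx _) (HD h).2.
  rewrite (HD h).1 addr0 -/E mulrC; apply => //; first by rewrite ltrDl.
  by move=> t tI _; rewrite addr0; exact: dvC.
have cL : continuous L.
  move=> y; apply/cvgrPdist_lt => e e0.
  apply/nbhs_ballP; exists (e / E) => /=; first by rewrite divr_gt0.
  move=> z; rewrite -ball_normE /= ltr_pdivlMr // mulrC => yz.
  by rewrite -(linearB L); apply: le_lt_trans (bD _) yz.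
pose r := Num.min r3 (r2 / (K + 1)).
have r_gt0 : 0 < r by rewrite lt_min r30 divr_gt0 //; lra.
have Q0 : 0 <= C2 * K ^+ 2 * E by rewrite !mulr_ge0 ?exprn_ge0 // ltW.
apply: (@diff_of_remainder _ _ _ L x r _ cL r_gt0 Q0) => h.
rewrite lt_min => /andP[hr3]; rewrite ltr_pdivlMr; last lra.
move=> hr2; have h0 := normr_ge0 h.
have [Phi0 sy] := HPhi (x + h).
have P0 : `|Phi (x + h) 0 - Phi x 0| = `|h|.
  by rewrite Phi0 (HPhi x).1 addrC addKr.
have bP (t : R) : 0 <= t <= 1 -> `|Phi (x + h) t - Phi x t| <= K * `|h|.
  by move=> tI; have := H3 _ sy; rewrite P0 => /(_ hr3 t tI).
have := @gronwall _ _ (fun t => Phi (x + h) t - Phi x t - D h t)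
  (fun t => v t (Phi (x + h) t) - v t (Phi x t) - 'd (v t) (Phi x t) (D h t))
  C1 (C2 * K ^+ 2 * `|h| ^+ 2) (C2 * K ^+ 2 * `|h| ^+ 2 * E + 1) C10.
rewrite Phi0 (HPhi x).1 (HD h).1 [x + h - x]addrC addKr subrr normr0 add0r.
move=> H.
have -> : C2 * K ^+ 2 * E * `|h| ^+ 2 = C2 * K ^+ 2 * `|h| ^+ 2 * E by ring.
apply: H => //.
- by rewrite !mulr_ge0 ?exprn_ge0.
- move=> t tI; apply: is_derive_sub; last exact: (HD h).2.
  by apply: is_derive_sub; [exact: sy|exact: sx].
- by rewrite ltrDl.
move=> t tI _.
set k := Phi (x + h) t - Phi x t.
have kK : `|k| <= K * `|h| by exact: bP.
have kr : `|k| <= r2 by nra.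
have Ek : Phi x t + k = Phi (x + h) t by rewrite /k addrC subrK.
have := H2 t k tI kr; rewrite Ek => Hk.
have -> : v t (Phi (x + h) t) - v t (Phi x t) - 'd (v t) (Phi x t) (D h t) =
  'd (v t) (Phi x t) (k - D h t) +
  (v t (Phi (x + h) t) - v t (Phi x t) - 'd (v t) (Phi x t) k).
  by rewrite linearB /= [RHS]addrC addrA subrK.
apply: le_trans (ler_normD _ _) _; apply: lerD; first exact: dvC.
apply: le_trans Hk _; rewrite -mulrA -exprMn ler_wpM2l //.
by rewrite ler_pXn2r // ?nnegrE ?mulr_ge0.
Qed.

(** The induction on the order runs over all spaces and fields at once: the differential of the flow
    is a component of the flow of the prolonged field, which lives on [V * V]. *)
Lemma flow_sm V (v : R -> V -> V) (Phi : V -> R -> V) : good V -> loc v ->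
  (forall y, Phi y 0 = y /\ solves v (Phi y)) -> sm setT (fun y => Phi y 1).
Proof.
move=> gV lv HPhi k; elim: k V v Phi gV lv HPhi => [|k IH] V v Phi gV lv HPhi.
  have I1 : 0 <= (1 : R) <= 1 by rewrite lexx ler01.
  move=> x _; have [r [K [r0 K0] H]] := ode_stable lv (HPhi x).2.
  apply/cvgrPdist_lt => e e0; apply/nbhs_ballP.
  exists (Num.min r (e / (K + 1))) => /=.
    by rewrite lt_min r0 divr_gt0 //; lra.
  move=> y; rewrite -ball_normE /= distrC lt_min => /andP[yr].
  rewrite ltr_pdivlMr; last lra.
  move=> ye; have := H _ (HPhi y).2; rewrite (HPhi x).1 (HPhi y).1.
  move=> /(_ yr 1 I1); rewrite [ltLHS]distrC; have := normr_ge0 (y - x); nra.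
have ex z : exists D : R -> V, D 0 = z.2 /\
    forall t : R, 0 <= t <= 1 -> is_derive t 1 D ('d (v t) (Phi z.1 t) (D t)).
  exact: ode_variation (HPhi z.1).2.
pose D (z : V * V) := sval (cid (ex z)).
have HD z : D z 0 = z.2 /\ forall t : R, 0 <= t <= 1 ->
    is_derive t 1 (D z) ('d (v t) (Phi z.1 t) (D z t)).
  by rewrite /D; case: cid.
have dPhi x : differentiable (fun y => Phi y 1) x /\
    forall h, 'd (fun y => Phi y 1) x h = D (x, h) 1.
  by apply: (flow_diff (D := fun h => D (x, h)) lv HPhi) => h; exact: (HD (x, h)).
split=> [x _|]; first exact: (dPhi x).1.
apply: (@Cn_eq _ _ _ _ _ (fun z => (Phi z.1 1, D z 1).2)).
- exact: open_setXT openT.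
- by move=> [x h] _; rewrite (dPhi x).2.
apply: (@Cn_sub _ _ _ _ setT) => //.
apply: (@Cn_comp _ _ _ _ _ setT setT (fun z => (Phi z.1 1, D z 1)) snd) => //; try exact: openT.
  apply: (IH _ (prolong v) (fun z t => (Phi z.1 t, D z t))).
  - exact: good_prod.
  - exact: loc_prolong.
  - move=> z; split; first by rewrite (HPhi z.1).1 (HD z).1; case: z.
    by move=> t tI; apply: is_derive_pair; [exact: (HPhi z.1).2|exact: (HD z).2].
exact: Cn_snd.
Qed.

End flows.

Section global_flows.
Context {R : realType}.
Implicit Types V W : normedModType R.

Lemma flow_diffE V (v : R -> V -> V) (Phi : V -> R -> V) x h (D : R -> V) :
  good V -> loc v -> (forall y, Phi y 0 = y /\ solves v (Phi y)) ->
  D 0 = h ->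
  (forall t : R, 0 <= t <= 1 -> is_derive t 1 D ('d (v t) (Phi x t) (D t))) ->
  differentiable (fun y => Phi y 1) x /\ 'd (fun y => Phi y 1) x h = D 1.
Proof.
move=> gV lv HPhi D0 dD.
have I1 : 0 <= (1 : R) <= 1 by rewrite lexx ler01.
have ex k : exists D' : R -> V, D' 0 = k /\
    forall t : R, 0 <= t <= 1 -> is_derive t 1 D' ('d (v t) (Phi x t) (D' t)).
  exact: ode_variation (HPhi x).2.
pose E k := sval (cid (ex k)).
have HE k : E k 0 = k /\ forall t : R, 0 <= t <= 1 ->
    is_derive t 1 (E k) ('d (v t) (Phi x t) (E k t)).
  by rewrite /E; case: cid.
have [dPhi dE] := flow_diff lv HPhi HE; split => //.
rewrite dE; pose c t := (Phi x t, E h t); pose c' t := (Phi x t, D t).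
suff /(congr1 snd) /= : c 1 = c' 1 by [].
apply: (ode_unique (loc_prolong lv)) => //.
- by move=> t tI; apply: is_derive_pair; [exact: (HPhi x).2|exact: dD].
- by move=> t tI; apply: is_derive_pair; [exact: (HPhi x).2|exact: (HE _).2].
- by rewrite /c /c' (HE _).1 D0.
Qed.

Lemma constant_of_derive0 V (u : R -> V) :
  (forall t : R, 0 <= t <= 1 -> is_derive t 1 u 0) ->
  forall t : R, 0 <= t <= 1 -> u t = u 0.
Proof.
move=> du; apply: (@ode_unique _ _ (fun _ _ => 0) (fun=> u 0) u) => //.
- by apply: (@loc_sm _ _ _ (fun=> 0)); exact: sm_cst.
- by move=> t tI; exact: is_derive_cst.
Qed.

Lemma flow_exists V (v : R -> V -> V) (C : R) : good V -> loc v -> 0 <= C ->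
  (forall (t : R) x y, 0 <= t <= 1 -> `|v t x - v t y| <= C * `|x - y|) ->
  exists Phi : V -> R -> V, forall y, Phi y 0 = y /\ solves v (Phi y).
Proof.
move=> gV lv C0 vC.
have ex x : exists c : R -> V, c 0 = x /\ solves v c.
  by apply: (picard x gV C0) => // c cc; exact: loc_curve_continuous.
by exists (fun x => sval (cid (ex x))) => y; case: cid.
Qed.

Lemma diff_scale W (z : R * W) :
  differentiable (fun z : R * W => z.1 *: z.2) z /\
  forall h, 'd (fun z : R * W => z.1 *: z.2) z h = z.1 *: h.2 + h.1 *: z.2.
Proof.
pose l (h : R * W) := z.1 *: h.2 + h.1 *: z.2.
have ll : linear l.
  move=> a h h'; rewrite /l /= !scalerDr scalerDl !scalerA mulrC.
  by rewrite -!addrA; congr (_ + _); rewrite addrCA.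
pose L : {linear (R * W)%type -> W} := HB.pack l (GRing.isLinear.Build _ _ _ _ _ ll).
have cL : continuous L.
  move=> x; apply: cvgD; apply: cvgZ; try exact: cvg_cst.
    exact: cvg_snd.
  exact: cvg_fst.
apply: (@diff_of_remainder _ _ _ _ L z 1 1) => // h _.
rewrite /= /l /= scalerDl !scalerDr mul1r.
have -> : z.1 *: z.2 + z.1 *: h.2 + (h.1 *: z.2 + h.1 *: h.2) - z.1 *: z.2
    - (z.1 *: h.2 + h.1 *: z.2) = h.1 *: h.2.
  rewrite -[z.1 *: z.2 + _ + _]addrA [z.1 *: z.2 + _]addrC addrK.
  by rewrite [z.1 *: h.2 + (_ + _)]addrA [LHS]addrAC subrr add0r.
by rewrite normrZ expr2 ler_pM // prod_normE le_max lexx ?orbT.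
Qed.

Lemma sm_scale V W (U : set V) (f : V -> R) (g : V -> W) : open U ->
  sm U f -> sm U g -> sm U (fun x => f x *: g x).
Proof.
suff H : sm [set: R * W] (fun z : R * W => z.1 *: z.2).
  move=> oU sf sg.
  apply: (@sm_compT _ _ _ _ _ (fun x => (f x, g x)) (fun z : R * W => z.1 *: z.2)) => //.
  exact: sm_pair.
elim=> [|k IH]; first by move=> z _; apply: differentiable_continuous; exact: (diff_scale z).1.
split=> [z _|]; first exact: (diff_scale z).1.
have P (a : (R * W) * (R * W) -> R) (b : (R * W) * (R * W) -> W) : sm setT a -> sm setT b ->
    Cn k setT (fun z => a z *: b z).
  move=> sa sb; apply: (@Cn_comp _ _ _ _ _ setT setT (fun z => (a z, b z))
    (fun z : R * W => z.1 *: z.2)) => //; try exact: openT.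
  by apply: Cn_pair => //; exact: openT.
have sf V1 V2 : sm [set: V1 * V2] fst by exact: sm_fst.
have ss V1 V2 : sm [set: V1 * V2] snd by exact: sm_snd.
have oT V1 : open [set: V1] by exact: openT.
apply: (@Cn_sub _ k _ _ setT) => //.
apply: (Cn_eq (oT _) _ (Cn_add (oT _) (P (fun z => z.1.1) (fun z => z.2.2) _ _)
  (P (fun z => z.2.1) (fun z => z.1.2) _ _))).
- by move=> [z h] _; rewrite (diff_scale z).2.
- exact: (sm_compT (oT _) (sf _ _) (sf _ _)).
- exact: (sm_compT (oT _) (ss _ _) (ss _ _)).
- exact: (sm_compT (oT _) (ss _ _) (sf _ _)).
- exact: (sm_compT (oT _) (sf _ _) (ss _ _)).
Qed.

Lemma diff_scaleE V W (f : V -> R) (g : V -> W) x h :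
  differentiable f x -> differentiable g x ->
  'd (fun y => f y *: g y) x h = f x *: 'd g x h + 'd f x h *: g x.
Proof.
move=> df dg; have dp : differentiable (fun y => (f y, g y)) x.
  exact: differentiable_pair.
have := diff_compE h dp (diff_scale (f x, g x)).1.
by rewrite diff_pairE // (diff_scale _).2.
Qed.

(* Adding the time scale [s] to the state variables turns smooth dependence on
   initial conditions at time one into joint smoothness of the flow. *)
Lemma autonomous_flow V (Z : V -> V) (C : R) : good V -> sm setT Z -> 0 <= C ->
  (forall x y, `|Z x - Z y| <= C * `|x - y|) ->
  exists psi : R * V -> V, [/\ sm setT psi,
    forall x, psi (0, x) = x,
    forall (s : R) x, is_derive s 1 (fun s => psi (s, x)) (Z (psi (s, x))) &
    forall s x, 'd (fun y => psi (s, y)) x (Z x) = Z (psi (s, x))].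
Proof.
move=> gV sZ C0 ZC.
have I0 : 0 <= (0 : R) <= 1 by rewrite lexx ler01.
have I1 : 0 <= (1 : R) <= 1 by rewrite lexx ler01.
have oT (W : normedModType R) : open [set: W] by exact: openT.
have ex (z : R * V) : exists c : R -> V, c 0 = z.2 /\ solves (fun _ y => z.1 *: Z y) c.
  apply: (@picard _ _ _ (`|z.1| * C)) => //; first by rewrite mulr_ge0.
    move=> c cc; apply: (@loc_curve_continuous _ _ _ (fun _ y => z.1 *: Z y)) => //.
    apply: (@loc_sm _ _ _ (fun y => z.1 *: Z y.2)).
    apply: sm_scale => //; first exact: sm_cst.
    exact: (sm_compT (oT _) (sm_snd _) sZ).
  by move=> t x y _; rewrite -scalerBr normrZ -mulrA ler_wpM2l.
pose y z := sval (cid (ex z)).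
have Hy z : y z 0 = z.2 /\ solves (fun _ y => z.1 *: Z y) (y z).
  by rewrite /y; case: cid.
pose w (t : R) (z : R * V) : R * V := (0, z.1 *: Z z.2).
have lw : loc w.
  apply: (@loc_sm _ _ _ (fun z : R * (R * V) => (0, z.2.1 *: Z z.2.2))).
  apply: sm_pair => //; first exact: sm_cst.
  apply: sm_scale => //.
    exact: (sm_compT (oT _) (sm_snd _) (@sm_fst _ _ _ _)).
  apply: (sm_compT (oT _) _ sZ).
  exact: (sm_compT (oT _) (sm_snd _) (@sm_snd _ _ _ _)).
pose Phi (z : R * V) (t : R) := (z.1, y z t).
have HPhi z : Phi z 0 = z /\ solves w (Phi z).
  split=> [|t tI]; first by rewrite /Phi (Hy z).1; case: z.
  by apply: is_derive_pair; exact: (Hy z).2.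
have gRV := good_prod (@good_real R) gV.
have sPhi := flow_sm gRV lw HPhi.
pose psi z := y z 1.
have spsi : sm setT psi.
  exact: (sm_compT (oT _) sPhi (@sm_snd _ _ _ _)).
have psi_diff z h (D : R -> R * V) : D 0 = h ->
    (forall t : R, 0 <= t <= 1 -> is_derive t 1 D ('d (w t) (Phi z t) (D t))) ->
    'd psi z h = (D 1).2.
  move=> D0 dD; have [dP dE] := flow_diffE gRV lw HPhi D0 dD.
  have c2 : continuous (snd : R * V -> V) by move=> x; exact: cvg_snd.
  by rewrite (diff_compE _ dP (linear_differentiable _ c2)) diff_lin // dE.
have dZ x : differentiable Z x by exact: sm_differentiable sZ _.
have dw z h : 'd (w 0) z h = (0, z.1 *: 'd Z (z.2) h.2 + h.1 *: Z z.2).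
  have d1 : differentiable (fst : R * V -> R) z by exact: (sm_differentiable (@sm_fst _ _ _ setT)).
  have d2 : differentiable (snd : R * V -> V) z by exact: (sm_differentiable (@sm_snd _ _ _ setT)).
  have s2 : sm setT (fun z : R * V => z.1 *: Z z.2).
    by apply: sm_scale => //; [exact: sm_fst|exact: (sm_compT (oT _) (sm_snd _) sZ)].
  have ds2 : differentiable (fun z : R * V => z.1 *: Z z.2) z by exact: (sm_differentiable s2).
  have dc : differentiable (fun _ : R * V => 0 : R) z by exact: differentiable_cst.
  rewrite (diff_pairE h dc ds2).
  have c1 : continuous (fst : R * V -> R) by move=> x; exact: cvg_fst.
  have c2 : continuous (snd : R * V -> V) by move=> x; exact: cvg_snd.
  have dZ2 : differentiable (fun z => Z z.2) z by exact: (differentiable_comp d2).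
  rewrite diff_cst diff_scaleE // (diff_compE _ d2) //.
  by rewrite (@diff_lin _ _ _ fst) // (@diff_lin _ _ _ snd).
exists psi; split=> //.
- move=> x; have := constant_of_derive0 (u := y (0, x)) _ I1.
  rewrite (Hy _).1; apply => t tI.
  by apply: (is_deriveE _ ((Hy (0, x)).2 t tI)); rewrite scale0r.
- move=> s x.
  have dpsi : differentiable psi (s, x) by exact: sm_differentiable spsi _.
  have := is_derive_comp dpsi (is_derive_pair (is_derive_id s 1) (is_derive_cst x s 1)).
  apply: is_deriveE.
  (* Variation in the time scale: [t *: Z] along the solution starts at zero and solves the equation
     linearized in the direction of [s]. *)
  have E : 'd psi (s, x) (1 : R, 0 : V) = (1 : R, (1 : R) *: Z (y (s, x) 1)).2.
    refine (psi_diff (s, x) (1, 0) (fun t : R => (1, t *: Z (y (s, x) t))) _ _).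
      by rewrite scale0r.
    move=> t tI; rewrite (dw (Phi (s, x) t)) /=; apply: is_derive_pair.
    have dy := (Hy (s, x)).2 t tI; rewrite /= in dy.
    have dZy := is_derive_comp (dZ (y (s, x) t)) dy.
    have := is_derive_comp (diff_scale (t, Z (y (s, x) t))).1
      (is_derive_pair (is_derive_id t 1) dZy).
    apply: is_deriveE; rewrite (diff_scale _).2 /= !linearZ /= !scalerA.
    by rewrite [t * s]mulrC.
  by rewrite E /= scale1r.
- move=> s x.
  (* The field evaluated along its own trajectory solves the linearized equation; hence the flow
     preserves [Z]. *)
  have E : 'd psi (s, x) (0, Z x) = (0 : R, Z (y (s, x) 1)).2.
    refine (psi_diff (s, x) (0, Z x) (fun t : R => (0, Z (y (s, x) t))) _ _).
      by rewrite (Hy (s, x)).1.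
    move=> t tI; rewrite (dw (Phi (s, x) t)) /=; apply: is_derive_pair.
    have := is_derive_comp (dZ (y (s, x) t)) ((Hy (s, x)).2 t tI).
    by apply: is_deriveE; rewrite /= linearZ scale0r addr0.
  have [_ dslice] := diff_slice (sm_differentiable (x := (s, x)) spsi I).
  by rewrite dslice E.
Qed.
End global_flows.

(** * Calculus in the plane *)

Notation smT f := (sm [set: _] f).

(* Locked, so that [ring] and [lra] do not try to unify distinct derivatives. *)
HB.lock Definition d1 (R : realType) (f : R * R -> R) (a : R * R) : R := 'd f a (1, 0).
HB.lock Definition d2 (R : realType) (f : R * R -> R) (a : R * R) : R := 'd f a (0, 1).

Section planar.
Context {R : realType}.
Implicit Types (f g : R * R -> R) (a : R * R).

Lemma openTT (V : normedModType R) : open [set: V].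
Proof. exact: openT. Qed.

Lemma is_derive_unique (V : normedModType R) (c : R -> V) (t : R) (d d' : V) :
  is_derive t 1 c d -> is_derive t 1 c d' -> d = d'.
Proof. by move=> [_ <-] [_ <-]. Qed.

Lemma smT_differentiable (V W : normedModType R) (f : V -> W) x :
  smT f -> differentiable f x.
Proof. by move=> sf; exact: sm_differentiable sf _. Qed.

Lemma smT_continuous (V W : normedModType R) (f : V -> W) : smT f -> continuous f.
Proof. by move=> sf x; exact: sm_continuous sf _. Qed.

Lemma smT_comp (V W X : normedModType R) (g : V -> W) (f : W -> X) :
  smT g -> smT f -> smT (fun x => f (g x)).
Proof. by move=> sg sf; apply: sm_compT => //; exact: openTT. Qed.

Lemma smT_pair (V W X : normedModType R) (g : V -> W) (f : V -> X) :
  smT g -> smT f -> smT (fun x => (g x, f x)).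
Proof. by move=> sg sf; apply: sm_pair => //; exact: openTT. Qed.

Lemma smT_mul (V : normedModType R) (f g : V -> R) :
  smT f -> smT g -> smT (fun x => f x * g x).
Proof. by move=> sg sf; apply: sm_mul => //; exact: openTT. Qed.

Lemma smT_add (V W : normedModType R) (f g : V -> W) :
  smT f -> smT g -> smT (fun x => f x + g x).
Proof. by move=> sg sf; apply: sm_add => //; exact: openTT. Qed.

Lemma smT_opp (V W : normedModType R) (f : V -> W) :
  smT f -> smT (fun x => - f x).
Proof. by move=> sf; apply: sm_opp => //; exact: openTT. Qed.

Lemma smT_sub (V W : normedModType R) (f g : V -> W) :
  smT f -> smT g -> smT (fun x => f x - g x).
Proof. by move=> sg sf; apply: smT_add => //; exact: smT_opp. Qed.

Lemma smT_fst (V W X : normedModType R) (f : V -> W * X) :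
  smT f -> smT (fun x => (f x).1).
Proof. by move=> sf; apply: (smT_comp sf); exact: sm_fst. Qed.

Lemma smT_snd (V W X : normedModType R) (f : V -> W * X) :
  smT f -> smT (fun x => (f x).2).
Proof. by move=> sf; apply: (smT_comp sf); exact: sm_snd. Qed.

Lemma diff_line (V W : normedModType R) (f : V -> W) x h d :
  differentiable f x -> is_derive (0 : R) 1 (fun s => f (x + s *: h)) d ->
  'd f x h = d.
Proof.
move=> df H; apply: is_derive_unique H.
by have := is_derive_comp (c := fun s => x + s *: h) (t := 0); rewrite scale0r addr0;
  apply => //; exact: is_derive_line.
Qed.

Lemma mean_value (f f' : R -> R) (a b : R) : a < b ->
  (forall x, a <= x <= b -> is_derive x 1 f (f' x)) ->
  exists c, [/\ a < c, c < b & f b - f a = f' c * (b - a)].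
Proof.
move=> ab df.
have H1 x : x \in `]a, b[%R -> is_derive x 1 f (f' x).
  by rewrite in_itv => /= /andP[ax xb]; apply: df; rewrite !ltW.
have H2 : {within `[a, b], continuous f}.
  apply: derivable_within_continuous => x; rewrite in_itv => /= xI.
  by have [] := df x xI.
have [c] := MVT ab H1 H2.
by rewrite in_itv => /= /andP[ac cb] H; exists c.
Qed.

Lemma constant_of_derive0_itv (f : R -> R) (a b : R) : a <= b ->
  (forall x, a <= x <= b -> is_derive x 1 f 0) -> f b = f a.
Proof.
rewrite le_eqVlt => /orP[/eqP -> //|ab] df.
have [c [_ _]] := mean_value (f' := fun=> 0) ab df.
by rewrite mul0r => /eqP; rewrite subr_eq0 => /eqP.
Qed.

Lemma constant_of_derive0_line (f : R -> R) : (forall x : R, is_derive x 1 f 0) ->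
  forall a b : R, f a = f b.
Proof.
move=> df a b; have [ab|/ltW ba] := leP a b; last exact: constant_of_derive0_itv.
by apply/esym/constant_of_derive0_itv.
Qed.

Lemma sm_d1 f : smT f -> smT (d1 f).
Proof.
move=> sf; rewrite d1.unlock; apply: (@sm_comp _ _ _ _ setT (setT `*` setT)
  (fun a => (a, (1, 0) : R * R)) (fun z => 'd f (z.1) z.2)) => //; first exact: openTT.
- exact: open_setXT (openTT _).
- by apply: smT_pair; [exact: sm_id|exact: sm_cst].
- exact: sm_diff sf.
Qed.

Lemma sm_d2 f : smT f -> smT (d2 f).
Proof.
move=> sf; rewrite d2.unlock; apply: (@sm_comp _ _ _ _ setT (setT `*` setT)
  (fun a => (a, (0, 1) : R * R)) (fun z => 'd f (z.1) z.2)) => //; first exact: openTT.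
- exact: open_setXT (openTT _).
- by apply: smT_pair; [exact: sm_id|exact: sm_cst].
- exact: sm_diff sf.
Qed.

Lemma diff_d12 f a h : 'd f a h = h.1 * d1 f a + h.2 * d2 f a.
Proof.
have {1}-> : h = h.1 *: (1, 0) + h.2 *: (0, 1).
  case: h => x y; congr (_, _) => /=;
  by rewrite /GRing.scale/= ?mulr0 ?mulr1 ?add0r ?addr0.
by rewrite d1.unlock d2.unlock linearD !linearZ.
Qed.

Lemma is_derive_planar f (c : R -> R * R) (t : R) d : smT f ->
  is_derive t 1 c d ->
  is_derive t 1 (fun s => f (c s)) (d.1 * d1 f (c t) + d.2 * d2 f (c t)).
Proof.
move=> sf dc; rewrite -diff_d12; apply: is_derive_comp => //.
exact: smT_differentiable.
Qed.

Lemma is_derive_d1 f (q p : R) : smT f ->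
  is_derive q 1 (fun s => f (s, p)) (d1 f (q, p)).
Proof.
move=> sf; have := is_derive_pair (is_derive_id q 1) (is_derive_cst p q 1).
move=> /(is_derive_planar sf); apply: is_deriveE => /=.
by rewrite mul1r mul0r addr0.
Qed.

Lemma is_derive_d2 f (q p : R) : smT f ->
  is_derive p 1 (fun s => f (q, s)) (d2 f (q, p)).
Proof.
move=> sf; have := is_derive_pair (is_derive_cst q p 1) (is_derive_id p 1).
move=> /(is_derive_planar sf); apply: is_deriveE => /=.
by rewrite mul1r mul0r add0r.
Qed.

Lemma d1_eq f a x : smT f -> is_derive a.1 1 (fun s => f (s, a.2)) x -> d1 f a = x.
Proof. by case: a => q p sf; exact: is_derive_unique (is_derive_d1 q p sf). Qed.

Lemma d2_eq f a x : smT f -> is_derive a.2 1 (fun s => f (a.1, s)) x -> d2 f a = x.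
Proof. by case: a => q p sf; exact: is_derive_unique (is_derive_d2 q p sf). Qed.

Lemma d1_comp f (g : R * R -> R * R) a : smT f -> smT g ->
  d1 (fun b => f (g b)) a =
  d1 (fun b => (g b).1) a * d1 f (g a) + d1 (fun b => (g b).2) a * d2 f (g a).
Proof.
move=> sf sg; have s1 := smT_fst sg; have s2 := smT_snd sg.
apply: d1_eq; first exact: smT_comp.
case: a => q p /=.
have dg : is_derive q 1 (fun s => g (s, p))
    (d1 (fun b => (g b).1) (q, p), d1 (fun b => (g b).2) (q, p)).
  have := is_derive_pair (is_derive_d1 q p s1) (is_derive_d1 q p s2).
  by congr (is_derive _ _ _ _); apply/funext => s /=; case: (g _).
exact: is_derive_planar sf dg.
Qed.

Lemma d2_comp f (g : R * R -> R * R) a : smT f -> smT g ->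
  d2 (fun b => f (g b)) a =
  d2 (fun b => (g b).1) a * d1 f (g a) + d2 (fun b => (g b).2) a * d2 f (g a).
Proof.
move=> sf sg; have s1 := smT_fst sg; have s2 := smT_snd sg.
apply: d2_eq; first exact: smT_comp.
case: a => q p /=.
have dg : is_derive p 1 (fun s => g (q, s))
    (d2 (fun b => (g b).1) (q, p), d2 (fun b => (g b).2) (q, p)).
  have := is_derive_pair (is_derive_d2 q p s1) (is_derive_d2 q p s2).
  by congr (is_derive _ _ _ _); apply/funext => s /=; case: (g _).
exact: is_derive_planar sf dg.
Qed.

Lemma d1_mul f g a : smT f -> smT g ->
  d1 (fun b => f b * g b) a = f a * d1 g a + g a * d1 f a.
Proof.
move=> sf sg; apply: d1_eq; first exact: smT_mul.
by case: a => q p; apply: is_derive_mul; exact: is_derive_d1.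
Qed.

Lemma d2_mul f g a : smT f -> smT g ->
  d2 (fun b => f b * g b) a = f a * d2 g a + g a * d2 f a.
Proof.
move=> sf sg; apply: d2_eq; first exact: smT_mul.
by case: a => q p; apply: is_derive_mul; exact: is_derive_d2.
Qed.

Lemma d1_add f g a : smT f -> smT g ->
  d1 (fun b => f b + g b) a = d1 f a + d1 g a.
Proof.
move=> sf sg; apply: d1_eq; first exact: smT_add.
by case: a => q p; apply: is_derive_add; exact: is_derive_d1.
Qed.

Lemma d2_add f g a : smT f -> smT g ->
  d2 (fun b => f b + g b) a = d2 f a + d2 g a.
Proof.
move=> sf sg; apply: d2_eq; first exact: smT_add.
by case: a => q p; apply: is_derive_add; exact: is_derive_d2.
Qed.

Lemma d1_opp f a : smT f -> d1 (fun b => - f b) a = - d1 f a.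
Proof.
move=> sf; apply: d1_eq; first exact: smT_opp.
by case: a => q p; apply: is_deriveN; exact: is_derive_d1.
Qed.

Lemma d2_opp f a : smT f -> d2 (fun b => - f b) a = - d2 f a.
Proof.
move=> sf; apply: d2_eq; first exact: smT_opp.
by case: a => q p; apply: is_deriveN; exact: is_derive_d2.
Qed.

Lemma d1_fst a : d1 fst a = 1.
Proof. by apply: d1_eq; exact: sm_fst. Qed.

Lemma d1_snd a : d1 snd a = 0.
Proof. by apply: d1_eq; [exact: sm_snd|exact: is_derive_cst]. Qed.

Lemma d2_fst a : d2 fst a = 0.
Proof. by apply: d2_eq; [exact: sm_fst|exact: is_derive_cst]. Qed.

Lemma d2_snd a : d2 snd a = 1.
Proof. by apply: d2_eq; exact: sm_snd. Qed.

Lemma near_eq_d12 f g a : (\forall b \near a, f b = g b) -> smT f ->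
  d1 f a = d1 g a /\ d2 f a = d2 g a.
Proof.
move=> fg sf; have [_ E] := near_eq_differentiable fg (smT_differentiable a sf).
by rewrite d1.unlock d2.unlock; split; exact: esym (congr1 (fun F : R * R -> R => F _) E).
Qed.

Lemma mixed_difference f (q p r : R) : smT f -> 0 < r ->
  exists x y, [/\ q <= x <= q + r, p <= y <= p + r &
    f (q + r, p + r) - f (q, p + r) - (f (q + r, p) - f (q, p)) =
    d1 (d2 f) (x, y) * r ^+ 2].
Proof.
move=> sf r0.
have pr : p < p + r by rewrite ltrDl.
have qr : q < q + r by rewrite ltrDl.
have du (y : R) : is_derive y 1 (fun y => f (q + r, y) - f (q, y)) (d2 f (q + r, y) - d2 f (q, y)).
  by apply: is_derive_sub; exact: is_derive_d2.
have [y [y1 y2 /= ->]] := mean_value pr (fun y _ => du y).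
have [x [x1 x2 /= ->]] := mean_value qr (fun x _ => is_derive_d1 x y (sm_d2 sf)).
by exists x, y; split; [lra|lra|ring].
Qed.

Lemma box_ball (q p r z w s : R) :
  q <= z <= q + r -> p <= w <= p + r -> r < s -> ball (q, p) s (z, w).
Proof.
move=> zI wI rs; rewrite -ball_normE /=.
rewrite -[(q, p) - (z, w)]/(q - z, p - w) norm_pair_lt.
by apply/andP; split; rewrite ler0_norm; lra.
Qed.

(** The second difference of [f] over a small square is [r ^+ 2] times a mixed derivative at some
    point of it. Exchanging the coordinates leaves this difference unchanged and produces the
    derivative in the other order, so continuity concludes. *)
Lemma schwarz f a : smT f -> d1 (d2 f) a = d2 (d1 f) a.
Proof.
case: a => q p sf; apply/eqP; rewrite -subr_eq0 -normr_le0.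
apply/ler_addgt0Pr => e e0; rewrite add0r.
have c1 : {for (q, p), continuous (d1 (d2 f))}.
  by apply: smT_continuous; exact: sm_d1 (sm_d2 sf).
have c2 : {for (q, p), continuous (d2 (d1 f))}.
  by apply: smT_continuous; exact: sm_d2 (sm_d1 sf).
have /cvgrPdist_lt/(_ (e / 2)) := c1; rewrite divr_gt0 // => /(_ isT) /nbhs_ballP[r1 /= r10 H1].
have /cvgrPdist_lt/(_ (e / 2)) := c2; rewrite divr_gt0 // => /(_ isT) /nbhs_ballP[r2 /= r20 H2].
pose r := Num.min r1 r2 / 2.
have m0 : 0 < Num.min r1 r2 by rewrite lt_min r10.
have r0 : 0 < r by rewrite divr_gt0.
have rr1 : r < r1.
  have : Num.min r1 r2 <= r1 by rewrite ge_min lexx.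
  by rewrite /r; lra.
have rr2 : r < r2.
  have : Num.min r1 r2 <= r2 by rewrite ge_min lexx orbT.
  by rewrite /r; lra.
have [x [y [xI yI E]]] := mixed_difference q p sf r0.
have sw : smT (fun b : R * R => (b.2, b.1)) by apply: smT_pair; [exact: sm_snd|exact: sm_fst].
have sfw : smT (fun b : R * R => f (b.2, b.1)) by exact: smT_comp sw sf.
have [y' [x' [yI' xI' E']]] := mixed_difference p q sfw r0.
have Esw : d1 (d2 (fun b : R * R => f (b.2, b.1))) (y', x') = d2 (d1 f) (x', y').
  have E1 b : d2 (fun b : R * R => f (b.2, b.1)) b = d1 f (b.2, b.1).
    rewrite (d2_comp b sf sw) /=.
    by rewrite (d2_snd b) (d2_fst b) mul1r mul0r addr0.
  have -> : d2 (fun b : R * R => f (b.2, b.1)) = fun b => d1 f (b.2, b.1) by apply/funext.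
  rewrite (d1_comp _ (sm_d1 sf) sw) /=.
  by rewrite (d1_snd _) (d1_fst _) mul1r mul0r add0r.
have : d1 (d2 f) (x, y) = d2 (d1 f) (x', y').
  have r2n : r ^+ 2 != 0 by rewrite expf_neq0 // gt_eqF.
  apply: (mulIf r2n); rewrite -E -Esw -E' /=; ring.
have := H1 (x, y) (box_ball xI yI rr1).
have := H2 (x', y') (box_ball xI' yI' rr2).
move=> /= h2 h1 EE; rewrite EE in h1.
have -> : d1 (d2 f) (q, p) - d2 (d1 f) (q, p) = (d1 (d2 f) (q, p) - d2 (d1 f) (x', y')) -
   (d2 (d1 f) (q, p) - d2 (d1 f) (x', y')) by ring.
apply: le_trans (ler_normB _ _) _; lra.
Qed.

End planar.

Section planar_fields.
Context {R : realType}.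
Implicit Types (f g : R * R -> R) (a : R * R).

Lemma good_plane : good (R * R)%type.
Proof. exact: good_prod (@good_real R) (@good_real R). Qed.

(** Joint smoothness of an integral with parameters is deduced from smooth dependence of flows:
    rescaled to time [0, 1], the integral is the last coordinate of a flow in which the upper limit
    and the parameter are frozen state variables. *)
Lemma primitive1 f (q0 : R) : smT f -> exists N : R * R -> R,
  [/\ smT N, forall a, d1 N a = f a & forall p, N (q0, p) = 0].
Proof.
move=> sf.
have I1 : 0 <= (1 : R) <= 1 by rewrite lexx ler01.
pose k (t : R) a := (a.1 - q0) * f (q0 + t * (a.1 - q0), a.2).
have s1 : smT (fun z : R * (R * R) => z.2.1 - q0).
  by apply: smT_sub; [apply: smT_fst; exact: sm_snd|exact: sm_cst].
have sk : smT (fun z : R * (R * R) => k z.1 z.2).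
  apply: smT_mul => //; apply: (smT_comp _ sf); apply: smT_pair.
    by apply: smT_add; [exact: sm_cst|apply: smT_mul => //; exact: sm_fst].
  by apply: smT_snd; exact: sm_snd.
have ck a : continuous (fun t => k t a).
  move=> t; apply: (@continuous_comp _ _ _ (fun t => (t, a)) (fun z => k z.1 z.2)).
    by apply: continuous_pair; [exact: cvg_id|exact: cvg_cst].
  exact: (smT_continuous sk).
have ex a : exists P : R -> R, P 0 = 0 /\ forall t : R, 0 <= t <= 1 -> is_derive t 1 P (k t a).
  have [P HP] := (@good_real R).1 _ (ck a).
  exists (fun t => P t - P 0); split; first exact: subrr.
  move=> t tI; apply: (is_deriveE (subr0 _)); apply: is_derive_sub; exact: HP.
pose P a := sval (cid (ex a)).
have HP a : P a 0 = 0 /\ forall t : R, 0 <= t <= 1 -> is_derive t 1 (P a) (k t a).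
  by rewrite /P; case: cid.
pose w (t : R) (z : (R * R) * R) : (R * R) * R := (0, k t z.1).
have sw : smT (fun z : R * ((R * R) * R) => w z.1 z.2).
  apply: smT_pair; first exact: sm_cst.
  apply: (@smT_comp _ _ _ _ (fun z => (z.1, z.2.1)) (fun z => k z.1 z.2) _ sk).
  by apply: smT_pair; [exact: sm_fst|apply: smT_fst; exact: sm_snd].
have lw : loc w := loc_sm sw.
pose Phi (z : (R * R) * R) (t : R) := (z.1, z.2 + P z.1 t).
have HPhi z : Phi z 0 = z /\ solves w (Phi z).
  split=> [|t tI]; first by rewrite /Phi (HP z.1).1 addr0; case: z.
  apply: is_derive_pair.
  by apply: (is_deriveE (add0r _)); apply: is_derive_add; exact: (HP z.1).2.
have gV := good_prod good_plane (@good_real R).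
have sPhi := flow_sm gV lw HPhi.
have si : smT (fun a : R * R => (a, 0 : R)).
  by apply: smT_pair; [exact: sm_id|exact: sm_cst].
pose N a := (Phi (a, 0) 1).2.
have sN : smT N by apply: smT_snd; exact: smT_comp si sPhi.
have kq0 t p : k t (q0, p) = 0 by rewrite /k subrr mul0r.
exists N; split => // [[q p]|p]; last first.
  rewrite /N /= add0r; have := constant_of_derive0 (u := P (q0, p)) _ I1.
  by rewrite (HP _).1; apply => t tI; rewrite -(kq0 t p); exact: (HP _).2.
(* The variation in the direction [(1, 0)], guessed explicitly: up to time [t] the integral covers a
   fraction [t] of the interval, so moving its end point [q] contributes [t] times the integrand
   there. *)
pose D (t : R) : (R * R) * R := ((1, 0), t * f (q0 + t * (q - q0), p)).
have dline (t : R) : is_derive t 1 (fun t => f (q0 + t * (q - q0), p))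
    ((q - q0) * d1 f (q0 + t * (q - q0), p)).
  have dl : is_derive t 1 (fun t => q0 + t * (q - q0)) (q - q0).
    exact: is_derive_line.
  have := is_derive_planar sf (is_derive_pair dl (is_derive_cst p t 1)).
  by apply: is_deriveE; rewrite /= mul0r addr0.
have dD (t : R) : 0 <= t <= 1 ->
    is_derive t 1 D ('d (w t) (Phi ((q, p), 0) t) (D t)).
  move=> tI.
  have dw : differentiable (w t) (Phi ((q, p), 0) t) by exact: loc_differentiable.
  have E : 'd (w t) (Phi ((q, p), 0) t) (D t) = (0, f (q0 + t * (q - q0), p)
      + t * ((q - q0) * d1 f (q0 + t * (q - q0), p))).
    apply: (diff_line dw); apply: is_derive_pair.
    rewrite /k /=.
    have dx : is_derive (0 : R) 1 (fun s : R => q + s *: 1) 1 by exact: is_derive_line.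
    have dx' : is_derive (0 : R) 1 (fun s : R => q + s *: 1 - q0) 1.
      by apply: (is_deriveE (subr0 _)); apply: is_derive_sub.
    have dx2 : is_derive (0 : R) 1 (fun s : R => q0 + t * (q + s *: 1 - q0)) t.
      apply: (is_deriveE (add0r _)); apply: is_derive_add.
      have := is_derive_mul (is_derive_cst t (0 : R) 1) dx'.
      by apply: is_deriveE; rewrite /cst /=; ring.
    have dp : is_derive (0 : R) 1 (fun s : R => p + s *: 0) 0 by exact: is_derive_line.
    have := is_derive_mul dx' (is_derive_planar sf (is_derive_pair dx2 dp)).
    by apply: is_deriveE; rewrite /= !scale0r !addr0; ring.
  rewrite E; apply: is_derive_pair.
  have := is_derive_mul (is_derive_id t 1) (dline t).
  by apply: is_deriveE; rewrite /=; ring.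
have D0 : D 0 = ((1, 0), 0) by rewrite /D mul0r.
have [dP dE] := flow_diffE gV lw HPhi D0 dD.
have E1 : D 1 = ((1, 0), f (q, p)) by rewrite /D !mul1r [q0 + _]addrC subrK.
rewrite d1.unlock /N.
have di : differentiable (fun a : R * R => (a, 0 : R)) (q, p) by exact: (smT_differentiable (q, p) si).
have dPi : differentiable (fun a : R * R => Phi (a, 0) 1) (q, p) by exact: (differentiable_comp di dP).
have c2 : continuous (snd : (R * R) * R -> R) by move=> x; exact: cvg_snd.
rewrite (diff_compE _ dPi (linear_differentiable _ c2)) (diff_compE _ di dP).
have did : differentiable (fun a : R * R => a) (q, p) by exact: (smT_differentiable (q, p) (@sm_id _ _ _)).
have dcs : differentiable (fun a : R * R => 0 : R) (q, p) by exact: differentiable_cst.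
rewrite (@diff_lin _ _ _ snd) // (diff_pairE _ did dcs).
by rewrite (@diff_val _ _ _ _ _ id id) diff_cst dE E1.
Qed.

Lemma sm_swap : smT (fun a : R * R => (a.2, a.1)).
Proof. by apply: smT_pair; [exact: sm_snd|exact: sm_fst]. Qed.

Lemma primitive2 f (p0 : R) : smT f -> exists N : R * R -> R,
  [/\ smT N, forall a, d2 N a = f a & forall q, N (q, p0) = 0].
Proof.
move=> sf; have [N [sN dN N0]] := primitive1 p0 (smT_comp sm_swap sf).
exists (fun a => N (a.2, a.1)); split; first exact: smT_comp sm_swap sN.
  by move=> a; rewrite (d2_comp a sN sm_swap) /= dN (d2_snd a) (d2_fst a) /= mul1r mul0r addr0; case: a.
by move=> q; rewrite N0.
Qed.

Lemma is_derive0_expR (W : R -> R) (c : R) :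
  (forall t : R, 0 <= t <= 1 -> is_derive t 1 W (c * W t)) -> W 1 = W 0 * expR c.
Proof.
move=> dW.
have I1 : 0 <= (1 : R) <= 1 by rewrite lexx ler01.
have H (t : R) : 0 <= t <= 1 -> is_derive t 1 (fun t => W t * (1 * expR ((- c) * t))) 0.
  move=> tI; have := is_derive_mul (dW t tI) (is_derive_expM 1 (- c) t).
  by apply: is_deriveE; ring.
have := constant_of_derive0 H I1.
rewrite !mul1r !mulr1 mulr0 expR0 mulr1 => <-.
by rewrite -mulrA -expRD addrC subrr expR0 mulr1.
Qed.

Definition jac (A : R * R -> R * R) a :=
  d1 (fun b => (A b).1) a * d2 (fun b => (A b).2) a -
  d1 (fun b => (A b).2) a * d2 (fun b => (A b).1) a.

Lemma diff_fst (V W X : normedModType R) (f : V -> W * X) x h : differentiable f x ->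
  'd (fun b => (f b).1) x h = ('d f x h).1.
Proof.
move=> df; have c1 : continuous (fst : W * X -> W) by move=> z; exact: cvg_fst.
apply: etrans (diff_compE h df (linear_differentiable (f x) c1)) _.
by rewrite (@diff_lin _ _ _ fst).
Qed.

Lemma diff_snd (V W X : normedModType R) (f : V -> W * X) x h : differentiable f x ->
  'd (fun b => (f b).2) x h = ('d f x h).2.
Proof.
move=> df; have c2 : continuous (snd : W * X -> X) by move=> z; exact: cvg_snd.
apply: etrans (diff_compE h df (linear_differentiable (f x) c2)) _.
by rewrite (@diff_lin _ _ _ snd).
Qed.

Lemma diff_planar (A : R * R -> R * R) a h : differentiable A a ->
  'd A a h = ('d (fun b => (A b).1) a h, 'd (fun b => (A b).2) a h).
Proof.
by move=> dA; rewrite [LHS]surjective_pairing; congr (_, _); apply/esym; [exact: diff_fst|exact: diff_snd].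
Qed.

Lemma diff_planarE (A : R * R -> R * R) a h : smT A ->
  'd A a h = (h.1 * d1 (fun b => (A b).1) a + h.2 * d2 (fun b => (A b).1) a,
              h.1 * d1 (fun b => (A b).2) a + h.2 * d2 (fun b => (A b).2) a).
Proof. move=> sA; rewrite (diff_planar h (smT_differentiable a sA)).
by congr (_, _); exact: diff_d12. Qed.

(** Liouville's formula: the determinant of two solutions of the variational equation grows at the
    rate given by the divergence. *)
Lemma jac_flow (v : R -> R * R -> R * R) (Phi : R * R -> R -> R * R) (c : R) :
  loc v -> (forall y, Phi y 0 = y /\ solves v (Phi y)) ->
  (forall (t : R) y, 0 <= t <= 1 ->
    ('d (v t) y (1, 0)).1 + ('d (v t) y (0, 1)).2 = c) ->
  forall a, jac (fun y => Phi y 1) a = expR c.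
Proof.
move=> lv HPhi divv a.
have [D [D0 dD]] := @ode_variation _ _ v (Phi a) (1, 0) good_plane lv (HPhi a).2.
have [E [E0 dE]] := @ode_variation _ _ v (Phi a) (0, 1) good_plane lv (HPhi a).2.
have [dP PD] := flow_diffE good_plane lv HPhi D0 dD.
have [_ PE] := flow_diffE good_plane lv HPhi E0 dE.
have {PD}PD := PD; rewrite diff_planar // in PD.
have {PE}PE := PE; rewrite diff_planar // in PE.
have -> : jac (fun y => Phi y 1) a = (D 1).1 * (E 1).2 - (D 1).2 * (E 1).1.
  by rewrite /jac d1.unlock d2.unlock -PD -PE.
have vE t (h : R * R) : 'd (v t) (Phi a t) h =
    h.1 *: 'd (v t) (Phi a t) (1, 0) + h.2 *: 'd (v t) (Phi a t) (0, 1).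
  have {1}-> : h = h.1 *: (1, 0) + h.2 *: (0, 1).
    case: h => x y; congr (_, _) => /=;
    by rewrite /GRing.scale/= ?mulr0 ?mulr1 ?add0r ?addr0.
  by rewrite linearD !linearZ.
pose W t := (D t).1 * (E t).2 - (D t).2 * (E t).1.
have HW (t : R) : 0 <= t <= 1 -> is_derive t 1 W (c * W t).
  move=> tI; have dDt := dD t tI; have dEt := dE t tI.
  have := is_derive_sub (is_derive_mul (is_derive_fst dDt) (is_derive_snd dEt))
    (is_derive_mul (is_derive_snd dDt) (is_derive_fst dEt)).
  apply: is_deriveE; rewrite /W (vE t (D t)) (vE t (E t)) -(divv t (Phi a t) tI) /=.
  move: ('d (v t) (Phi a t) (1, 0)) ('d (v t) (Phi a t) (0, 1)) (D t) (E t) => x y z w.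
  by rewrite /GRing.scale /=; ring.
have := is_derive0_expR HW; rewrite /W D0 E0 /= => ->.
by rewrite mulr1 mulr0 subr0 mul1r.
Qed.

Lemma loc_diff_bound_compact (V W : normedModType R) (v : R -> V -> W) (K : set (R * V)) :
  loc v -> compact K -> exists2 C, 0 <= C &
    forall (t : R) y, 0 <= t <= 1 -> K (t, y) -> forall h, `|'d (v t) y h| <= C * `|h|.
Proof.
move=> lv cK.
pose P (n : nat) (z : R * V) := 0 <= z.1 <= 1 ->
  forall h, `|'d (v z.1) (z.2) h| <= n.+1%:R * `|h|.
have : \forall n \near \oo, K `<=` P n.
  have /compact_near_coveringP := cK; apply => -[t0 y0] _.
  (* A time outside [0, 1] remains outside nearby, and the claim is void there. *)
  have [t0I|t0I] := pselect (0 <= t0 <= 1 : Prop); last first.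
    have ct : {for (t0, y0), continuous (fun z : R * V => clamp z.1 - z.1)}.
      apply: cvgB; last exact: cvg_fst.
      by apply: (continuous_comp (f := fst)); [exact: cvg_fst|exact: clamp_continuous].
    have n0 : clamp t0 - t0 != 0.
      apply/eqP => /eqP; rewrite subr_eq0 => /eqP E; apply: t0I.
      by rewrite -E; exact: clamp01.
    have := @cvgr_neq0 _ _ _ _ _ _ _ ct n0 => H.
    near=> z n => zI h; exfalso.
    have : clamp z.1 - z.1 != 0 by near: z; exact: H.
    by have := clamp_id zI; rewrite /= => ->; rewrite subrr eqxx.
  have [U [g [oU Ux sg vg]]] := loc_diff lv (y0, 0) t0I.
  have g0 : g (t0, (y0, 0)) = 0 by rewrite -vg //= linear0.
  have cg := sm_continuous sg Ux.
  have : \forall z \near (t0, (y0, 0 : V)), U z /\ `|g z| < 1.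
    apply: filterI; first exact: (near_open oU Ux).
    by apply: (cvgr_norm_lt _ cg); rewrite g0 normr0 ltr01.
  move=> /nbhs_ballP[d /= d0 Hd].
  have nN : \forall n \near \oo, 2 / d < n%:R.
    near=> n; apply: lt_le_trans (_ : (Num.truncn (2 / d)).+1%:R <= _).
      by have := truncnS_gt (2 / d).
    by rewrite ler_nat; near: n; exact: nbhs_infty_ge.
  have Hz : \forall z \near (t0, y0), `|(t0, y0) - z| < d.
    by apply/nbhs_ballP; exists d => // z; rewrite -ball_normE.
  near=> z n => zI h.
  have : `|(t0, y0) - z| < d by near: z; exact: Hz.
  rewrite [z]surjective_pairing norm_pair_lt => /andP[dt dy].
  have H h' : `|h'| < d -> `|'d (v z.1) (z.2) h'| <= 1.
    move=> h'd; have [Uz gz] : U (z.1, (z.2, h')) /\ `|g (z.1, (z.2, h'))| < 1.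
      apply: Hd; rewrite -ball_normE /=.
      by rewrite !norm_pair_lt dt /= sub0r normrN h'd andbT.
    by have /= -> := vg _ (z.2, h') zI Uz; exact: ltW.
  have fZ b h' : 'd (v z.1) (z.2) (b *: h') = b *: 'd (v z.1) (z.2) h' by rewrite linearZ.
  apply: le_trans (scaled_bound d0 ler01 fZ H h) _.
  apply: ler_wpM2r => //.
  have : 2 / d < n%:R by near: n.
  have : n%:R < n.+1%:R :> R by rewrite ltr_nat.
  lra.
move=> [N _ /(_ N (leqnn N)) HN].
exists N.+1%:R; first by rewrite ler0n.
by move=> t y tI Ky; exact: (HN (t, y)).
Unshelve. all: by end_near. Qed.

Lemma floor_shift (q : R) : exists m : int, 0 <= q + m%:~R <= 1.
Proof.
exists (- Num.floor q).
have := floor_itv q => /andP[].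
rewrite mulrNz intrD => ? ?; apply/andP; split; lra.
Qed.

Definition periodic (T : Type) (f : R * R -> T) := forall q p, f (q + 1, p) = f (q, p).

Lemma periodic_int (T : Type) (f : R * R -> T) : periodic f ->
  forall (m : int) q p, f (q + m%:~R, p) = f (q, p).
Proof.
move=> pf; have H (n : nat) : forall q p, f (q + n%:R, p) = f (q, p).
  elim: n => [|n IH] q p; first by rewrite addr0.
  by rewrite -natr1 addrA pf IH.
case=> n q p; first exact: H.
by rewrite NegzE mulrNz -{2}(subrK n.+1%:R q) H.
Qed.

(** The rectangle [[0, 1] x [-r, r]] is compact; integer translations carry the derivative bound to
    the rest of the strip, and the field vanishes outside it. *)
Lemma periodic_lipschitz (v : R -> R * R -> R * R) (r : R) : loc v ->
  (forall t : R, 0 <= t <= 1 -> periodic (v t)) ->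
  (forall (t : R) a, 0 <= t <= 1 -> r < `|a.2| -> v t a = 0) ->
  exists2 C, 0 <= C &
    forall (t : R) x y, 0 <= t <= 1 -> `|v t x - v t y| <= C * `|x - y|.
Proof.
move=> lv pv v0.
have cK : compact (`[0 : R, 1]%classic `*` (`[0 : R, 1]%classic `*` `[- r, r]%classic)).
  by do 2 ?apply: compact_setX; exact: segment_compact.
have [C C0 HC] := loc_diff_bound_compact lv cK.
exists C => // t x y tI.
have dv z : differentiable (v t) z by exact: loc_differentiable.
have bound z h : `|'d (v t) z h| <= C * `|h|.
  case: z => q p.
  have [m qm] := floor_shift q.
  have -> : 'd (v t) (q, p) h = 'd (v t) (q + m%:~R, p) h.
    have tr : differentiable (fun z : R * R => z + (m%:~R, 0)) (q, p).
      by apply: differentiableD => //; exact: differentiable_cst.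
    have E1 : v t = fun z => v t (z + (m%:~R, 0)).
      apply/funext => -[z1 z2]; rewrite -[(z1, z2) + _]/(z1 + m%:~R, z2 + 0) addr0.
      by rewrite (periodic_int (pv t tI)).
    have Ea : (q, p) + (m%:~R, 0) = (q + m%:~R, p) by congr (_, _); exact: addr0.
    have dtr : 'd (fun z : R * R => z + (m%:~R, 0)) (q, p) h = h.
      apply: (diff_line tr); apply: (is_deriveE (addr0 _)).
      by apply: is_derive_add; exact: is_derive_line.
    apply: etrans (congr1 (fun F : R * R -> R * R => 'd F (q, p) h) E1) _.
    apply: etrans (diff_compE h tr (dv _)) _.
    have F (x' y' x'' y'' : R * R) : x' = x'' -> y' = y'' ->
      'd (v t) x' y' = 'd (v t) x'' y'' by move=> -> ->.
    exact: F Ea dtr.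
  have [pr|pr] := leP `|p| r.
    apply: HC => //; split => /=; first by rewrite in_itv.
    by split; rewrite /= in_itv //= -ler_norml.
  have -> : 'd (v t) (q + m%:~R, p) h = 0; last by rewrite normr0 mulr_ge0.
  have E : \forall z \near (q + m%:~R, p), cst 0 z = v t z.
    have cn : {for (q + m%:~R, p), continuous (fun z : R * R => `|z.2|)}.
      by apply: cvg_norm; exact: cvg_snd.
    have /cvgr_gt/(_ r pr) := cn.
    by apply: filterS => z zr; rewrite v0.
  have [_ ->] := near_eq_differentiable E (differentiable_cst _ _).
  by rewrite diff_cst.
rewrite -{1}(subrK y x) [x - y + y]addrC.
by apply: mean_value_le => s sI.
Qed.

End planar_fields.

(** * Bump functions *)

Section bump.
Context {R : realType}.

(** The powers of [1 / x] are included so that the family is closed under differentiation, up to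
    linear combinations. Smoothness of all members is then one induction on the order. *)
Definition flat (n : nat) (x : R) : R :=
  if 0 < x then x^-1 ^+ n * expR (- x^-1) else 0.

Lemma flat_ge0 n x : 0 <= flat n x.
Proof.
by rewrite /flat; case: ltP => // x0; rewrite mulr_ge0 ?expR_ge0 // exprn_ge0 // invr_ge0 ltW.
Qed.

Lemma flat_le0 n x : x <= 0 -> flat n x = 0.
Proof. by rewrite /flat leNgt => /negbTE ->. Qed.

Lemma flatS n x : flat n x = x * flat n.+1 x.
Proof.
rewrite /flat; case: ltP => [x0|]; last by rewrite mulr0.
by rewrite exprS !mulrA divff ?mul1r // gt_eqF.
Qed.

(** With [y = 1 / x], the exponential [expR y] is the power [n + 1] of [expR (y / (n + 1))], hence
    at least [(y / (n + 1))^(n + 1)]. The linear bound gives differentiability at 0. *)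
Lemma flat_bound n : exists2 C, 0 < C & forall x, 0 < x -> flat n x <= C * x.
Proof.
exists (n.+1%:R ^+ n.+1); first by rewrite exprn_gt0.
move=> x x0; rewrite /flat x0 expRN ler_pdivrMr ?expR_gt0 //.
set y := x^-1; have y0 : 0 < y by rewrite invr_gt0.
have n0 : 0 < n.+1%:R :> R by rewrite ltr0n.
have : (y / n.+1%:R) ^+ n.+1 <= expR y.
  have -> : y = n.+1%:R * (y / n.+1%:R) by field; rewrite gt_eqF.
  rewrite expRM_natl.
  have -> : n.+1%:R * (y / n.+1%:R) / n.+1%:R = y / n.+1%:R by field; rewrite gt_eqF.
  rewrite lerXn2r ?nnegrE ?expR_ge0 ?divr_ge0 ?ltW //.
  by apply: lt_le_trans (expR_ge1Dx _); rewrite ltrDr.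
rewrite expr_div_n ler_pdivrMr ?exprn_gt0 // mulrC exprS => H.
have -> : y ^+ n = x * (y * y ^+ n) by rewrite /y mulrA divff ?mul1r // gt_eqF.
by rewrite [leRHS]mulrAC mulrC ler_pM2r.
Qed.

Lemma is_derive_flat n (x : R) :
  is_derive x 1 (flat n) (flat n.+2 x - n%:R * flat n.+1 x).
Proof.
have [x0|x0|->] := ltgtP x 0.
- rewrite !flat_le0 ?ltW // mulr0 subr0.
  apply: (near_eq_is_derive (f := cst 0)).
  by apply: filterS (lt_nbhsl x0) => y y0; rewrite flat_le0 ?ltW.
- pose g (y : R) := y^-1 ^+ n * expR (- y^-1).
  apply: (near_eq_is_derive (f := g)).
    by apply: filterS (lt_nbhsr x0) => y y0; rewrite /flat /g ifT.
  have xn0 : x != 0 by rewrite gt_eqF.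
  have dV : is_derive x 1 (fun y : R => y^-1) (- x^-1 ^+ 2).
    split; first exact: (derivableV (f := id)).
    by rewrite (deriveV (f := id)) // derive_id /GRing.scale /= mulr1 exprVn.
  have dX : is_derive x 1 (fun y : R => y^-1 ^+ n) (n%:R * x^-1 ^+ n.-1 * - x^-1 ^+ 2).
    elim: n {g} => [|m IH].
      by rewrite mul0r mul0r; under eq_fun do rewrite expr0; exact: is_derive_cst.
    under eq_fun do rewrite exprS.
    have := is_derive_mul dV IH; apply: is_deriveE.
    by case: m {IH} => [|m] /=; rewrite ?expr0 ?exprS -?natr1; ring.
  have dN : is_derive x 1 (fun y : R => - y^-1) (x^-1 ^+ 2).
    by apply: (is_deriveE (opprK _)); exact: is_deriveN.
  have dE := is_derive_1comp (g := fun y => - y^-1) (is_derive_expR (- x^-1)) dN.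
  have := is_derive_mul dX dE; apply: is_deriveE.
  rewrite /flat x0 /GRing.scale /=.
  by case: n {g dX} => [|n] /=; rewrite ?exprS ?expr0; ring.
rewrite !flat_le0 // mulr0 subr0.
have [C C0 HC] := flat_bound n.+1.
apply/is_derive_approxP => e e0; exists (e / C); first by rewrite divr_gt0.
move=> h; rewrite ltr_pdivlMr // add0r scaler0 subr0 (flat_le0 n (lexx 0)) subr0 => hC.
rewrite ger0_norm ?flat_ge0 //; have [h0|h0] := leP h 0.
  by rewrite flat_le0 // mulr_ge0 // ltW.
rewrite gtr0_norm // in hC *; rewrite flatS mulrC ler_pM2r //.
by apply: le_trans (HC h h0) _; rewrite mulrC ltW.
Qed.

Lemma Cn_mul k (V : normedModType R) (U : set V) (f g : V -> R) : open U ->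
  Cn k U f -> Cn k U g -> Cn k U (fun x => f x * g x).
Proof.
move=> oU cf cg.
apply: (@Cn_comp _ _ _ _ _ U setT (fun x => (f x, g x)) (fun z : R * R => z.1 * z.2)) => //.
- exact: openTT.
- exact: Cn_pair.
- by apply: smT_mul; [exact: sm_fst|exact: sm_snd].
Qed.

Lemma sm_flat n : smT (flat n).
Proof.
move=> k; elim: k n => [|k IH] n.
  by move=> x _; exact: is_derive_continuous (is_derive_flat n x).
split=> [x _|]; first by have [] := is_derive_diff (is_derive_flat n x).
have oT := openTT (R * R)%type.
have H m : Cn k [set: R * R] (fun z : R * R => flat m z.1).
  apply: (@Cn_comp _ _ _ _ _ setT setT fst (flat m)) => //; first exact: openTT.
  exact: Cn_fst.
have HZ : Cn k [set: R * R] (fun z : R * R => z.2 * (flat n.+2 z.1 + (- n%:R) * flat n.+1 z.1)).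
  apply: Cn_mul => //; first exact: Cn_snd.
  by apply: Cn_add => //; apply: Cn_mul => //; exact: Cn_cst.
apply: (@Cn_sub _ k _ _ setT) => //; apply: Cn_eq oT _ HZ => -[x h] _ /=.
by have [_ ->] := is_derive_diff (is_derive_flat n x); rewrite mulNr.
Qed.

Lemma sm_fun_fst (f : R -> R) : smT f -> smT (fun a : R * R => f a.1).
Proof. by move=> sf; apply: (smT_comp _ sf); exact: sm_fst. Qed.

Lemma sm_fun_snd (f : R -> R) : smT f -> smT (fun a : R * R => f a.2).
Proof. by move=> sf; apply: (smT_comp _ sf); exact: sm_snd. Qed.

Lemma primitive_line (f : R -> R) (q0 : R) : smT f -> exists N : R -> R,
  [/\ smT N, forall x : R, is_derive x 1 N (f x) & N q0 = 0].
Proof.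
move=> sf; have [N [sN dN N0]] := primitive1 q0 (sm_fun_fst sf).
exists (fun x => N (x, 0)); split => //.
  apply: (smT_comp _ sN); apply: smT_pair; [exact: sm_id|exact: sm_cst].
by move=> x; have := is_derive_d1 x 0 sN; rewrite dN.
Qed.

Lemma smooth_step : exists c c' : R -> R, [/\ smT c /\ smT c',
  forall x : R, is_derive x 1 c (c' x),
  forall x, 0 <= c' x,
  forall x, (x <= 0 -> c x = 0) /\ (1 <= x -> c x = 1) &
  forall x, 0 <= c x <= 1].
Proof.
pose f x := flat 0 x * flat 0 (1 - x).
have sf : smT f.
  apply: smT_mul; first exact: sm_flat.
  apply: (@smT_comp _ _ _ _ (fun x : R => 1 - x) (flat 0)); last exact: sm_flat.
  by apply: smT_sub; [exact: sm_cst|exact: sm_id].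
have f0 x : 0 <= f x by rewrite mulr_ge0 ?flat_ge0.
have fout x : x <= 0 \/ 1 <= x -> f x = 0.
  by move=> [x0|x1]; rewrite /f; [rewrite flat_le0 ?mul0r|rewrite (@flat_le0 _ (1 - x)) ?mulr0 //; lra].
have fin x : 0 < x -> x < 1 -> 0 < f x.
  move=> x0 x1; have x1' : 0 < 1 - x by lra.
  by rewrite /f /flat x0 x1' !mulr_gt0 ?expR_gt0.
have [N [sN dN N0]] := primitive_line 0 sf.
have mono x y : x <= y -> N x <= N y.
  rewrite le_eqVlt => /orP[/eqP -> //|xy].
  have [z [_ _]] := mean_value xy (fun z _ => dN z).
  by have := f0 z; nra.
have N1 : 0 < N 1.
  have h : (1 / 4 : R) < 3 / 4 by lra.
  have [z [z1 z2]] := mean_value h (fun z _ => dN z).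
  have := fin z ltac:(lra) ltac:(lra).
  have := mono 0 (1 / 4) ltac:(lra); have := mono (3 / 4) 1 ltac:(lra); rewrite N0; nra.
have Nle x : x <= 0 -> N x = 0.
  move=> x0; rewrite -N0; apply/esym/(constant_of_derive0_itv x0) => y /andP[_ y0].
  by have := dN y; rewrite fout //; left.
have Nge x : 1 <= x -> N x = N 1.
  move=> x1; apply: (constant_of_derive0_itv x1) => y /andP[y1 _].
  by have := dN y; rewrite fout //; right.
exists (fun x => (N 1)^-1 * N x), (fun x => (N 1)^-1 * f x).
have i0 : 0 < (N 1)^-1 by rewrite invr_gt0.
split.
- by split; apply: smT_mul => //; exact: sm_cst.
- move=> x; have := is_derive_mul (is_derive_cst (N 1)^-1 x 1) (dN x).
  by apply: is_deriveE; rewrite /cst /=; ring.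
- by move=> x; rewrite mulr_ge0 // ltW.
- by move=> x; split => [/Nle ->|/Nge ->]; rewrite ?mulr0 ?mulVf // gt_eqF.
move=> x; have [x0|x0] := leP x 0; first by rewrite (Nle x x0) mulr0 lexx ler01.
have [x1|x1] := leP 1 x; first by rewrite (Nge x x1) mulVf ?gt_eqF // lexx ler01.
rewrite mulrC -ler_pdivrMr // invrK mul0r ler_pdivrMr // mul1r -{1}N0 !mono //; lra.
Qed.

End bump.

(** * Area-preserving maps of the plane *)

Notation pr1 m := (fun a => (m a).1).
Notation pr2 m := (fun a => (m a).2).

(* Lifts to the plane of compactly supported area-preserving diffeomorphisms of
   the strip, together with their inverses. *)
Record sympl (R : realType) (r : R) (m n : R * R -> R * R) : Prop := Sympl {
  sympl_sm : smT m;
  sympl_smV : smT n;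
  symplK : forall a, n (m a) = a;
  symplVK : forall a, m (n a) = a;
  sympl_jac : forall a, jac m a = 1;
  sympl_shift : forall q p, m (q + 1, p) = ((m (q, p)).1 + 1, (m (q, p)).2);
  sympl_id : forall a, r < `|a.2| -> m a = a }.

Section sympl_theory.
Context {R : realType}.
Implicit Types (a : R * R).

(** A matrix of determinant one is inverted by its adjugate. This is how area preservation enters
    all later changes of variables. *)
Lemma inverse_derivatives (m n : R * R -> R * R) a : smT m -> smT n ->
  (forall b, n (m b) = b) -> jac m a = 1 ->
  [/\ d1 (pr1 n) (m a) = d2 (pr2 m) a, d2 (pr1 n) (m a) = - d2 (pr1 m) a,
      d1 (pr2 n) (m a) = - d1 (pr2 m) a & d2 (pr2 n) (m a) = d1 (pr1 m) a].
Proof.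
move=> sm sn nm; rewrite /jac => J.
have s1 := smT_fst sn; have s2 := smT_snd sn.
have := d1_comp a s1 sm; have := d2_comp a s1 sm.
have := d1_comp a s2 sm; have := d2_comp a s2 sm.
have -> : (fun b => (n (m b)).1) = fst by apply/funext => b; rewrite nm.
have -> : (fun b => (n (m b)).2) = snd by apply/funext => b; rewrite nm.
rewrite d1_fst d2_fst d1_snd d2_snd.
move: (d1 (pr1 m) a) (d2 (pr1 m) a) (d1 (pr2 m) a) (d2 (pr2 m) a) J => A B C D J.
move: (d1 (pr1 n) (m a)) (d2 (pr1 n) (m a)) (d1 (pr2 n) (m a)) (d2 (pr2 n) (m a)) => E F G H h1 h2 h3 h4.
split.
- have -> : E = (A * D - C * B) * E by rewrite J mul1r.
  have -> : (A * D - C * B) * E = D * (A * E + C * F) - C * (B * E + D * F) by ring.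
  by rewrite -h4 -h3; ring.
- have -> : F = (A * D - C * B) * F by rewrite J mul1r.
  have -> : (A * D - C * B) * F = A * (B * E + D * F) - B * (A * E + C * F) by ring.
  by rewrite -h4 -h3; ring.
- have -> : G = (A * D - C * B) * G by rewrite J mul1r.
  have -> : (A * D - C * B) * G = D * (A * G + C * H) - C * (B * G + D * H) by ring.
  by rewrite -h1 -h2; ring.
- have -> : H = (A * D - C * B) * H by rewrite J mul1r.
  have -> : (A * D - C * B) * H = A * (B * G + D * H) - B * (A * G + C * H) by ring.
  by rewrite -h1 -h2; ring.
Qed.

Lemma tube (G : R * R -> R) (x1 x2 : R) : continuous G ->
  (forall x, x1 <= x <= x2 -> 0 < G (x, 0)) ->
  exists2 e, 0 < e & forall x s, x1 <= x <= x2 -> `|s| <= e -> 0 < G (x, s).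
Proof.
move=> cG G0.
pose P (n : nat) (x : R) := forall s, `|s| <= n.+1%:R^-1 -> 0 < G (x, s).
have : \forall n \near \oo, `[x1, x2]%classic `<=` P n.
  have /compact_near_coveringP := @segment_compact R x1 x2.
  apply => x0; rewrite /= in_itv /= => x0I.
  have /cvgr_gt/(_ 0 (G0 _ x0I)) := cG (x0, 0).
  move=> /nbhs_ballP[d /= d0 Hd].
  have nN : \forall n \near \oo, 1 / d < n%:R.
    near=> n; apply: lt_le_trans (_ : (Num.truncn (1 / d)).+1%:R <= _).
      by have := truncnS_gt (1 / d).
    by rewrite ler_nat; near: n; exact: nbhs_infty_ge.
  have Hx : \forall x \near x0, `|x0 - x| < d.
    by apply/nbhs_ballP; exists d => // z; rewrite -ball_normE.
  near=> x n => s sn; apply: Hd; rewrite -ball_normE /=.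
  rewrite -[(x0, 0) - (x, s)]/(x0 - x, 0 - s) norm_pair_lt sub0r normrN.
  apply/andP; split; first by near: x; exact: Hx.
  apply: le_lt_trans sn _; rewrite invf_plt ?posrE //.
  have n1 : n%:R < n.+1%:R :> R by rewrite ltr_nat.
  apply: lt_trans n1; rewrite -div1r.
  by near: n.
move=> [N _ /(_ N (leqnn N)) HN].
exists (N.+1%:R^-1); first by rewrite invr_gt0 ltr0n.
by move=> x s xI; apply: (HN x); rewrite /= in_itv.
Unshelve. all: by end_near. Qed.

Lemma nondecreasing_of_derive (f f' : R -> R) (x1 x2 : R) : x1 <= x2 ->
  (forall x, x1 <= x <= x2 -> is_derive x 1 f (f' x)) ->
  (forall x, x1 <= x <= x2 -> 0 <= f' x) -> f x1 <= f x2.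
Proof.
rewrite le_eqVlt => /orP[/eqP -> //|x12] df f0.
have [c [c1 c2]] := mean_value x12 df.
have := f0 c ltac:(lra); nra.
Qed.

Lemma lipschitz_of_derive (f f' : R -> R) (x1 x2 C : R) : x1 <= x2 ->
  (forall x, x1 <= x <= x2 -> is_derive x 1 f (f' x)) ->
  (forall x, x1 <= x <= x2 -> `|f' x| <= C) -> `|f x2 - f x1| <= C * (x2 - x1).
Proof.
rewrite le_eqVlt => /orP[/eqP ->|x12] df fC.
  by rewrite !subrr normr0 mulr0.
have [c [c1 c2 ->]] := mean_value x12 df.
by rewrite normrM (gtr0_norm (_ : 0 < x2 - x1)) ?subr_gt0 // ler_pM2r ?subr_gt0 // fC; lra.
Qed.

Lemma derive_zero_of_locally_constant (f f' : R -> R) (c x : R) :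
  (\forall y \near x, f y = c) -> is_derive x 1 f (f' x) -> f' x = 0.
Proof.
move=> fc; have : is_derive x 1 f 0.
  apply: (near_eq_is_derive (f := cst c)).
  by apply: filterS fc => y ->.
by move=> H1 H2; exact: is_derive_unique H2 H1.
Qed.

Lemma smooth_step_between (x1 x2 : R) : x1 < x2 -> exists h h' : R -> R,
  [/\ smT h /\ smT h', forall x : R, is_derive x 1 h (h' x),
   forall x, 0 <= h' x /\ 0 <= h x <= 1,
   forall x, (x <= x1 -> h x = 0) /\ (x2 <= x -> h x = 1) &
   forall x, (x < x1) || (x2 < x) -> h' x = 0].
Proof.
move=> x12; have [c [c' [[sc sc'] dc c'0 c01 cI]]] := @smooth_step R.
have d0 : 0 < x2 - x1 by rewrite subr_gt0.
pose k x := (x - x1) * (x2 - x1)^-1.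
have sk : smT k.
  apply: smT_mul; last exact: sm_cst.
  by apply: smT_sub; [exact: sm_id|exact: sm_cst].
have dk (x : R) : is_derive x 1 k (x2 - x1)^-1.
  have := is_derive_mul (is_derive_sub (is_derive_id x 1) (is_derive_cst x1 x 1))
    (is_derive_cst (x2 - x1)^-1 x 1).
  by apply: is_deriveE; rewrite /cst /=; ring.
have h01 x : (x <= x1 -> c (k x) = 0) /\ (x2 <= x -> c (k x) = 1).
  split=> xx.
    by apply: (c01 _).1; rewrite /k ler_pdivrMr // mul0r subr_le0.
  by apply: (c01 _).2; rewrite /k ler_pdivlMr // mul1r lerD2r.
have dh (x : R) : is_derive x 1 (fun x => c (k x)) ((x2 - x1)^-1 * c' (k x)).
  exact: is_derive_1comp (dc _) (dk x).
exists (fun x => c (k x)), (fun x => (x2 - x1)^-1 * c' (k x)); split => //.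
- split; first exact: smT_comp sk sc.
  by apply: smT_mul; [exact: sm_cst|exact: smT_comp sk sc'].
- by move=> x; split => //; rewrite mulr_ge0 // invr_ge0 ltW.
move=> x /orP[xx|xx].
  apply: (derive_zero_of_locally_constant (f' := fun x => (x2 - x1)^-1 * c' (k x)) (c := 0) _ (dh x)).
  by apply: filterS (lt_nbhsl xx) => y /ltW /(h01 y).1.
apply: (derive_zero_of_locally_constant (f' := fun x => (x2 - x1)^-1 * c' (k x)) (c := 1) _ (dh x)).
by apply: filterS (lt_nbhsr xx) => y /ltW /(h01 y).2.
Qed.

End sympl_theory.

(** * The action of an arc in a thin strip *)

Section barrier.
Context {R : realType}.
Implicit Types (z : R * R).

Lemma smT_is_derive (f : R -> R) : smT f ->
  exists f' : R -> R, forall x : R, is_derive x 1 f (f' x).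
Proof.
move=> sf; exists (fun x => 'D_1 f x) => x; apply: derivableP.
exact/derivable1_diffP/smT_differentiable.
Qed.

Lemma d1_fun (k k' : R -> R) (f : R * R -> R) z : smT k -> smT f ->
  (forall x : R, is_derive x 1 k (k' x)) ->
  d1 (fun z => k (f z)) z = d1 f z * k' (f z).
Proof.
move=> sk sf dk; apply: d1_eq; first exact: smT_comp sf sk.
case: z => q p; exact: is_derive_1comp (dk _) (is_derive_d1 q p sf).
Qed.

Lemma d2_fun (k k' : R -> R) (f : R * R -> R) z : smT k -> smT f ->
  (forall x : R, is_derive x 1 k (k' x)) ->
  d2 (fun z => k (f z)) z = d2 f z * k' (f z).
Proof.
move=> sk sf dk; apply: d2_eq; first exact: smT_comp sf sk.
case: z => q p; exact: is_derive_1comp (dk _) (is_derive_d2 q p sf).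
Qed.

Lemma flat_gt0 k (x : R) : 0 < x -> 0 < flat k x.
Proof. by move=> x0; rewrite /flat x0 mulr_gt0 ?expR_gt0 // exprn_gt0 // invr_gt0. Qed.

(* Smooth substitute for the statement that an embedded arc separates: [w]
   jumps by one across the part of the curve [m (x, 0)] with [a <= x <= b],
   which lies in the upper half plane, and is locally constant elsewhere there;
   hence it takes values in [0, 1] or in [-1, 0]. *)
Lemma barrier (r : R) (m n : R * R -> R * R) (a b rho eta eps c0 : R)
    (k k' h h' : R -> R) :
  sympl r m n -> r < 1 ->
  (forall z, `|(m z).1 - z.1| <= 1) -> (forall z, `|(m z).2 - z.2| <= eps) ->
  0 < eps -> eps <= 1 / 4 -> 0 < eta -> eta <= eps ->
  smT k /\ smT k' -> (forall x : R, is_derive x 1 k (k' x)) ->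
  (forall x, k x != 0 -> a - rho <= x <= b + rho) ->
  (forall x s, k' x != 0 -> `|s| <= eta -> (m (x, s)).2 <= 0) ->
  k c0 = 1 ->
  smT h /\ smT h' -> (forall x : R, is_derive x 1 h (h' x)) ->
  (forall s, 0 <= h s <= 1) -> (forall s, h' s != 0 -> `|s| <= eta) ->
  (forall s, `|s| <= eta -> 0 < (m (c0, s)).2) ->
  (forall x y s, `|s| <= eta -> a - rho <= x <= b + rho -> 0 < (m (x, s)).2 ->
     (x <= y <= c0) || (c0 <= y <= x) -> 0 < (m (y, s)).2) ->
  exists w : R * R -> R, [/\ smT w,
    forall z, d2 w z = k (n z).1 * h' (n z).2 * d2 (pr2 n) z,
    forall q p, 0 < p <= 1 -> `|w (q, p)| <= 1,
    forall q p, (q < a - rho - 1) || (b + rho + 1 < q) -> w (q, p) = 0 &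
    forall q p, 2 * eps <= p -> w (q, p) = 0].
Proof.
move=> Hm r1 disp thin e0 e14 eta0 eta_e [sk sk'] dk kJ k'P kc0 [sh sh'] dh h01 h'e Pc0 conn.
have [sm sn nm mn J _ _] := Hm.
have sX := smT_fst sn; have sS := smT_snd sn.
have sSp := sm_d2 sS; have sSq := sm_d1 sS.
have [h'' dh''] := smT_is_derive sh'.
pose A z := k (n z).1 * h' (n z).2.
have skX : smT (fun z => k (n z).1) by exact: smT_comp sX sk.
have shS : smT (fun z => h' (n z).2) by exact: smT_comp sS sh'.
have sA : smT A by exact: smT_mul.
(* With [n = (X, S)], the functions [be1] and [be] are the components of the form [k(X) d(h(S))].
   Its differential is [k'(X) h'(S)] times the area form, which vanishes in the upper half plane by
   the hypothesis on [k']. *)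
pose be z := A z * d2 (pr2 n) z.
pose be1 z := A z * d1 (pr2 n) z.
have sbe : smT be by exact: smT_mul.
have sbe1 : smT be1 by exact: smT_mul.
have d1A z : d1 A z = k (n z).1 * (d1 (pr2 n) z * h'' (n z).2) + h' (n z).2 * (d1 (pr1 n) z * k' (n z).1).
  by rewrite (d1_mul z skX shS) (d1_fun z sh' sS dh'') (d1_fun z sk sX dk).
have d2A z : d2 A z = k (n z).1 * (d2 (pr2 n) z * h'' (n z).2) + h' (n z).2 * (d2 (pr1 n) z * k' (n z).1).
  by rewrite (d2_mul z skX shS) (d2_fun z sh' sS dh'') (d2_fun z sk sX dk).
have closed z : 0 < z.2 -> d1 be z = d2 be1 z.
  move=> z0; rewrite (d1_mul z sA sSp) (d2_mul z sA sSq) d1A d2A (schwarz z sS).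
  have : k' (n z).1 * h' (n z).2 = 0.
    have [//|k0] := eqVneq (k' (n z).1) 0; first by move=> ->; rewrite mul0r.
    have [//|h0] := eqVneq (h' (n z).2) 0; first by move=> ->; rewrite mulr0.
    have := k'P _ _ k0 (h'e _ h0); rewrite -surjective_pairing mn; lra.
  move: (d2 (d1 (pr2 n)) z) (d1 (pr2 n) z) (d1 (pr1 n) z) (d2 (pr2 n) z)
    (d2 (pr1 n) z) (k' (n z).1) (h' (n z).2) (h'' (n z).2) (k (n z).1) (A z) => B C D E F G H I K L GH.
  have -> : L * B + E * (K * (C * I) + H * (D * G)) = L * B + E * K * C * I + E * D * (G * H) by ring.
  have -> : L * B + C * (K * (E * I) + H * (F * G)) = L * B + E * K * C * I + C * F * (G * H) by ring.
  by rewrite GH !mulr0.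
(* Integration starts from the line [p = 1], away from the support of the form, so that [dw] equals
   the form throughout [0 < p <= 1]. *)
have [w [sw dw w1]] := primitive2 1 sbe.
have be_mem z : be z != 0 -> a - rho <= (n z).1 <= b + rho /\ `|(n z).2| <= eta.
  rewrite /be /A !mulf_eq0 !negb_or -andbA => /and3P[k0 h0 _].
  by split; [exact: kJ|exact: h'e].
have near_m z : `|z.1 - (n z).1| <= 1 /\ `|z.2 - (n z).2| <= eps.
  by rewrite -{1 3}(mn z); split; [exact: disp|exact: thin].
have w_out q p : (forall p', be (q, p') = 0) -> w (q, p) = 0.
  move=> H; rewrite -(w1 q).
  apply: (@constant_of_derive0_line _ (fun p => w (q, p))) => y.
  by have := is_derive_d2 q y sw; rewrite dw H.
have w_q q p : (q < a - rho - 1) || (b + rho + 1 < q) -> w (q, p) = 0.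
  move=> /orP qo; apply: w_out => p'; apply/eqP; apply: contraT => /be_mem[xJ _].
  by have [/= + _] := near_m (q, p'); rewrite ler_norml; case: qo => qo; lra.
have w_p q p : 2 * eps <= p -> w (q, p) = 0.
  move=> pe.
  have z0 y : 2 * eps < y -> be (q, y) = 0.
    move=> ye; apply/eqP; apply: contraT => /be_mem[_ sE].
    have [_] := near_m (q, y); move: sE; rewrite /= !ler_norml; lra.
  have z0' y : 2 * eps <= y -> be (q, y) = 0.
    rewrite le_eqVlt => /orP[/eqP <-|]; last exact: z0.
    apply/eqP; apply: contraT => bn.
    have cb : {for 2 * eps, continuous (fun y => be (q, y))}.
      exact: is_derive_continuous (is_derive_d2 q _ sbe).
    have bn0 : 0 < `|be (q, 2 * eps)| by rewrite normr_gt0.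
    have /cvgrPdist_lt/(_ _ bn0)/nbhs_ballP[d /= d0 Hd] := cb.
    have := Hd (2 * eps + d / 2) ltac:(rewrite /ball /= opprD addrA subrr add0r normrN gtr0_norm; lra).
    by rewrite (z0 (2 * eps + d / 2)) ?subr0 ?ltxx //; lra.
  have [p1|/ltW p1] := leP p 1.
    rewrite -(w1 q); apply/esym/(@constant_of_derive0_itv _ (fun p => w (q, p)) _ _ p1) => y yI.
    by have := is_derive_d2 q y sw; rewrite dw z0' //; lra.
  rewrite -(w1 q); apply: (@constant_of_derive0_itv _ (fun p => w (q, p)) _ _ p1) => y yI.
  by have := is_derive_d2 q y sw; rewrite dw z0' //; lra.
have d1w q p : 0 < p <= 1 -> d1 w (q, p) = be1 (q, p).
  move=> pI.
  have : d1 w (q, 1) - be1 (q, 1) = d1 w (q, p) - be1 (q, p).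
    apply: (@constant_of_derive0_itv _ (fun p => d1 w (q, p) - be1 (q, p))); first lra.
    move=> y yI; have := is_derive_sub (is_derive_d2 q y (sm_d1 sw)) (is_derive_d2 q y sbe1).
    apply: is_deriveE; rewrite -(schwarz _ sw).
    have -> : d2 w = be by apply/funext.
    by rewrite closed ?subrr //=; lra.
  have -> : d1 w (q, 1) = 0.
    have E : (fun s => w (s, 1)) = cst 0 by apply/funext => s; rewrite w1.
    have := is_derive_d1 q 1 sw; rewrite E => H.
    exact: is_derive_unique H (is_derive_cst _ _ _).
  have -> : be1 (q, 1) = 0.
    have [h0|/h'e] := eqVneq (h' (n (q, 1)).2) 0; first by rewrite /be1 /A h0 mulr0 mul0r.
    have [_ /=] := near_m (q, 1); rewrite !ler_norml; lra.
  by move=> /eqP; rewrite subrr eq_sym subr_eq0 => /eqP.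
have Ple x s : `|s| <= eta -> (m (x, s)).2 <= 1.
  by move=> se; have /= := thin (x, s); move: se; rewrite !ler_norml; lra.
have An x s : A (m (x, s)) = k x * h' s by rewrite /A nm.
(* In the coordinates carried by [m], the function [w] does not vary with [x], and along [x = c0] it
   varies exactly like [h]; hence [w = h + c] on the part of the tube above the axis. *)
have horiz (x s : R) : `|s| <= eta -> 0 < (m (x, s)).2 ->
    is_derive x 1 (fun x => w (m (x, s))) 0.
  move=> se P0; have := is_derive_d1 x s (smT_comp sm sw).
  apply: is_deriveE; rewrite (d1_comp _ sw sm).
  have [_ _ E3 E4] := inverse_derivatives sm sn nm (J (x, s)).
  rewrite dw [m (x, s)]surjective_pairing d1w -?surjective_pairing; last by rewrite P0 Ple.
  by rewrite /be1 /be E3 E4; ring.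
have vert (s : R) : `|s| <= eta -> is_derive s 1 (fun s => w (m (c0, s)) - h s) 0.
  move=> se; have P0 := Pc0 s se.
  have := is_derive_sub (is_derive_d2 c0 s (smT_comp sm sw)) (dh s).
  apply: is_deriveE; rewrite (d2_comp _ sw sm).
  have [_ _ E3 E4] := inverse_derivatives sm sn nm (J (c0, s)).
  have := J (c0, s); rewrite /jac.
  rewrite dw [m (c0, s)]surjective_pairing d1w -?surjective_pairing; last by rewrite P0 Ple.
  rewrite /be1 /be E3 E4 An kc0 mul1r.
  move: (d1 (pr1 m) _) (d2 (pr2 m) _) (d1 (pr2 m) _) (d2 (pr1 m) _) (h' s) => B C D E F H.
  have -> : E * (F * - D) + C * (F * B) - F = F * ((B * C - D * E) - 1) by ring.
  by rewrite H subrr mulr0.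
pose c := w (m (c0, 0)) - h 0.
have on_tube x s : `|s| <= eta -> a - rho <= x <= b + rho -> 0 < (m (x, s)).2 ->
    w (m (x, s)) = h s + c.
  move=> se xJ P0.
  have -> : w (m (x, s)) = w (m (c0, s)).
    have [xc|/ltW cx] := leP x c0.
      apply/esym/(@constant_of_derive0_itv _ (fun x => w (m (x, s))) _ _ xc) => y yI.
      by apply: horiz => //; apply: (conn x y) => //; rewrite yI.
    apply: (@constant_of_derive0_itv _ (fun x => w (m (x, s))) _ _ cx) => y yI.
    by apply: horiz => //; apply: (conn x y) => //; rewrite yI orbT.
  suff : w (m (c0, s)) - h s = c by move=> <-; ring.
  have [s0|/ltW s0] := leP s 0.
    apply/esym/(@constant_of_derive0_itv _ (fun s => w (m (c0, s)) - h s) _ _ s0) => y yI.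
    by apply: vert; move: se; rewrite !ler_norml; lra.
  apply: (@constant_of_derive0_itv _ (fun s => w (m (c0, s)) - h s) _ _ s0) => y yI.
  by apply: vert; move: se; rewrite !ler_norml; lra.
(* [phi] vanishes exactly on [[c, c + 1]], together with its derivative. On a vertical line [w]
   varies only inside the tube, where its values lie in that interval, so [phi (w)] is constant on
   the line. The line through [m (c0, 0)] shows that this constant, [phi 0], is 0; hence both 0 and
   all values of [w] lie in [[c, c + 1]]. *)
pose phi y := flat 0 (y - (c + 1)) - flat 0 (c - y).
have phi_lt y : c + 1 < y -> 0 < phi y.
  by move=> yc; rewrite /phi (@flat_le0 _ _ (c - y)) ?subr0 ?flat_gt0; lra.
have phi_gt y : y < c -> phi y < 0.
  by move=> yc; rewrite /phi (@flat_le0 _ _ (y - (c + 1))) ?sub0r ?oppr_lt0 ?flat_gt0; lra.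
have phi0 y : phi y = 0 <-> c <= y <= c + 1.
  split=> [E|yI].
    have [yc|yc] := ltP y c; first by have := phi_gt y yc; rewrite E ltxx.
    by have [yc'|//] := ltP (c + 1) y; have := phi_lt y yc'; rewrite E ltxx.
  by rewrite /phi !flat_le0 ?subrr //; lra.
have dphi (y : R) : is_derive y 1 phi (flat 2 (y - (c + 1)) + flat 2 (c - y)).
  have d1 : is_derive y 1 (fun y => y - (c + 1)) 1.
    by apply: (is_deriveE (subr0 _)); apply: is_derive_sub.
  have d2 : is_derive y 1 (fun y => c - y) (- 1).
    by apply: (is_deriveE (sub0r _)); apply: is_derive_sub.
  have := is_derive_sub (is_derive_1comp (is_derive_flat 0 _) d1) (is_derive_1comp (is_derive_flat 0 _) d2).
  by apply: is_deriveE; rewrite /GRing.scale /=; ring.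
have phi_w q p : 0 < p <= 1 -> phi (w (q, p)) = phi 0.
  move=> pI; rewrite -(w1 q); have p1 : p <= 1 by lra.
  apply/esym/(@constant_of_derive0_itv _ (fun p => phi (w (q, p))) _ _ p1) => y yI.
  have := is_derive_1comp (dphi _) (is_derive_d2 q y sw).
  apply: is_deriveE; rewrite dw.
  have [->|bn] := eqVneq (be (q, y)) 0; first by rewrite scale0r.
  have [xJ sE] := be_mem _ bn.
  have E : m ((n (q, y)).1, (n (q, y)).2) = (q, y) by rewrite -surjective_pairing mn.
  have := on_tube _ _ sE xJ; rewrite E /= => -> //; last lra.
  have := h01 (n (q, y)).2 => hI.
  by rewrite !flat_le0 ?addr0 ?scaler0 //; lra.
have cI : c <= 0 <= c + 1.
  have P0 : 0 < (m (c0, 0)).2 by apply: Pc0; rewrite normr0 ltW.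
  have P1 : (m (c0, 0)).2 <= 1 by apply: Ple; rewrite normr0 ltW.
  apply/phi0; rewrite -(phi_w (m (c0, 0)).1 (m (c0, 0)).2); last by rewrite P0.
  rewrite -surjective_pairing; apply/phi0.
  by have := h01 0; rewrite /c; lra.
exists w; split => // q p pI.
have /phi0 : phi (w (q, p)) = 0 by rewrite phi_w //; exact/phi0.
rewrite ler_norml; lra.
Qed.

End barrier.

Section arc.
Context {R : realType}.
Implicit Types (z : R * R).

(* Stokes for the barrier [w] against the form [g(p) dq]: the change of
   variables by the area-preserving map [m] is carried out with primitives in
   both systems of coordinates. *)
Lemma arc_slice (r : R) (m n : R * R -> R * R) (a b rho eps : R)
    (w : R * R -> R) (k h' g g' : R -> R) (Kc : R * R -> R) :
  sympl r m n -> r < 1 -> (forall z, `|(m z).1 - z.1| <= 1) ->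
  0 < eps -> eps <= 1 / 4 -> a < b -> 0 < rho ->
  smT k -> smT h' -> smT g -> (forall x : R, is_derive x 1 g (g' x)) ->
  (forall p, 0 <= g' p) -> (forall p, p <= 0 -> g p = 0 /\ g' p = 0) ->
  (forall p, 0 <= p -> g p <= p) ->
  smT w -> (forall z, d2 w z = k (n z).1 * h' (n z).2 * d2 (pr2 n) z) ->
  (forall q p, 0 < p <= 1 -> `|w (q, p)| <= 1) ->
  (forall q p, (q < a - rho - 1) || (b + rho + 1 < q) -> w (q, p) = 0) ->
  (forall q p, 2 * eps <= p -> w (q, p) = 0) ->
  smT Kc -> (forall z, d1 Kc z = k z.1 * g (m z).2 * d1 (pr1 m) z) ->
  (forall s, Kc (a - rho - 3, s) = 0) ->
  exists Y : R -> R,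
    (forall s : R, is_derive s 1 Y (h' s * Kc (b + rho + 3, s))) /\
    `|Y 1 - Y (- 1)| <= (b - a + 2 * rho + 4) * (2 * eps).
Proof.
move=> Hm r1 disp e0 e14 ab rho0 sk sh' sg dg g'0 gle gub sw dw w_le w_q w_p sKc dKc Kc0.
have [sm sn nm mn J _ mid] := Hm.
have sP := smT_snd sm; have sQ := smT_fst sm.
(* The margins of one unit leave room for the horizontal displacement: [w] vanishes to the left of
   [A1], and [m] maps the edge [xl] there; similarly on the right. *)
pose A1 := a - rho - 2; pose A2 := b + rho + 2; pose xl := a - rho - 3; pose xr := b + rho + 3.
have A12 : A1 <= A2 by rewrite /A1 /A2; lra.
have xlr : xl <= xr by rewrite /xl /xr; lra.
have const_zero (f : R * R -> R) q : smT f -> (forall p, f (q, p) = 0) -> forall p, d2 f (q, p) = 0.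
  move=> sf f0 p; have E : (fun p => f (q, p)) = cst 0 by apply/funext => s; rewrite f0.
  have := is_derive_d2 q p sf; rewrite E => H.
  exact: is_derive_unique H (is_derive_cst _ _ _).
have sg2 : smT (fun z : R * R => g z.2) by exact: sm_fun_snd.
pose f0 z := g z.2 * d2 w z.
have sf0 : smT f0 by apply: smT_mul => //; exact: sm_d2.
have f0_q q p : (q <= A1) || (A2 <= q) -> f0 (q, p) = 0.
  move=> /orP qo; rewrite /f0 (const_zero w) ?mulr0 // => y; apply: w_q.
  by apply/orP; move: qo; rewrite /A1 /A2 => -[qo|qo]; [left|right]; lra.
have [U [sU dU U0]] := primitive1 A1 sf0.
have Ul q p : q <= A1 -> U (q, p) = 0.
  move=> qA; rewrite -(U0 p); apply/esym/(@constant_of_derive0_itv _ (fun q => U (q, p)) _ _ qA) => y yI.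
  by have := is_derive_d1 y p sU; rewrite dU f0_q //; apply/orP; left; lra.
have Ur q p : A2 <= q -> U (q, p) = U (A2, p).
  move=> qA; apply: (@constant_of_derive0_itv _ (fun q => U (q, p)) _ _ qA) => y yI.
  by have := is_derive_d1 y p sU; rewrite dU f0_q //; apply/orP; right; lra.
have sUm : smT (fun z => U (m z)) by exact: smT_comp sm sU.
(* Components of the pullback under [m] of the form [U dp]. The differential of [U dp] is
   [g(p) d2 w] times the area form, and since [m] preserves area, [key] is the same identity read in
   the source coordinates. *)
pose Pf z := U (m z) * d2 (pr2 m) z.
pose Qf z := U (m z) * d1 (pr2 m) z.
have sPf : smT Pf by apply: smT_mul => //; exact: sm_d2.
have sQf : smT Qf by apply: smT_mul => //; exact: sm_d1.
have key z : d1 Pf z - d2 Qf z = h' z.2 * d1 Kc z.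
  rewrite (d1_mul z sUm (sm_d2 sP)) (d2_mul z sUm (sm_d1 sP)) (schwarz z sP).
  rewrite (d1_comp z sU sm) (d2_comp z sU sm) dU dKc /f0 dw nm.
  have [_ _ _ ->] := inverse_derivatives sm sn nm (J z).
  have := J z; rewrite /jac.
  move: (d1 (pr1 m) z) (d2 (pr2 m) z) (d1 (pr2 m) z) (d2 (pr1 m) z) (U (m z)) (d2 U (m z))
    (d2 (d1 (pr2 m)) z) (g _) (k _) (h' _) => B C D E F G H I K L BC.
  have -> : F * H + C * (B * (I * (K * L * B)) + D * G) - (F * H + D * (E * (I * (K * L * B)) + C * G))
    = (B * C - D * E) * (I * K * L * B) by ring.
  by rewrite BC; ring.
have [Qc [sQc dQc Qc0]] := primitive1 xl sQf.
have sh2 : smT (fun z : R * R => h' z.2) by exact: sm_fun_snd.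
have sKh : smT (fun z => h' z.2 * Kc z) by exact: smT_mul.
have Psi s : h' s * Kc (xr, s) - Pf (xr, s) + d2 Qc (xr, s) = 0.
  have -> : h' s * Kc (xr, s) - Pf (xr, s) + d2 Qc (xr, s) =
      h' s * Kc (xl, s) - Pf (xl, s) + d2 Qc (xl, s).
    apply: (@constant_of_derive0_itv _ (fun x => h' s * Kc (x, s) - Pf (x, s) + d2 Qc (x, s)) _ _ xlr) => y yI.
    have := is_derive_add (is_derive_sub (is_derive_d1 y s sKh) (is_derive_d1 y s sPf))
       (is_derive_d1 y s (sm_d2 sQc)).
    apply: is_deriveE; rewrite (d1_mul _ sh2 sKc).
    have -> : d1 (fun z : R * R => h' z.2) (y, s) = 0.
      by apply: (d1_eq sh2) => /=; exact: is_derive_cst.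
    rewrite (schwarz _ sQc); have -> : d1 Qc = Qf by apply/funext.
    by have /= := key (y, s); lra.
  have Pl : U (m (xl, s)) = 0.
    rewrite [m (xl, s)]surjective_pairing Ul //.
    by have /= := disp (xl, s); rewrite ler_norml /A1 /xl; lra.
  by rewrite /Pf Pl (const_zero Qc xl) // /xl Kc0; ring.
have sB : smT (fun p => U (A2, p)).
  by apply: (smT_comp _ sU); apply: smT_pair; [exact: sm_cst|exact: sm_id].
have [BB [sBB dBB BB0]] := primitive_line (- 1) sB.
(* Integrating [key] across the strip leaves boundary terms at the right edge only; [Y] is their
   primitive in [s]. *)
pose Y s := BB (m (xr, s)).2 - Qc (xr, s).
exists Y; split.
  move=> s; have := is_derive_sub (is_derive_1comp (dBB _) (is_derive_d2 xr s sP)) (is_derive_d2 xr s sQc).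
  apply: is_deriveE; have := Psi s; rewrite /Pf -/xr.
  have -> : U (m (xr, s)) = U (A2, (m (xr, s)).2).
    rewrite [m (xr, s)]surjective_pairing Ur //=.
    by have /= := disp (xr, s); rewrite ler_norml /A2 /xr; lra.
  by rewrite /GRing.scale /=; lra.
have m1 x : m (x, 1) = (x, 1) by rewrite mid //= normr1.
have mN1 x : m (x, -1) = (x, -1) by rewrite mid //= normrN1.
have Qc_edge s : (forall x, m (x, s) = (x, s)) -> Qc (xr, s) = 0.
  move=> ms; rewrite -(Qc0 s); apply: (@constant_of_derive0_itv _ (fun x => Qc (x, s)) _ _ xlr) => y yI.
  have := is_derive_d1 y s sQc; apply: is_deriveE; rewrite dQc /Qf.
  have -> : d1 (pr2 m) (y, s) = 0; last by rewrite mulr0.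
  have E : (fun x => (m (x, s)).2) = cst s by apply/funext => x; rewrite ms.
  have := is_derive_d1 y s sP; rewrite E => H.
  exact: is_derive_unique H (is_derive_cst _ _ _).
(* Integration by parts in [p]: since [U = g * d2 V] on the edge [A2], the integral of [U] reduces
   to that of [- V * g']. Here [|w| <= 1] bounds [V] by the width, [g'] vanishes below the axis, and
   [V] vanishes above height [2 * eps]. *)
have [V [sV dV V0]] := primitive1 A1 sw.
have gV p : g p * d2 V (A2, p) = U (A2, p).
  apply/eqP; rewrite -subr_eq0; apply/eqP.
  have -> : g p * d2 V (A2, p) - U (A2, p) = g p * d2 V (A1, p) - U (A1, p).
    apply: (@constant_of_derive0_itv _ (fun q => g p * d2 V (q, p) - U (q, p)) _ _ A12) => y yI.
    have := is_derive_sub (is_derive_mul (is_derive_cst (g p) y 1) (is_derive_d1 y p (sm_d2 sV))) (is_derive_d1 y p sU).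
    apply: is_deriveE; rewrite (schwarz _ sV); have -> : d1 V = w by apply/funext.
    by rewrite dU /f0 /cst /=; ring.
  by rewrite (const_zero V) // U0; ring.
pose M := A2 - A1.
have WM p : 0 < p <= 1 -> `|V (A2, p)| <= M.
  move=> pI; have := @lipschitz_of_derive _ (fun q => V (q, p)) (fun q => w (q, p)) _ _ 1 A12.
  rewrite V0 subr0 mul1r; apply => x _; last exact: w_le.
  by have := is_derive_d1 x p sV; rewrite dV.
have W0 p : 2 * eps <= p -> V (A2, p) = 0.
  move=> pe; rewrite -(V0 p); apply: (@constant_of_derive0_itv _ (fun q => V (q, p)) _ _ A12) => y yI.
  by have := is_derive_d1 y p sV; rewrite dV w_p.
pose Xi p := BB p - g p * V (A2, p).
have dXi (p : R) : is_derive p 1 Xi (- (V (A2, p) * g' p)).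
  have := is_derive_sub (dBB p) (is_derive_mul (dg p) (is_derive_d2 A2 p sV)).
  by apply: is_deriveE; rewrite gV; ring.
have M0 : 0 <= M by rewrite subr_ge0.
have WMg p : p <= 2 * eps -> `|V (A2, p) * g' p| <= M * g' p.
  move=> pe; have [p0|p0] := leP p 0; first by rewrite (gle p p0).2 !mulr0 normr0.
  by rewrite normrM (ger0_norm (g'0 p)) ler_wpM2r // WM //; lra.
have dMg (x : R) : is_derive x 1 (fun p => M * g p) (M * g' x).
  have := is_derive_mul (is_derive_cst M x 1) (dg x).
  by apply: is_deriveE; rewrite /cst /=; ring.
have up : Xi (-1) + M * g (- 1) <= Xi (2 * eps) + M * g (2 * eps).
  apply: (@nondecreasing_of_derive _ (fun p => Xi p + M * g p) (fun p => - (V (A2, p) * g' p) + M * g' p)); first lra.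
  by move=> x xI; have := WMg x ltac:(lra); rewrite ler_norml; lra.
have dn : M * g (- 1) - Xi (-1) <= M * g (2 * eps) - Xi (2 * eps).
  apply: (@nondecreasing_of_derive _ (fun p => M * g p - Xi p) (fun p => M * g' p - - (V (A2, p) * g' p))); first lra.
  by move=> x xI; have := WMg x ltac:(lra); rewrite ler_norml; lra.
have top : Xi 1 = Xi (2 * eps).
  have e1 : 2 * eps <= 1 by lra.
  apply: (@constant_of_derive0_itv _ Xi _ _ e1) => y yI.
  by have := dXi y; rewrite W0 ?mul0r ?oppr0 //; lra.
have gN1 : g (- 1) = 0 by apply: (gle _ _).1; lra.
have X1 : Xi 1 = BB 1 by rewrite /Xi W0 ?mulr0 ?subr0 //; lra.
have XN1 : Xi (-1) = BB (-1) by rewrite /Xi gN1 mul0r subr0.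
rewrite /Y m1 mN1 /= (Qc_edge 1 m1) (Qc_edge _ mN1).
have MM : b - a + 2 * rho + 4 = M by rewrite /M /A1 /A2; ring.
have gM : M * g (2 * eps) <= M * (2 * eps) by apply: ler_wpM2l => //; apply: gub; lra.
rewrite MM; rewrite gN1 X1 XN1 in up dn top *.
by rewrite ler_norml; lra.
Qed.

End arc.

Section arc_action.
Context {R : realType}.
Implicit Types (z : R * R).

Lemma continuous_line (f : R * R -> R) (p : R) : smT f -> continuous (fun x => f (x, p)).
Proof. by move=> sf x; exact: is_derive_continuous (is_derive_d1 x p sf). Qed.

Lemma near_line_gt0 (f : R -> R) (x : R) : {for x, continuous f} -> 0 < f x ->
  exists2 d, 0 < d & forall y, `|y - x| <= d -> 0 < f y.
Proof.
move=> /cvgr_gt cf f0; have /nbhs_ballP[d /= d0 H] := cf 0 f0.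
exists (d / 2); first by rewrite divr_gt0.
by move=> y yd; apply: H; rewrite -ball_normE /= distrC; lra.
Qed.

Lemma smooth_cut (tau : R) : 0 < tau -> exists g g' : R -> R,
  [/\ smT g, forall x : R, is_derive x 1 g (g' x),
      (forall p, 0 <= g' p) /\ (forall p, p <= 0 -> g p = 0 /\ g' p = 0),
      forall p, 0 <= p -> g p <= p &
      forall p, 0 <= p -> `|g p - p| <= tau].
Proof.
move=> tau0; have [h [h' [[sh sh'] dh h01 hI hz]]] := smooth_step_between tau0.
exists (fun p => p * h p), (fun p => p * h' p + h p).
have z p : p <= 0 -> p * h' p = 0.
  rewrite le_eqVlt => /orP[/eqP ->|p0]; first by rewrite mul0r.
  by rewrite hz ?mulr0 // p0.
split.
- by apply: smT_mul => //; exact: sm_id.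
- move=> x; have := is_derive_mul (is_derive_id x 1) (dh x).
  by apply: is_deriveE; rewrite /=; ring.
- split=> p.
    have [h'0 /andP[h0 _]] := h01 p.
    have [p0|p0] := leP p 0; first by rewrite z // add0r.
    by rewrite addr_ge0 // mulr_ge0 // ltW.
  by move=> p0; rewrite z // (hI p).1 // mulr0 addr0.
- by move=> p p0; have [_ /andP[h0 h1]] := h01 p; rewrite ler_piMr.
move=> p p0; have [_ /andP[h0 h1]] := h01 p.
have [pt|/ltW pt] := leP tau p; first by rewrite (hI p).2 // mulr1 subrr normr0 ltW.
by rewrite ler_norml; nra.
Qed.

Lemma smooth_plateau (x1 x2 x3 x4 : R) : x1 < x2 -> x2 < x3 -> x3 < x4 ->
  exists k k' : R -> R, [/\ smT k /\ smT k',
   forall x : R, is_derive x 1 k (k' x),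
   forall x, 0 <= k x <= 1 /\ (k x != 0 -> x1 <= x <= x4),
   forall x, x2 <= x <= x3 -> k x = 1 &
   forall x, k' x != 0 -> (x1 <= x <= x2) || (x3 <= x <= x4)].
Proof.
move=> x12 x23 x34.
have [h [h' [[sh sh'] dh h01 hI hz]]] := smooth_step_between x12.
have [l [l' [[sl sl'] dl l01 lI lz]]] := smooth_step_between x34.
have s1 : smT (fun x => 1 - l x) by apply: smT_sub => //; exact: sm_cst.
exists (fun x => h x * (1 - l x)), (fun x => h' x * (1 - l x) - h x * l' x); split.
- split; first exact: smT_mul.
  by apply: smT_sub; exact: smT_mul.
- move=> x; have := is_derive_mul (dh x) (is_derive_sub (is_derive_cst (1 : R) x 1) (dl x)).
  by apply: is_deriveE; rewrite /cst /=; ring.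
- move=> x; split.
    have [_ /andP[h0 h1]] := h01 x; have [_ /andP[l0 l1]] := l01 x.
    by apply/andP; split; nra.
  apply: contraR; rewrite negb_and -!ltNge => /orP[xx|xx].
    by rewrite (hI x).1 ?mul0r // ltW.
  by rewrite (lI x).2 ?subrr ?mulr0 // ltW.
- by move=> x xI; rewrite (hI x).2 ?(lI x).1 ?subr0 ?mulr1 //; lra.
move=> x; apply: contraR; rewrite negb_or !negb_and -!ltNge => /andP[/orP[xx|xx] /orP[yy|yy]].
- by rewrite hz ?xx // (hI x).1 ?(ltW xx) // !mul0r subrr.
- lra.
- by rewrite hz ?xx ?orbT // lz ?yy // mul0r mulr0 subrr.
- by rewrite hz ?xx ?orbT // lz ?yy ?orbT // mul0r mulr0 subrr.
Qed.

(** Transversality makes the height cross zero upwards at [a] and downwards at [b], so just beyond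
    these points the curve lies below the axis, and [k] is cut off there. Nearby slices are monotone
    around both ends and positive in between, which makes the part of each slice above the axis an
    interval around [c0]. *)
Lemma arc_tube (m : R * R -> R * R) (a b eps : R) :
  smT m -> 0 < eps -> a < b ->
  (m (a, 0)).2 = 0 -> (m (b, 0)).2 = 0 ->
  (forall x, a < x < b -> 0 < (m (x, 0)).2) ->
  d1 (pr2 m) (a, 0) != 0 -> d1 (pr2 m) (b, 0) != 0 ->
  let c0 := (a + b) / 2 in
  exists rho, exists2 t0, 0 < rho <= 1 /\ 0 < t0 <= eps & exists k k' : R -> R,
  [/\ [/\ smT k /\ smT k', forall x : R, is_derive x 1 k (k' x),
         forall x, k x != 0 -> a - rho <= x <= b + rho &
         forall x, a <= x <= b -> k x = 1],
   forall x s, k' x != 0 -> `|s| <= t0 -> (m (x, s)).2 <= 0,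
   forall s, `|s| <= t0 -> 0 < (m (c0, s)).2,
   forall x y s, `|s| <= t0 -> a - rho <= x <= b + rho -> 0 < (m (x, s)).2 ->
     (x <= y <= c0) || (c0 <= y <= x) -> 0 < (m (y, s)).2 &
   forall x, (a - rho <= x <= a) || (b <= x <= b + rho) -> (m (x, 0)).2 <= 0].
Proof.
move=> sm e0 ab Pa Pb Pab da db c0.
have sP := smT_snd sm.
have sPx := sm_d1 sP.
pose P z := (m z).2; pose Px z := d1 (pr2 m) z.
have dP (x s : R) : is_derive x 1 (fun x => P (x, s)) (Px (x, s)) by exact: is_derive_d1.
have PxN : continuous (fun z => - Px z) by apply: smT_continuous; exact: smT_opp.
have cPx := continuous_line (p := 0) sPx.
have Pxa : 0 < Px (a, 0).
  rewrite lt_neqAle eq_sym da leNgt; apply/negP => neg.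
  have [d d0 Hd] := near_line_gt0 (f := fun x => - Px (x, 0)) (x := a) (cvgN (cPx a)) ltac:(rewrite /=; lra).
  pose x := a + Num.min d ((b - a) / 2).
  have m1 : Num.min d ((b - a) / 2) <= d by rewrite ge_min lexx.
  have m2 : Num.min d ((b - a) / 2) <= (b - a) / 2 by rewrite ge_min lexx orbT.
  have m0 : 0 < Num.min d ((b - a) / 2) by rewrite lt_min d0 divr_gt0 // subr_gt0.
  have := @nondecreasing_of_derive _ (fun x => - P (x, 0)) (fun x => - Px (x, 0)) a x ltac:(rewrite /x; lra).
  have := Pab x ltac:(rewrite /x; lra).
  rewrite /P Pa => Px0 H; suff : - 0 <= - (m (x, 0)).2 by lra.
  apply: H => y yI.
  by apply: ltW; apply: Hd; rewrite ger0_norm; rewrite /x in yI; lra.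
have Pxb : 0 < - Px (b, 0).
  rewrite oppr_gt0 lt_neqAle db leNgt; apply/negP => pos.
  have [d d0 Hd] := near_line_gt0 (f := fun x => Px (x, 0)) (x := b) (cPx b) ltac:(rewrite /=; lra).
  pose x := b - Num.min d ((b - a) / 2).
  have m1 : Num.min d ((b - a) / 2) <= d by rewrite ge_min lexx.
  have m2 : Num.min d ((b - a) / 2) <= (b - a) / 2 by rewrite ge_min lexx orbT.
  have m0 : 0 < Num.min d ((b - a) / 2) by rewrite lt_min d0 divr_gt0 // subr_gt0.
  have := @nondecreasing_of_derive _ (fun x => P (x, 0)) (fun x => Px (x, 0)) x b ltac:(rewrite /x; lra).
  have := Pab x ltac:(rewrite /x; lra).
  rewrite /P Pb => Px0 H; suff : (m (x, 0)).2 <= 0 by lra.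
  apply: H => y yI.
  by apply: ltW; apply: Hd; rewrite ler0_norm; rewrite /x in yI; lra.
have [da' da0 Hda] := near_line_gt0 (cPx a) Pxa.
have [db' db0 Hdb] := near_line_gt0 (f := fun x => - Px (x, 0)) (cvgN (cPx b)) Pxb.
pose rho := Num.min (Num.min da' db') (Num.min 1 ((b - a) / 3)).
have rho0 : 0 < rho by rewrite !lt_min da0 db0 ltr01 divr_gt0 // subr_gt0.
have rho_a : rho <= da' by rewrite !ge_min lexx.
have rho_b : rho <= db' by rewrite !ge_min lexx !orbT.
have rho_1 : rho <= 1 by rewrite !ge_min lexx !orbT.
have rho_3 : rho <= (b - a) / 3 by rewrite !ge_min lexx !orbT.
move: rho rho0 rho_a rho_b rho_1 rho_3 => rho rho0 rho_a rho_b rho_1 rho_3.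
have Pxa0 x : a - rho <= x <= a + rho -> 0 < Px (x, 0).
  by move=> xI; apply: Hda; rewrite ler_norml; lra.
have Pxb0 x : b - rho <= x <= b + rho -> 0 < - Px (x, 0).
  by move=> xI; apply: Hdb; rewrite ler_norml; lra.
have Pl x : a - rho <= x < a -> P (x, 0) < 0.
  move=> xI; have xa : x < a by lra.
  have [c [c1 c2]] := mean_value xa (fun x _ => dP x 0).
  have := Pxa0 c ltac:(clear - c1 c2 xI rho0; lra); rewrite /P Pa; clear - xa; move: (Px _) (m _).2 => u v; nra.
have Pr x : b < x <= b + rho -> P (x, 0) < 0.
  move=> xI; have xb : b < x by lra.
  have [c [c1 c2]] := mean_value xb (fun x _ => dP x 0).
  have := Pxb0 c ltac:(clear - c1 c2 xI rho0; lra); rewrite /P Pb; clear - xb; move: (Px _) (m _).2 => u v; nra.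
have sPN : continuous (fun z => - P z) by apply: smT_continuous; exact: smT_opp.
have [t1 t10 H1] := @tube _ Px (a - rho) (a + rho) (smT_continuous sPx) Pxa0.
have [t2 t20 H2] := @tube _ (fun z => - Px z) (b - rho) (b + rho) PxN Pxb0.
have [t3 t30 H3] := @tube _ P (a + rho) (b - rho) (smT_continuous sP)
  ltac:(by move=> x xI; apply: Pab; clear - xI rho0; lra).
have [t4 t40 H4] := @tube _ (fun z => - P z) (a - rho / 2) (a - rho / 2) sPN
  ltac:(by move=> x xI; rewrite oppr_gt0; apply: Pl; clear - xI rho0; lra).
have [t5 t50 H5] := @tube _ (fun z => - P z) (b + rho / 2) (b + rho / 2) sPN
  ltac:(by move=> x xI; rewrite oppr_gt0; apply: Pr; clear - xI rho0; lra).
pose t0 := Num.min (Num.min (Num.min t1 t2) (Num.min t3 t4)) (Num.min t5 eps).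
have t00 : 0 < t0 by rewrite !lt_min t10 t20 t30 t40 t50.
have t0_le : [/\ t0 <= t1, t0 <= t2, t0 <= t3, t0 <= t4 & t0 <= t5].
  by split; rewrite !ge_min lexx ?orbT.
have t0e : t0 <= eps by rewrite !ge_min lexx !orbT.
move: t0 t00 t0_le t0e => t0 t00 [l1 l2 l3 l4 l5] t0e.
have incr x y s : `|s| <= t0 -> a - rho <= x -> x <= y -> y <= a + rho -> P (x, s) <= P (y, s).
  move=> st x1 xy y1; apply: (nondecreasing_of_derive (f := fun x => P (x, s)) xy (fun x _ => dP x s)).
  by move=> u uI; apply: ltW; apply: H1; [clear - x1 xy y1 uI; lra|exact: le_trans st l1].
have decr x y s : `|s| <= t0 -> b - rho <= x -> x <= y -> y <= b + rho -> P (y, s) <= P (x, s).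
  move=> st x1 xy y1; rewrite -lerN2.
  apply: (nondecreasing_of_derive (f := fun x => - P (x, s)) (f' := fun x => - Px (x, s)) xy).
  by move=> u uI; apply: ltW; apply: H2; [clear - x1 xy y1 uI; lra|exact: le_trans st l2].
have [k [k' [[sk sk'] dk k01 k1 k'J]]] := @smooth_plateau (a - rho) (a - rho / 2) (b + rho / 2) (b + rho)
   ltac:(clear - rho0; lra) ltac:(clear - rho0 ab; lra) ltac:(clear - rho0; lra).
have k'P x s : k' x != 0 -> `|s| <= t0 -> P (x, s) <= 0.
  move=> /k'J/orP[xI|xI] st.
    have := H4 (a - rho / 2) s ltac:(rewrite !lexx //) (le_trans st l4).
    rewrite oppr_gt0 => /ltW; apply: le_trans.
    by apply: incr => //; clear - xI rho0; lra.
  have := H5 (b + rho / 2) s ltac:(rewrite !lexx //) (le_trans st l5).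
  rewrite oppr_gt0 => /ltW; apply: le_trans.
  by apply: decr => //; clear - xI rho0; lra.
have Pc0 s : `|s| <= t0 -> 0 < P (c0, s).
  by move=> st; apply: H3; [clear - rho0 rho_3 ab; rewrite /c0; lra|exact: le_trans st l3].
have conn x y s : `|s| <= t0 -> a - rho <= x <= b + rho -> 0 < P (x, s) ->
    (x <= y <= c0) || (c0 <= y <= x) -> 0 < P (y, s).
  move=> st xI Px0 yI.
  have [y1|y1] := leP y (a + rho).
    have xy : x <= y by clear - yI y1 rho_3 ab; move: yI; rewrite /c0 => /orP[]; lra.
    by apply: lt_le_trans Px0 _; apply: incr => //; case/andP: xI.
  have [y2|y2] := leP (b - rho) y.
    have xy : y <= x by clear - yI y2 rho_3 ab; move: yI; rewrite /c0 => /orP[]; lra.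
    by apply: lt_le_trans Px0 _; apply: decr => //; case/andP: xI.
  by apply: H3; [rewrite !ltW|exact: le_trans st l3].
exists rho, t0; first by rewrite rho0 rho_1 t00 t0e.
exists k, k'; split => //.
  split => // [x|x xI]; first exact: (k01 x).2.
  by apply: k1; clear - xI rho0; lra.
move=> x /orP[xI|xI].
  have [->|xa] := eqVneq x a; first by rewrite Pa.
  by apply/ltW/Pl; rewrite lt_neqAle xa.
have [->|xb] := eqVneq x b; first by rewrite Pb.
by apply/ltW/Pr; rewrite lt_neqAle eq_sym xb.
Qed.

(** For every small width the slice estimate bounds an average of [Th] against the density [h'],
    which has mass one and is concentrated near [s = 0]. By continuity the same bound holds for
    [Th 0]. *)
Lemma arc_theta (r : R) (m n : R * R -> R * R) (a b rho t0 eps : R)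
    (k k' g g' : R -> R) (Kc : R * R -> R) (c0 := (a + b) / 2) :
  sympl r m n -> r < 1 ->
  (forall z, `|(m z).1 - z.1| <= 1) -> (forall z, `|(m z).2 - z.2| <= eps) ->
  0 < eps -> eps <= 1 / 4 -> a < b -> 0 < rho -> 0 < t0 -> t0 <= eps ->
  smT k /\ smT k' -> (forall x : R, is_derive x 1 k (k' x)) ->
  (forall x, k x != 0 -> a - rho <= x <= b + rho) -> k c0 = 1 ->
  (forall x s, k' x != 0 -> `|s| <= t0 -> (m (x, s)).2 <= 0) ->
  (forall s, `|s| <= t0 -> 0 < (m (c0, s)).2) ->
  (forall x y s, `|s| <= t0 -> a - rho <= x <= b + rho -> 0 < (m (x, s)).2 ->
     (x <= y <= c0) || (c0 <= y <= x) -> 0 < (m (y, s)).2) ->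
  smT g -> (forall x : R, is_derive x 1 g (g' x)) ->
  (forall p, 0 <= g' p) -> (forall p, p <= 0 -> g p = 0 /\ g' p = 0) ->
  (forall p, 0 <= p -> g p <= p) ->
  smT Kc -> (forall z, d1 Kc z = k z.1 * g (m z).2 * d1 (pr1 m) z) ->
  (forall s, Kc (a - rho - 3, s) = 0) ->
  `|Kc (b + rho + 3, 0)| <= (b - a + 2 * rho + 4) * (2 * eps).
Proof.
move=> Hm r1 disp thin e0 e14 ab rho0 t00 t0e [sk sk'] dk kJ kc0 k'P Pc0 conn
  sg dg g'0 gle gub sKc dKc Kc0.
pose Th s := Kc (b + rho + 3, s).
set C := (b - a + 2 * rho + 4) * (2 * eps).
have C0 : 0 <= C by clear - ab rho0 e0; rewrite /C mulr_ge0 //; lra.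
have cTh : {for 0, continuous Th} by exact: is_derive_continuous (is_derive_d2 _ 0 sKc).
have slice t : 0 < t -> t <= t0 -> exists h h' Y : R -> R,
    [/\ forall s : R, is_derive s 1 Y (h' s * Th s), `|Y 1 - Y (-1)| <= C,
     forall s : R, is_derive s 1 h (h' s), h 1 - h (-1) = 1 &
     forall s, 0 <= h' s /\ (h' s != 0 -> `|s| <= t)].
  move=> tt tt0.
  have [h [h' [[sh sh'] dh h01 hI hz]]] := @smooth_step_between _ (- t) t ltac:(clear - tt; lra).
  have h'e s : h' s != 0 -> `|s| <= t.
    by apply: contraR; rewrite -ltNge ltr_normr => /orP[st|st]; rewrite hz ?st ?orbT // ltrNr st.
  have [|||w [sw dw w_le w_q w_p]] := @barrier _ r m n a b rho t eps c0 k k' h h' Hm r1 disp thin e0 e14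
    tt (le_trans tt0 t0e) (conj sk sk') dk kJ _ kc0 (conj sh sh') dh (fun s => (h01 s).2) h'e _ _.
  - by move=> x s kx st; apply: k'P => //; exact: le_trans st tt0.
  - by move=> s st; apply: Pc0; exact: le_trans st tt0.
  - by move=> x y s st; apply: conn; exact: le_trans st tt0.
  have [Y [dY Yb]] := @arc_slice _ r m n a b rho eps w k h' g g' Kc Hm r1 disp e0 e14 ab rho0 sk sh' sg dg
    g'0 gle gub sw dw w_le w_q w_p sKc dKc Kc0.
  exists h, h', Y; split => //.
    by rewrite (hI _).2 ?(hI _).1 ?subr0 //; clear - tt0 t0e e14; lra.
  by move=> s; split; [exact: (h01 s).1|exact: h'e].
clearbody C.
rewrite -/(Th 0) leNgt; apply/negP => ThC.
(* A level strictly between the bound and the supposed larger value: near 0 all values of [|Th|]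
   exceed it, and so would their average. *)
pose la := (C + `|Th 0|) / 2.
have [sg1|sg1] := leP 0 (Th 0).
  rewrite (ger0_norm sg1) in ThC la *.
  have [d d0 Hd] := near_line_gt0 (f := fun s => Th s - la) (x := 0) (cvgB cTh (cvg_cst _)) ltac:(clear - ThC; rewrite /= /la; lra).
  have [h [h' [Y [dY Yb dh hh h'P]]]] := slice (Num.min t0 d) ltac:(by rewrite lt_min t00) ltac:(by rewrite ge_min lexx).
  have := @nondecreasing_of_derive _ (fun s => Y s - h s * la) (fun s => h' s * Th s - h' s * la) (-1) 1 ltac:(clear; lra).
  move=> H; have H1' : Y (-1) - h (-1) * la <= Y 1 - h 1 * la.
    apply: H => s sI.
      apply: is_derive_sub => //; have := is_derive_mul (dh s) (is_derive_cst la s 1).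
      by apply: is_deriveE; rewrite /cst /=; ring.
    rewrite -mulrBr; have [h'0 h'e] := h'P s.
    have [->|h's] := eqVneq (h' s) 0; first by rewrite mul0r.
    apply: mulr_ge0 => //; apply: ltW; apply: Hd; rewrite subr0.
    by apply: le_trans (h'e h's) _; rewrite ge_min lexx orbT.
  by clear - H1' Yb hh ThC C0; move: H1' Yb hh; rewrite ler_norml /la; move: (Y 1) (Y (-1)) (h 1) (h (-1)) => y1 y2 h1 h2; nra.
rewrite (ltr0_norm sg1) in ThC la *.
have [d d0 Hd] := near_line_gt0 (f := fun s => - la - Th s) (x := 0) (cvgB (cvg_cst _) cTh) ltac:(clear - ThC; rewrite /= /la; lra).
have [h [h' [Y [dY Yb dh hh h'P]]]] := slice (Num.min t0 d) ltac:(by rewrite lt_min t00) ltac:(by rewrite ge_min lexx).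
have := @nondecreasing_of_derive _ (fun s => h s * (- la) - Y s) (fun s => h' s * (- la) - h' s * Th s) (-1) 1 ltac:(clear; lra).
move=> H; have H1' : h (-1) * (- la) - Y (-1) <= h 1 * (- la) - Y 1.
  apply: H => s sI.
    apply: is_derive_sub => //; have := is_derive_mul (dh s) (is_derive_cst (- la) s 1).
    by apply: is_deriveE; rewrite /cst /=; ring.
  rewrite -mulrBr; have [h'0 h'e] := h'P s.
  have [->|h's] := eqVneq (h' s) 0; first by rewrite mul0r.
  apply: mulr_ge0 => //; apply: ltW; apply: Hd; rewrite subr0.
  by apply: le_trans (h'e h's) _; rewrite ge_min lexx orbT.
by clear - H1' Yb hh ThC C0; move: H1' Yb hh; rewrite ler_norml /la; move: (Y 1) (Y (-1)) (h 1) (h (-1)) => y1 y2 h1 h2; nra.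
Qed.

(** [S] is the action, a primitive of [p dq] along the curve. The form is replaced by [g(p) dq] with
    [g] smooth and zero below the axis, so that the continuation of the arc past its end points
    contributes nothing; then [g] tends to the identity on [p >= 0]. *)
Lemma arc_action (r : R) (m n : R * R -> R * R) (a b eps : R) (S : R -> R) :
  sympl r m n -> r < 1 ->
  (forall z, `|(m z).1 - z.1| <= 1) -> (forall z, `|(m z).2 - z.2| <= eps) ->
  0 < eps -> eps <= 1 / 4 -> a < b -> b <= a + 1 ->
  (m (a, 0)).2 = 0 -> (m (b, 0)).2 = 0 ->
  (forall x, a < x < b -> 0 < (m (x, 0)).2) ->
  d1 (pr2 m) (a, 0) != 0 -> d1 (pr2 m) (b, 0) != 0 ->
  (forall x : R, is_derive x 1 S ((m (x, 0)).2 * d1 (pr1 m) (x, 0))) ->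
  `|S b - S a| <= 14 * eps.
Proof.
move=> Hm r1 disp thin e0 e14 ab ba1 Pa Pb Pab da db dS.
have [sm sn nm mn J _ mid] := Hm.
have sP := smT_snd sm; have sQ := smT_fst sm.
have sQx := sm_d1 sQ.
have [rho [t0 [/andP[rho0 rho1] /andP[t00 t0e]] [k [k' [[[sk sk'] dk kJ k1] k'P Pc0 conn Ple]]]]] :=
  arc_tube sm e0 ab Pa Pb Pab da db.
have kc0 : k ((a + b) / 2) = 1 by apply: k1; clear - ab; lra.
have [Cq Cq0 HCq] : exists2 C, 0 <= C & forall x, a <= x <= b -> `|d1 (pr1 m) (x, 0)| <= C.
  have cn : {within `[a, b], continuous (fun x => `|d1 (pr1 m) (x, 0)|)}.
    by apply: continuous_subspaceT => x; apply: cvg_norm; exact: continuous_line.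
  have [x0 _ H] := EVT_max (ltW ab) cn.
  by exists (`|d1 (pr1 m) (x0, 0)|) => // x xI; apply: H; rewrite in_itv.
apply/ler_addgt0Pr => e ee0.
(* Replacing [p] by [g(p)] changes the integrand by at most this error times [Cq], hence the action
   by at most [e] on an interval of length at most one. *)
have tau0 : 0 < e / (Cq + 1) by rewrite divr_gt0 //; clear - Cq0; lra.
have [g [g' [sg dg [g'0 gle] gub gtau]]] := smooth_cut tau0.
have sgP : smT (fun z => g ((m z).2)) by exact: smT_comp sP sg.
have skx : smT (fun z : R * R => k z.1) by exact: sm_fun_fst.
have skg : smT (fun z => k z.1 * g ((m z).2)) by exact: smT_mul.
have sker : smT (fun z => k z.1 * g ((m z).2) * d1 (pr1 m) z) by exact: smT_mul.
have [Kc [sKc dKc Kc0]] := primitive1 (a - rho - 3) sker.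
have ThC := arc_theta Hm r1 disp thin e0 e14 ab rho0 t00 t0e (conj sk sk') dk kJ kc0 k'P Pc0 conn
  sg dg g'0 gle gub sKc dKc Kc0.
have Kca : Kc (a, 0) = 0.
  apply: etrans _ (Kc0 0); apply: (@constant_of_derive0_itv _ (fun x => Kc (x, 0))).
    by clear - rho0; lra.
  move=> x xI; have := is_derive_d1 x 0 sKc; apply: is_deriveE; rewrite dKc /=.
  have [->|/kJ xJ] := eqVneq (k x) 0; first by rewrite !mul0r.
  rewrite (gle _ _).1 ?mulr0 ?mul0r //; apply: Ple.
  by clear - xI xJ; apply/orP; left; lra.
have Kcb : Kc (b, 0) = Kc (b + rho + 3, 0).
  apply/esym; apply: (@constant_of_derive0_itv _ (fun x => Kc (x, 0))).
    by clear - rho0; lra.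
  move=> x xI; have := is_derive_d1 x 0 sKc; apply: is_deriveE; rewrite dKc /=.
  have [->|/kJ xJ] := eqVneq (k x) 0; first by rewrite !mul0r.
  rewrite (gle _ _).1 ?mulr0 ?mul0r //; apply: Ple.
  by clear - xI xJ; apply/orP; right; lra.
have HK : `|Kc (b, 0) - S b - (Kc (a, 0) - S a)| <= e * (b - a).
  apply: (lipschitz_of_derive (f := fun x => Kc (x, 0) - S x)
    (f' := fun x => k x * g (m (x, 0)).2 * d1 (pr1 m) (x, 0) - (m (x, 0)).2 * d1 (pr1 m) (x, 0))
    (ltW ab)) => x xI.
    by have dK := is_derive_d1 x 0 sKc; rewrite dKc in dK; exact: is_derive_sub dK (dS x).
  rewrite k1 // mul1r -mulrBl normrM.
  have P0 : 0 <= (m (x, 0)).2.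
    have [->|xa] := eqVneq x a; first by rewrite Pa.
    have [->|xb] := eqVneq x b; first by rewrite Pb.
    by apply: ltW; apply: Pab; rewrite !lt_neqAle eq_sym xa xb.
  have := gtau _ P0; rewrite ler_pdivlMr; last by clear - Cq0; lra.
  have := HCq x xI; have := normr_ge0 (g (m (x, 0)).2 - (m (x, 0)).2).
  have := normr_ge0 (d1 (pr1 m) (x, 0)).
  clear - Cq0 ee0.
  by move: (`|g _ - _|) (`|d1 _ _|) => u v; nra.
rewrite Kca Kcb in HK.
have e1 : e * (b - a) <= e by clear - ba1 ee0; nra.
(* The origin of the constant: [b - a <= 1] and [rho <= 1] give [(1 + 2 + 4) * 2 = 14]. *)
have e2 : (b - a + 2 * rho + 4) * (2 * eps) <= 14 * eps by clear - ba1 rho1 e0 ab; nra.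
clear - HK ThC e1 e2; move: HK ThC; rewrite !ler_norml.
move: (Kc _) (S a) (S b) => u v w; lra.
Qed.

End arc_action.

(** * The action at the intersection points *)

Section action_bound.
Context {R : realType}.
Implicit Types (z : R * R).

(** Conjugation by the half-turn, which preserves both the area and the form [p dq] and exchanges
    the two sides of the axis. Arcs below the axis are thus reduced to arcs above. *)
Definition rot (m : R * R -> R * R) z : R * R := - m (- z).

Lemma smT_oppid : smT (fun z : R * R => - z).
Proof. by apply: smT_opp; exact: sm_id. Qed.

Lemma d1_rot (f : R * R -> R) z : smT f -> d1 (fun z => - f (- z)) z = d1 f (- z).
Proof.
move=> sf; apply: d1_eq; first by apply: smT_opp; exact: smT_comp smT_oppid sf.
have dN : is_derive z.1 1 (fun s : R => (- s, - z.2)) (- 1, 0).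
  by apply: is_derive_pair; exact: is_deriveNid.
have := is_derive_planar sf dN; rewrite /= mul0r addr0 mulN1r => H.
by have := is_deriveN H; rewrite opprK; apply: is_deriveE; case: z {dN H}.
Qed.

Lemma d2_rot (f : R * R -> R) z : smT f -> d2 (fun z => - f (- z)) z = d2 f (- z).
Proof.
move=> sf; apply: d2_eq; first by apply: smT_opp; exact: smT_comp smT_oppid sf.
have dN : is_derive z.2 1 (fun s : R => (- z.1, - s)) (0, - 1).
  by apply: is_derive_pair; exact: is_deriveNid.
have := is_derive_planar sf dN; rewrite /= mul0r add0r mulN1r => H.
by have := is_deriveN H; rewrite opprK; apply: is_deriveE; case: z {dN H}.
Qed.

Lemma sympl_rot (r : R) (m n : R * R -> R * R) : sympl r m n -> sympl r (rot m) (rot n).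
Proof.
move=> [sm sn nm mn J sh mid].
have srot f : smT f -> smT (rot f).
  by move=> sf; apply: smT_opp; exact: smT_comp smT_oppid sf.
split; [exact: srot|exact: srot| | | | |].
- by move=> a; rewrite /rot opprK nm opprK.
- by move=> a; rewrite /rot opprK mn opprK.
- move=> a; rewrite -(J (- a)) /jac.
  have s1 := smT_fst sm; have s2 := smT_snd sm.
  by rewrite (d1_rot a s1) (d1_rot a s2) (d2_rot a s1) (d2_rot a s2).
- move=> q p; rewrite /rot -[- (q, p)]/(- q, - p) -[- (q + 1, p)]/(- (q + 1), - p).
  have -> : - q = - (q + 1) + 1 by ring.
  rewrite sh; case: (m _) => u v; rewrite -[- (u, v)]/(- u, - v) /=.
  by congr (_, _); ring.
- by move=> a ar; rewrite /rot mid ?opprK //= normrN.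
Qed.

Definition frac (x : R) : R := x - (Num.floor x)%:~R.

Lemma frac_itv x : 0 <= frac x < 1.
Proof.
rewrite /frac; have /andP[] := floor_itv x; rewrite intrD => h1 h2.
by apply/andP; split; lra.
Qed.

Lemma frac_inj (x y : R) : `|x - y| < 1 -> frac x = frac y -> x = y.
Proof.
rewrite /frac => xy E.
have E' : x - y = (Num.floor x - Num.floor y)%:~R by rewrite intrB; lra.
rewrite E' in xy.
have : `|Num.floor x - Num.floor y| < 1 by rewrite -(@ltr_int R) intr_norm.
have [] := eqVneq (Num.floor x - Num.floor y) 0.
  by move=> E0 _; apply/eqP; rewrite -subr_eq0 E' E0.
by rewrite -normr_gt0 gtz0_ge1 leNgt => h1 h2; rewrite h2 in h1.
Qed.

(** Translation by an integer brings the two points to distance less than one, and the interval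
    between them is cut at the other zeros into single arcs. *)
Lemma action_bound (r : R) (m n : R * R -> R * R) (eps : R) (S : R -> R) (N : nat) :
  sympl r m n -> r < 1 ->
  (forall z, `|(m z).1 - z.1| <= 1) -> (forall z, `|(m z).2 - z.2| <= eps) ->
  0 < eps -> eps <= 1 / 4 ->
  (forall x, (m (x, 0)).2 = 0 -> d1 (pr2 m) (x, 0) != 0) ->
  (forall s : seq R, uniq s ->
    (forall x, x \in s -> 0 <= x < 1 /\ (m (x, 0)).2 = 0) -> (size s <= N)%N) ->
  (forall x : R, is_derive x 1 S ((m (x, 0)).2 * d1 (pr1 m) (x, 0))) ->
  (forall x, S (x + 1) = S x) ->
  forall x y, (m (x, 0)).2 = 0 -> (m (y, 0)).2 = 0 ->
    `|S x - S y| <= 14 * eps * 2 ^+ N.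
Proof.
move=> Hm r1 disp thin e0 e14 tr cnt dS pS.
have [sm sn nm mn J sh mid] := Hm.
have sP := smT_snd sm; have sQ := smT_fst sm.
have arc a b : a < b -> b <= a + 1 -> (m (a, 0)).2 = 0 -> (m (b, 0)).2 = 0 ->
    (forall x, a < x < b -> (m (x, 0)).2 != 0) -> `|S b - S a| <= 14 * eps.
  move=> ab ba1 Pa Pb P0.
  have cP : continuous (fun x => (m (x, 0)).2) := continuous_line (p := 0) sP.
  pose c := (a + b) / 2.
  have cI : a < c < b by rewrite /c; lra.
  have sgn x : a < x < b -> 0 < (m (c, 0)).2 * (m (x, 0)).2.
    move=> xI; rewrite lt_neqAle eq_sym mulf_neq0 ?P0 //= leNgt; apply/negP => neg.
    have key u v : u <= v -> a < u -> v < b -> (m (u, 0)).2 * (m (v, 0)).2 < 0 -> False.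
      move=> uv au vb uvneg.
      have cn : {within `[u, v], continuous (fun x => (m (x, 0)).2)} by exact: continuous_subspaceT.
      have [] := @IVT _ _ u v 0 uv cn.
        clear - uvneg; move: (m (u, 0)).2 (m (v, 0)).2 uvneg => x1 x2 H.
        rewrite ge_min le_max; have [x10|x10] := lerP x1 0 => /=.
          by apply/orP; right; nra.
        by rewrite (ltW x10) andbT; nra.
      move=> w; rewrite in_itv /= => wI w0.
      by have := P0 w ltac:(clear - au vb wI; lra); rewrite w0 eqxx.
    have [xc|/ltW cx] := leP x c.
      by apply: (key x c) => //; [clear - xI; lra|clear - cI; lra|rewrite mulrC].
    by apply: (key c x) => //; [clear - cI; lra|clear - xI; lra].
  have := P0 c cI; rewrite neq_lt => /orP[neg|pos]; last first.
    apply: (arc_action Hm r1 disp thin e0 e14 ab ba1 Pa Pb _ (tr _ Pa) (tr _ Pb) dS).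
    by move=> x /sgn; rewrite pmulr_rgt0.
  have dSN (x : R) : is_derive x 1 (fun x => S (- x))
      ((rot m (x, 0)).2 * d1 (pr1 (rot m)) (x, 0)).
    have := is_derive_1comp (dS (- x)) (is_deriveNid x 1).
    apply: is_deriveE; rewrite (d1_rot _ sQ) /rot.
    have -> : - (x, 0) = (- x, 0) :> R * R by congr (_, _); rewrite oppr0.
    by rewrite /GRing.scale /= mulN1r mulNr.
  have rotE x : rot m (- x, 0) = - m (x, 0).
    by rewrite /rot; congr (- m _); congr (_, _); rewrite ?opprK ?oppr0.
  have := @arc_action _ r (rot m) (rot n) (- b) (- a) eps (fun x => S (- x)) (sympl_rot Hm) r1.
  rewrite !opprK distrC; apply => //.
  - move=> z; have /= := disp (- z); rewrite /rot /= -normrN; congr (_ <= _); congr (`|_|); ring.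
  - move=> z; have /= := thin (- z); rewrite /rot /= -normrN; congr (_ <= _); congr (`|_|); ring.
  - by rewrite ltrN2.
  - by clear - ba1; lra.
  - by rewrite rotE /= Pb oppr0.
  - by rewrite rotE /= Pa oppr0.
  - move=> x xI; rewrite -[x]opprK rotE /= oppr_gt0.
    have := sgn (- x) ltac:(clear - xI; lra); clear - neg; move: (m (c, 0)).2 (m (- x, 0)).2 neg => u v; nra.
  - rewrite (d1_rot _ sP); have -> : - (- b, 0) = (b, 0) :> R * R by congr (_, _); rewrite ?opprK ?oppr0.
    exact: tr.
  - rewrite (d1_rot _ sP); have -> : - (- a, 0) = (a, 0) :> R * R by congr (_, _); rewrite ?opprK ?oppr0.
    exact: tr.
(* Cutting at an inner zero [c] leaves fewer inner zeros in either half, since [c] itself is lost;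
   each cut at most doubles the bound, whence the power of 2. *)
have many (k : nat) : forall a b, a < b -> b <= a + 1 -> (m (a, 0)).2 = 0 -> (m (b, 0)).2 = 0 ->
    (forall s : seq R, uniq s -> (forall x, x \in s -> a < x < b /\ (m (x, 0)).2 = 0) -> (size s <= k)%N) ->
    `|S b - S a| <= 14 * eps * 2 ^+ k.
  elim: k => [|k IH] a b ab ba1 Pa Pb ck.
    rewrite expr0 mulr1; apply: arc => // x xI; apply/eqP => x0.
    have := ck [:: x] isT; rewrite /= => H; suff : (1 <= 0)%N by [].
    by apply: H => y; rewrite inE => /eqP ->.
  have [[c [cI c0]]|nc] := pselect (exists c, a < c < b /\ (m (c, 0)).2 = 0); last first.
    apply: le_trans (arc a b ab ba1 Pa Pb _) _.
      by move=> x xI; apply/eqP => x0; apply: nc; exists x.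
    rewrite ler_peMr // ?exprn_ege1 //; first by clear - e0; lra.
    by clear; lra.
  have /andP[ac cb] := cI.
  have Hl : `|S c - S a| <= 14 * eps * 2 ^+ k.
    apply: IH => //; first by clear - ba1 cb; lra.
    move=> s us Hs; rewrite -ltnS; apply: (ck (c :: s)).
      by rewrite /= us andbT; apply/negP => /Hs[]; rewrite ltxx andbF.
    move=> x; rewrite inE => /orP[/eqP -> //|/Hs[xI x0]]; split => //.
    by clear - xI cb; lra.
  have Hr : `|S b - S c| <= 14 * eps * 2 ^+ k.
    apply: IH => //; first by clear - ba1 ac; lra.
    move=> s us Hs; rewrite -ltnS; apply: (ck (c :: s)).
      by rewrite /= us andbT; apply/negP => /Hs[]; rewrite ltxx.
    move=> x; rewrite inE => /orP[/eqP -> //|/Hs[xI x0]]; split => //.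
    by clear - xI ac; lra.
  rewrite exprS; clear - Hl Hr; move: Hl Hr; rewrite !ler_norml.
  by move: (14 * eps) (2 ^+ k) (S a) (S b) (S c) => u v x y w; lra.
have P1 x : (m (x + 1, 0)).2 = (m (x, 0)).2 by rewrite sh.
have Pint : forall (k : int) x, (m (x + k%:~R, 0)).2 = (m (x, 0)).2.
  by move=> k x; apply: (periodic_int (f := fun z => (m z).2)) => q p; rewrite sh.
have Sint : forall (k : int) x, S (x + k%:~R) = S x.
  by move=> k x; apply: (periodic_int (f := fun z => S z.1) _ k x 0) => q p; exact: pS.
have near x y : x < y -> y < x + 1 -> (m (x, 0)).2 = 0 -> (m (y, 0)).2 = 0 ->
    `|S y - S x| <= 14 * eps * 2 ^+ N.
  move=> xy yx x0 y0; apply: many => //; first exact: ltW.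
  (* An interval shorter than one embeds in the circle, so its zeros can be counted by fractional
     parts. *)
  move=> s us Hs; rewrite -(size_map frac); apply: cnt.
    rewrite map_inj_in_uniq // => u v /Hs[uI _] /Hs[vI _]; apply: frac_inj.
    by rewrite ltr_norml; clear - uI vI yx; lra.
  move=> u /mapP[v /Hs[vI v0] ->]; split; first exact: frac_itv.
  by rewrite /frac -mulrNz Pint.
move=> x y x0 y0; rewrite distrC.
(* The translate of [y] in [[x, x + 1)], with the same action. *)
pose y' := x + frac (y - x).
have y'E : y' = y + (- Num.floor (y - x))%:~R by rewrite /y' /frac mulrNz; ring.
have y'0 : (m (y', 0)).2 = 0 by rewrite y'E Pint.
have -> : S y = S y' by rewrite y'E Sint.
have := frac_itv (y - x); rewrite -/y' => fI.
have [E|ne] := eqVneq y' x.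
  by rewrite E subrr normr0 !mulr_ge0 ?exprn_ge0 // ltW.
apply: near => //; last by rewrite /y'; clear - fI; lra.
by rewrite lt_neqAle eq_sym ne /y'; clear - fI; lra.
Qed.

End action_bound.

(** * Liouville flows *)

Definition ham (R : realType) (h : R * R -> R) (a : R * R) : R * R := (d2 h a, - d1 h a).

Section conformal.
Context {R : realType}.
Implicit Types (a : R * R).

Lemma Cn_local k (V W : normedModType R) (U : set V) (f : V -> W) :
  (forall x, U x -> exists U', [/\ open U', U' x & Cn k U' f]) -> Cn k U f.
Proof.
elim: k V W U f => [|k IH] V W U f H.
  by move=> x Ux; have [U' [oU' U'x cf]] := H x Ux; exact: cf.
split=> [x Ux|]; first by have [U' [oU' U'x [df _]]] := H x Ux; exact: df.
apply: IH => -[x h] [/= Ux _]; have [U' [oU' U'x [_ Cdf]]] := H x Ux.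
by exists (U' `*` setT); split => //; exact: open_setXT.
Qed.

Lemma loc_slice (V W : normedModType R) (v : R -> V -> W) (t : R) :
  loc v -> 0 <= t <= 1 -> smT (v t).
Proof.
move=> lv tI k; apply: Cn_local => x _.
have [U [g [oU Ux sg vg]]] := lv t x tI.
pose U' : set V := [set y | U (t, y)].
have oU' : open U' by apply: open_comp => // z _; exact: pair_continuous.
exists U'; split => //.
have H : Cn k U' (fun y => g (t, y)).
  apply: (Cn_comp oU' oU (g := fun y => (t, y)) (f := g)) => //.
  by apply: Cn_pair => //; [exact: Cn_cst|exact: Cn_id].
by apply: Cn_eq oU' _ H => y Uy; rewrite vg.
Qed.

Lemma ham_linear (a1 a2 : R) (f1 f2 : R * R -> R) a : smT f1 -> smT f2 ->
  ham (fun z => a1 * f1 z + a2 * f2 z) a = a1 *: ham f1 a + a2 *: ham f2 a.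
Proof.
move=> s1 s2.
have c1 : smT (fun z => a1 * f1 z) by apply: smT_mul => //; exact: sm_cst.
have c2 : smT (fun z => a2 * f2 z) by apply: smT_mul => //; exact: sm_cst.
have dc1 b (f : R * R -> R) z : smT f -> d1 (fun z => b * f z) z = b * d1 f z.
  move=> sf; apply: d1_eq; first by apply: smT_mul => //; exact: sm_cst.
  have := is_derive_mul (is_derive_cst b z.1 1) (is_derive_d1 z.1 z.2 sf).
  by rewrite -surjective_pairing; apply: is_deriveE; rewrite /cst /=; ring.
have dc2 b (f : R * R -> R) z : smT f -> d2 (fun z => b * f z) z = b * d2 f z.
  move=> sf; apply: d2_eq; first by apply: smT_mul => //; exact: sm_cst.
  have := is_derive_mul (is_derive_cst b z.2 1) (is_derive_d2 z.1 z.2 sf).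
  by rewrite -surjective_pairing; apply: is_deriveE; rewrite /cst /=; ring.
rewrite /ham (d1_add a c1 c2) (d2_add a c1 c2) !dc1 // !dc2 //.
by apply: injective_projections; rewrite /= /GRing.scale /=; ring.
Qed.

(** A map that multiplies area by [jac A] carries a Hamiltonian field to that multiple of the
    Hamiltonian field of the transported function. For the Liouville flows the factor is
    [expR (- s)], the source of the damping. *)
Lemma ham_push (A B : R * R -> R * R) (h : R * R -> R) a : smT A -> smT B ->
  smT h -> (forall b, B (A b) = b) ->
  'd A a (ham h a) = jac A a *: ham (fun b => h (B b)) (A a).
Proof.
move=> sA sB sh BA; set g := fun b => h (B b).
have sg : smT g by exact: smT_comp sB sh.
have hE : h = fun b => g (A b) by apply/funext => b; rewrite /g BA.
rewrite (diff_planarE _ _ sA) /ham /jac /=.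
have -> : d1 h a = d1 (fun b => g (A b)) a by congr (d1 _ a).
have -> : d2 h a = d2 (fun b => g (A b)) a by congr (d2 _ a).
rewrite (d1_comp _ sg sA) (d2_comp _ sg sA).
move: (d1 (pr1 A) a) (d2 (pr2 A) a) (d1 (pr2 A) a) (d2 (pr1 A) a) (d1 g _) (d2 g _) => x y z w u v.
by apply: injective_projections; rewrite /= /GRing.scale /=; ring.
Qed.

Lemma autonomous_unique (V : normedModType R) (Z : V -> V) (s : R) (c c' : R -> V) :
  smT Z -> (forall t : R, 0 <= t <= 1 -> is_derive t 1 c (s *: Z (c t))) ->
  (forall t : R, 0 <= t <= 1 -> is_derive t 1 c' (s *: Z (c' t))) ->
  c 0 = c' 0 -> c 1 = c' 1.
Proof.
move=> sZ dc dc' c0; apply: (@ode_unique _ _ (fun _ y => s *: Z y)) => //; last first.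
  by rewrite lexx ler01.
apply: (@loc_sm _ _ _ (fun z => s *: Z z.2)).
apply: sm_scale; [exact: openTT|exact: sm_cst|].
by apply: (@smT_comp _ _ _ _ snd Z) => //; exact: sm_snd.
Qed.

Lemma d12_shift (f : R * R -> R) (c : R) q p : smT f ->
  (forall q p, f (q + 1, p) = f (q, p) + c) ->
  d1 f (q + 1, p) = d1 f (q, p) /\ d2 f (q + 1, p) = d2 f (q, p).
Proof.
move=> sf fc; split; [apply: (d1_eq sf) => /=|apply: (d2_eq sf) => /=].
  have E : (fun s => f (s, p)) = (fun s => f (s - 1, p) + c).
    by apply/funext => s; rewrite -fc subrK.
  rewrite E; have D : is_derive (q + 1) 1 (fun s : R => s - 1) 1.
    have := is_derive_sub (is_derive_id (q + 1) 1) (is_derive_cst (1 : R) (q + 1) 1).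
    by apply: is_deriveE; rewrite subr0.
  have F : is_derive (q + 1 - 1) 1 (fun s => f (s, p)) (d1 f (q, p)).
    by rewrite addrK; exact: is_derive_d1.
  have := is_derive_add (is_derive_1comp (f := fun s => f (s, p)) (g := fun s : R => s - 1) F D) (is_derive_cst c (q + 1) 1).
  by apply: is_deriveE; rewrite addr0 scale1r.
have -> : (fun s => f (q + 1, s)) = (fun s => f (q, s) + c) by apply/funext => s; rewrite fc.
have := is_derive_add (is_derive_d2 q p sf) (is_derive_cst c p 1).
by apply: is_deriveE; rewrite addr0.
Qed.

(* The field dual to the primitive [p dq - dF] of the area form; its flow
   contracts areas by [expR (- s)] and preserves every curve on which the
   primitive vanishes. *)
Definition liouville (F : R * R -> R) a : R * R := (- d2 F a, - a.2 + d1 F a).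

Definition shift1 a : R * R := (a.1 + 1, a.2).

(** The field is [(0, - p)] plus a periodic field of bounded vertical support, hence globally
    Lipschitz. The mixed derivatives of [F] cancel in its divergence, which is -1. Outside the
    support only [(0, - p)] remains, and its backward flow moves points outwards, never back into
    the support. *)
Lemma liouville_flow (F : R * R -> R) (r : R) : smT F -> periodic F ->
  (forall a, r < `|a.2| -> d1 F a = 0 /\ d2 F a = 0) ->
  exists psi : R * (R * R) -> R * R, [/\ smT psi /\ (forall x, psi (0, x) = x),
    forall (t : R) (sg : R -> R) y dsg dy, is_derive t 1 sg dsg -> is_derive t 1 y dy ->
      is_derive t 1 (fun t => psi (sg t, y t))
        (dsg *: liouville F (psi (sg t, y t)) + 'd (fun z => psi (sg t, z)) (y t) dy),
    forall s x, 'd (fun y => psi (s, y)) x (liouville F x) = liouville F (psi (s, x)) /\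
      psi (- s, psi (s, x)) = x /\ jac (fun y => psi (s, y)) x = expR (- s),
    forall s x, (liouville F x = 0 -> psi (s, x) = x) /\ psi (s, shift1 x) = shift1 (psi (s, x)) &
    forall s x, 0 <= s -> r < `|x.2| -> psi (- s, x) = (x.1, x.2 * expR s)].
Proof.
move=> sF pF F0.
have sZ : smT (liouville F).
  apply: smT_pair; first by apply: smT_opp; exact: sm_d2.
  by apply: smT_add; [apply: smT_opp; exact: sm_snd|exact: sm_d1].
have pd z : d1 F (shift1 z) = d1 F z /\ d2 F (shift1 z) = d2 F z.
  by case: z => q p; apply: (d12_shift (c := 0)) => // q' p'; rewrite addr0 pF.
have ZS z : liouville F (shift1 z) = liouville F z.
  by rewrite /liouville (pd z).1 (pd z).2.
pose v (t : R) z : R * R := (- d2 F z, d1 F z).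
have lv : loc v.
  apply: (@loc_sm _ _ _ (fun z => (- d2 F z.2, d1 F z.2))).
  apply: (@smT_comp _ _ _ _ snd (fun z => (- d2 F z, d1 F z))); first exact: sm_snd.
  by apply: smT_pair; [apply: smT_opp; exact: sm_d2|exact: sm_d1].
have [C C0 HC] := @periodic_lipschitz _ v r lv
  ltac:(by move=> t _ q p; rewrite /v -(pd (q, p)).1 -(pd (q, p)).2)
  ltac:(by move=> t a _ /F0[E1 E2]; rewrite /v E1 E2 oppr0).
have ZL x y : `|liouville F x - liouville F y| <= (C + 1) * `|x - y|.
  have E z : liouville F z = v 0 z - (0, z.2).
    by rewrite -[v 0 z - _]/(- d2 F z - 0, d1 F z - z.2) subr0 /liouville addrC.
  have -> : liouville F x - liouville F y = (v 0 x - v 0 y) - ((0, x.2) - (0, y.2)).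
    by rewrite !E !opprD !opprK addrACA.
  apply: le_trans (ler_normB _ _) _; rewrite mulrDl mul1r; apply: lerD.
    by apply: HC; rewrite lexx ler01.
  rewrite -[(0, x.2) - (0, y.2)]/(0 - 0, x.2 - y.2) subrr norm_pair_le normr0 normr_ge0 /=.
  by rewrite [leRHS]prod_normE le_max lexx orbT.
have C1 : 0 <= C + 1 by apply: addr_ge0.
have [psi [spsi psi0 dpsi Zpsi]] := autonomous_flow good_plane sZ C1 ZL.
have dtime (s t : R) x : is_derive t 1 (fun t => psi (s * t, x)) (s *: liouville F (psi (s * t, x))).
  have dl : is_derive t 1 (fun t => s * t) s.
    have := is_derive_mul (is_derive_cst s t 1) (is_derive_id t 1).
    by apply: is_deriveE; rewrite /cst /=; ring.
  exact: (is_derive_1comp (f := fun s => psi (s, x)) (dpsi _ _) dl).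
have inv s x : psi (- s, psi (s, x)) = x.
  have := @autonomous_unique _ (liouville F) (- s) (fun t => psi (- s * t, psi (s, x)))
    (fun t => psi (s - s * t, x)) sZ (fun t _ => dtime _ _ _).
  rewrite !mulr0 !mulr1 subrr subr0 !psi0; apply => // t _.
  have dl : is_derive t 1 (fun t => s - s * t) (- s).
    have := is_derive_sub (is_derive_cst s t 1) (is_derive_mul (is_derive_cst s t 1) (is_derive_id t 1)).
    by apply: is_deriveE; rewrite /cst /=; ring.
  exact: (is_derive_1comp (f := fun s => psi (s, x)) (dpsi _ _) dl).
exists psi; split => //.
- move=> t sg y dsg dy Dsg Dy.
  have dP : differentiable psi (sg t, y t) by exact: smT_differentiable.
  have := is_derive_comp dP (is_derive_pair Dsg Dy); apply: is_deriveE.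
  have -> : (dsg, dy) = dsg *: (1, 0) + (0, dy).
    by congr (_, _); rewrite /= ?scaler0 ?add0r // /GRing.scale /= mulr1 addr0.
  rewrite linearD linearZ; congr (_ *: _ + _).
    have := is_derive_comp dP (is_derive_pair (is_derive_id (sg t) 1) (is_derive_cst (y t) (sg t) 1)).
    by move=> H; exact: is_derive_unique H (dpsi _ _).
  by have [_ ->] := diff_slice dP.
- move=> s x; split; first exact: Zpsi.
  split; first exact: inv.
  have lZ : loc (fun _ : R => fun y => s *: liouville F y).
    apply: (@loc_sm _ _ _ (fun z => s *: liouville F z.2)).
    apply: sm_scale; [exact: openTT|exact: sm_cst|].
    by apply: (@smT_comp _ _ _ _ snd (liouville F)) => //; exact: sm_snd.
  have := @jac_flow _ _ (fun y t => psi (s * t, y)) (- s) lZ _ _ x.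
  rewrite mulr1; apply.
    by move=> y; rewrite mulr0 psi0; split => // t _; exact: dtime.
  move=> t y _; have dZ := smT_differentiable y sZ.
  have dsc h : 'd (fun y => s *: liouville F y) y h = s *: 'd (liouville F) y h.
    apply: etrans (diff_scaleE (f := fun=> s) h _ dZ) _; first exact: differentiable_cst.
    by rewrite diff_cst scale0r addr0.
  have key h := etrans (dsc h) (congr1 (GRing.scale s) (diff_planarE y h sZ)).
  apply: etrans (congr2 (fun u w : R * R => u.1 + w.2) (key (1, 0)) (key (0, 1))) _ => /=.
  have -> : d1 (pr1 (liouville F)) y = - d1 (d2 F) y by rewrite -(d1_opp y (sm_d2 sF)).
  have sN : smT (fun z : R * R => - z.2) by apply: smT_opp; exact: sm_snd.
  have -> : d2 (pr2 (liouville F)) y = - 1 + d2 (d1 F) y.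
    by rewrite (d2_add y sN (sm_d1 sF)) (d2_opp y (@sm_snd _ _ _ _)) d2_snd.
  by rewrite (schwarz _ sF) /GRing.scale /=; ring.
- move=> s x; split=> [Z0|].
    have := @autonomous_unique _ (liouville F) s (fun t => psi (s * t, x)) (fun=> x) sZ (fun t _ => dtime _ _ _).
    by rewrite mulr0 psi0 mulr1; apply => // t _; rewrite Z0 scaler0; exact: is_derive_cst.
  have := @autonomous_unique _ (liouville F) s (fun t => psi (s * t, shift1 x))
    (fun t => shift1 (psi (s * t, x))) sZ (fun t _ => dtime _ _ _).
  rewrite mulr0 !psi0 mulr1; apply => // t _; rewrite ZS.
  have := dtime s t x => D.
  have := is_derive_pair (is_derive_add (is_derive_fst D) (is_derive_cst (1 : R) t 1)) (is_derive_snd D).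
  by apply: is_deriveE; rewrite addr0 -surjective_pairing.
move=> s x s0 xr.
have := @autonomous_unique _ (liouville F) (- s) (fun t => psi (- s * t, x))
    (fun t => (x.1, x.2 * expR (s * t))) sZ (fun t _ => dtime _ _ _).
rewrite !mulr0 psi0 !mulr1 expR0 mulr1; apply; last by case: x {xr}.
move=> t /andP[t0 t1].
have e1 : 1 <= expR (s * t) by rewrite -[leLHS]expR0 ler_expR mulr_ge0.
have big : r < `|x.2 * expR (s * t)|.
  by rewrite normrM (gtr0_norm (expR_gt0 _)); apply: lt_le_trans xr _; rewrite ler_peMr.
have [E1 E2] := F0 (x.1, x.2 * expR (s * t)) big.
rewrite /liouville E1 E2 /= oppr0 addr0.
have := is_derive_pair (is_derive_cst x.1 t 1) (is_derive_expM x.2 s t).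
by apply: is_deriveE; congr (_, _); rewrite /GRing.scale /=; ring.
Qed.

End conformal.

(* Compactly supported Hamiltonians on the strip, seen on its universal cover
   and extended by zero to the whole plane. *)
Record pham (R : realType) (r : R) (H : R -> R * R -> R) : Prop := Pham {
  pham_loc : loc H;
  pham_periodic : forall t : R, 0 <= t <= 1 -> periodic (H t);
  pham_supp : forall (t : R) a, 0 <= t <= 1 -> r < `|a.2| -> H t a = 0 }.

(** * Primitives of the area form relative to a map *)

Section interpolation.
Context {R : realType}.
Implicit Types (a : R * R).

Lemma open_far (r : R) : open [set a : R * R | r < `|a.2|].
Proof.
apply: (@open_comp _ _ (fun a : R * R => `|a.2|) [set x | r < x]); last exact: open_gt.
move=> a _; apply: (@continuous_comp _ _ _ snd (fun x : R => `|x|)).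
  exact: smT_continuous (@sm_snd _ _ _ _) a.
exact: norm_continuous.
Qed.

Lemma sympl_shiftV (r : R) (m n : R * R -> R * R) q p : sympl r m n ->
  n (q + 1, p) = ((n (q, p)).1 + 1, (n (q, p)).2).
Proof.
move=> Hm; rewrite -[RHS](symplK Hm) (sympl_shift Hm).
by rewrite -surjective_pairing (symplVK Hm).
Qed.

Lemma sympl_idV (r : R) (m n : R * R -> R * R) a : sympl r m n ->
  r < `|a.2| -> n a = a.
Proof. by move=> Hm ar; rewrite -{1}(sympl_id Hm ar) (symplK Hm). Qed.

(** The form [p dq] minus its pullback under [n] is closed because [n] preserves area. Since [F] is
    zero on the whole line [p = -1], where [n] is the identity, it is periodic, so the form is exact
    on the cylinder and not only on its cover. *)
Lemma exact_primitive (r : R) (m n : R * R -> R * R) : r < 1 -> sympl r m n ->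
  exists F, [/\ smT F, periodic F,
    forall a, d1 F a = a.2 - (n a).2 * d1 (pr1 n) a,
    forall a, d2 F a = - ((n a).2 * d2 (pr1 n) a) &
    forall a, r < `|a.2| -> d1 F a = 0 /\ d2 F a = 0].
Proof.
move=> r1 Hm; have [sm sn nm mn J _ _] := Hm.
have s1 := smT_fst sn; have s2 := smT_snd sn.
have far a : r < `|a.2| -> d1 (pr1 n) a = 1 /\ d2 (pr1 n) a = 0.
  move=> ar; have N : \forall b \near a, (n b).1 = b.1.
    by apply: (filterS _ (near_open (@open_far r) ar)) => b br; rewrite (sympl_idV Hm br).
  have [-> ->] := near_eq_d12 N s1.
  by rewrite -(d1_fst a) -(d2_fst a).
have sG : smT (fun a => - ((n a).2 * d2 (pr1 n) a)).
  by apply: smT_opp; apply: smT_mul => //; exact: sm_d2.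
have [F [sF dF F0]] := primitive2 (-1) sG.
have sK : smT (fun a : R * R => a.2 - (n a).2 * d1 (pr1 n) a).
  apply: smT_sub; first exact: sm_snd.
  by apply: smT_mul => //; exact: sm_d1.
have rN1 (q : R) : r < `|(q, -1 : R).2| by rewrite /= normrN1.
have dF1 a : d1 F a = a.2 - (n a).2 * d1 (pr1 n) a.
  case: a => q p.
  pose h (s : R) := d1 F (q, s) - (s - (n (q, s)).2 * d1 (pr1 n) (q, s)).
  have hd (s : R) : is_derive s 1 h 0.
    have sd1 := sm_d1 s1; have sd2 := sm_d2 s1.
    have := is_derive_sub (is_derive_d2 q s (sm_d1 sF)) (is_derive_d2 q s sK).
    apply: is_deriveE; set a := (q, s).
    rewrite -(schwarz a sF).
    have -> : d1 (d2 F) a = - (d1 (pr2 n) a * d2 (pr1 n) a + (n a).2 * d1 (d2 (pr1 n)) a).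
      have -> : d2 F = (fun a => - ((n a).2 * d2 (pr1 n) a)) by apply/funext => b; rewrite dF.
      by rewrite (d1_opp a (smT_mul s2 sd2)) (d1_mul a s2 sd2); congr (- _); ring.
    have -> : d2 (fun a : R * R => a.2 - (n a).2 * d1 (pr1 n) a) a =
        1 - (d2 (pr2 n) a * d1 (pr1 n) a + (n a).2 * d2 (d1 (pr1 n)) a).
      rewrite (d2_add a (@sm_snd _ _ _ _) (smT_opp (smT_mul s2 sd1))).
      by rewrite d2_snd (d2_opp a (smT_mul s2 sd1)) (d2_mul a s2 sd1); congr (_ - _); ring.
    rewrite (schwarz a s1) -[a]mn.
    have [-> -> -> ->] := inverse_derivatives sm sn nm (J (n a)).
    have := J (n a); rewrite /jac.
    move: (d1 _ _) (d2 _ _) (d1 _ _) (d2 _ _) (d2 _ _) (n _).2 => x y z w u v E.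
    rewrite -[X in X - _]addr0 -E; ring.
  have := constant_of_derive0_line hd p (-1).
  rewrite /h; have -> : d1 F (q, -1) = 0.
    by apply: d1_eq => //=; rewrite (_ : (fun s => _) = cst 0); [exact: is_derive_cst|exact/funext].
  have [-> _] := far _ (rN1 q); rewrite (sympl_idV Hm (rN1 q)) mulr1 subrr subr0.
  by move/eqP; rewrite subr_eq0 => /eqP.
have pn2 q p : (n (q + 1, p)).2 = (n (q, p)).2 + 0 by rewrite (sympl_shiftV _ _ Hm) addr0.
have pn1 q p : (n (q + 1, p)).1 = (n (q, p)).1 + 1 by rewrite (sympl_shiftV _ _ Hm).
exists F; split=> // [q p|a ar].
  have hd (s : R) : is_derive s 1 (fun s => F (q + 1, s) - F (q, s)) 0.
    have := is_derive_sub (is_derive_d2 (q + 1) s sF) (is_derive_d2 q s sF).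
    by apply: is_deriveE; rewrite !dF pn2 addr0 (d12_shift _ _ s1 pn1).2 subrr.
  have := constant_of_derive0_line hd p (-1); rewrite /= !F0 subrr.
  by move/eqP; rewrite subr_eq0 => /eqP.
by rewrite dF1 dF (far a ar).1 (far a ar).2 (sympl_idV Hm ar) mulr0 mulr1 subrr oppr0.
Qed.

(** The maximum of [e1 - |F|] and [|g|] is positive on the circle, hence at least some [d > 0] on a
    strip by compactness. Where [|g| <= d], it must be [e1 - |F|] that exceeds [d]. *)
Lemma bound_near_zeros (F g : R * R -> R) (e0 e1 : R) : smT F -> smT g ->
  periodic F -> periodic g -> e0 < e1 ->
  (forall q, g (q, 0) = 0 -> `|F (q, 0)| <= e0) ->
  exists2 eta, 0 < eta & forall a, `|a.2| <= eta -> `|g a| <= eta -> `|F a| <= e1.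
Proof.
move=> sF sg pF pg e01 H.
pose G a : R := Num.max (e1 - `|F a|) `|g a|.
have cF := smT_continuous sF; have cg := smT_continuous sg.
have cG : continuous G.
  move=> a; apply: (@continuous_max R _ (fun a => e1 - `|F a|) (fun a => `|g a|)).
    by apply: cvgB; [exact: cvg_cst|apply: cvg_norm; exact: cF].
  by apply: cvg_norm; exact: cg.
have cG0 : {within `[0 : R, 1], continuous (fun x => G (x, 0))}.
  apply: continuous_subspaceT => x; apply: (@continuous_comp _ _ _ (fun x : R => (x, 0 : R)) G).
    by apply: continuous_pair; [exact: cvg_id|exact: cvg_cst].
  exact: cG.
have [x0 _ Hx0] := EVT_min ler01 cG0.
have G0 q : 0 < G (q, 0).
  rewrite /G lt_max; have [g0|gN] := eqVneq (g (q, 0)) 0; last by rewrite normr_gt0 gN orbT.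
  by rewrite subr_gt0 (le_lt_trans (H q g0) e01).
set d := G (x0, 0) / 2; have d0 : 0 < d by rewrite divr_gt0.
have cGd : continuous (fun a => G a - d).
  by move=> a; apply: cvgB; [exact: cG|exact: cvg_cst].
have [eta eta0 Heta] : exists2 e, 0 < e & forall x s, 0 <= x <= 1 -> `|s| <= e -> 0 < G (x, s) - d.
  apply: (tube (G := fun a => G a - d)) => // x xI; rewrite subr_gt0.
  apply: lt_le_trans (Hx0 x _); last by rewrite in_itv.
  by rewrite /d; have := G0 x0; lra.
exists (Num.min eta d); first by rewrite lt_min eta0.
move=> [q p] /=; rewrite !le_min => /andP[pe _] /andP[_ gd].
have [k kI] := floor_shift q.
have := Heta _ _ kI pe; rewrite subr_gt0 /G !(periodic_int pF, periodic_int pg) lt_max.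
by case/orP => h; [lra|have := lt_le_trans h gd; rewrite ltxx].
Qed.

End interpolation.

(** * The interpolating isotopy *)

Section sliding.
Context {R : realType}.
Implicit Types (a : R * R).

Lemma sm_expR : smT (@expR R).
Proof.
move=> k; elim: k => [|k IH]; first by move=> x _; exact: continuous_expR.
split=> [x _|]; first by have [] := is_derive_diff (is_derive_expR x).
have oT := openTT (R * R)%type.
have HZ : Cn k [set: R * R] (fun z : R * R => z.2 * expR z.1).
  apply: Cn_mul => //; first exact: Cn_snd.
  apply: (@Cn_comp _ _ _ _ _ setT setT fst expR) => //; first exact: openTT.
  exact: Cn_fst.
apply: (@Cn_sub _ k _ _ setT) => //; apply: Cn_eq oT _ HZ => -[x h] _ /=.
by have [_ ->] := is_derive_diff (is_derive_expR x).
Qed.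

Lemma ham_scale (b : R) (f : R * R -> R) a : smT f ->
  ham (fun z => b * f z) a = b *: ham f a.
Proof.
move=> sf; have := ham_linear b 0 a sf sf; rewrite scale0r addr0 => <-.
by congr (ham _ a); apply/funext => z; rewrite mul0r addr0.
Qed.

(** One formula serves both cutoffs: the weight 1 gives [F_0], which vanishes near [p = 0], and the
    weight [1 - chi (n a).2] gives [F_1], which agrees with [F] near the image of the circle. Their
    difference is [F a * chi a.2 * chi (n a).2]. *)
Lemma cutoff (F : R * R -> R) (r eta : R) : smT F -> periodic F -> 0 < eta -> eta < 1 ->
  (forall a, r < `|a.2| -> d1 F a = 0 /\ d2 F a = 0) ->
  exists chi : R -> R, [/\ smT chi, forall p, 0 <= chi p <= 1,
    forall p, eta < `|p| -> chi p = 0, forall p, `|p| <= eta / 2 -> chi p = 1 &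
    forall w, smT w -> periodic w ->
    [/\ smT (fun a => F a * (1 - chi a.2 * w a)), periodic (fun a => F a * (1 - chi a.2 * w a)) &
    forall a, Num.max r eta < `|a.2| -> d1 (fun a => F a * (1 - chi a.2 * w a)) a = 0 /\
       d2 (fun a => F a * (1 - chi a.2 * w a)) a = 0]].
Proof.
move=> sF pF eta0 eta1 far.
have [k [k' [[sk _] _ kI k1 _]]] := @smooth_plateau R (- eta) (- (eta / 2)) (eta / 2) eta
  ltac:(clear - eta0; lra) ltac:(clear - eta0; lra) ltac:(clear - eta0; lra).
have k0 p : eta < `|p| -> k p = 0.
  move=> ep; apply/eqP/negPn/negP => kp; have [_ /(_ kp)] := kI p.
  by rewrite -ler_norml leNgt ep.
exists k; split=> // [p|p|w sw pw].
- by have [] := kI p.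
- by rewrite ler_norml => /k1.
have sW : smT (fun a => F a * (1 - k a.2 * w a)).
  apply: smT_mul => //; apply: smT_sub; first exact: sm_cst.
  by apply: smT_mul => //; exact: sm_fun_snd.
split=> // [q p|a]; first by rewrite pF pw.
rewrite gt_max => /andP[ar ae].
have N : \forall b \near a, F b * (1 - k b.2 * w b) = F b.
  apply: (filterS _ (near_open (@open_far _ eta) ae)) => b be.
  by rewrite k0 // mul0r subr0 mulr1.
by have [-> ->] := near_eq_d12 N sW; exact: far.
Qed.

(* [Y x t = psi1 (s t, psi0 (s (1 - t), M (psi0 (- s, x)) t))], where [psi0] and
   [psi1] are the Liouville flows of two primitives of the area form that differ
   by [dE]; the first vanishes on the circle [p = 0] and the second on its image
   under [m]. The generating function consists of a multiple of [E] and of [H]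
   damped by [expR (- s)]. *)
Lemma sliding (r : R) (m n : R * R -> R * R) (H : R -> R * R -> R)
    (M : R * R -> R -> R * R) (F : R * R -> R) (e0 e1 D s : R) :
  r < 1 -> sympl r m n -> pham r H ->
  (forall z, M z 0 = z /\ solves (fun t => ham (H t)) (M z)) -> (forall z, M z 1 = m z) ->
  (forall (t : R) a, 0 <= t <= 1 -> `|H t a| <= D) ->
  smT F -> periodic F ->
  (forall a, d1 F a = a.2 - (n a).2 * d1 (pr1 n) a) ->
  (forall a, d2 F a = - ((n a).2 * d2 (pr1 n) a)) ->
  (forall a, r < `|a.2| -> d1 F a = 0 /\ d2 F a = 0) ->
  (forall q, (n (q, 0)).2 = 0 -> `|F (q, 0)| <= e0) -> 0 <= e0 -> e0 < e1 -> 0 < s ->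
  exists r' G Y, [/\ r' < 1, pham r' G,
    forall x, Y x 0 = x /\ solves (fun t => ham (G t)) (Y x),
    forall q, Y (q, 0) 1 = m (q, 0) &
    forall (t : R) a, 0 <= t <= 1 ->
      `|G t a| <= s * expR (- s * t) * e1 + expR (- s) * D].
Proof.
move=> r1 Hm HH M0 M1 HD sF pF dF1 dF2 far0 Fz e00 e01 s0.
have [lH pH suppH] := HH; have sn := sympl_smV Hm; have sn2 := smT_snd sn.
have pn2 : periodic (pr2 n) by move=> q p; rewrite (sympl_shiftV _ _ Hm).
have [eta' eta'0 small] := bound_near_zeros sF sn2 pF pn2 e01 Fz.
pose eta : R := Num.min eta' (1 / 2).
have eta0 : 0 < eta by rewrite lt_min eta'0 /=; lra.
have eta1 : eta < 1 by rewrite gt_min; apply/orP; right; lra.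
have [chi [schi chi01 chi_out chi_in cut]] := cutoff sF pF eta0 eta1 far0.
set rr := Num.max r eta in cut.
have rr1 : rr < 1 by rewrite gt_max r1.
have rrr a : rr < `|a.2| -> r < `|a.2| by apply: le_lt_trans; rewrite le_max lexx.
pose w1 a := 1 - chi (n a).2.
have sw1 : smT w1.
  by apply: smT_sub; [exact: sm_cst|exact: smT_comp sn2 schi].
have pw1 : periodic w1 by move=> q p; rewrite /w1 (pn2 q p).
have [sF0 pF0 far_0] := cut (fun=> 1) (@sm_cst _ _ _ _ _) (fun _ _ => erefl).
have [sF1 pF1 far_1] := cut w1 sw1 pw1.
set F0 := (fun a => F a * (1 - chi a.2 * 1)) in sF0 pF0 far_0.
set F1 := (fun a => F a * (1 - chi a.2 * w1 a)) in sF1 pF1 far_1.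
have open2 (f : R * R -> R) : smT f -> open [set a | `|f a| < eta / 2].
  move=> sf; apply: (@open_comp _ _ (fun a => `|f a|) [set x | x < eta / 2]); last exact: open_lt.
  move=> a _; apply: cvg_norm; exact: smT_continuous sf a.
(* Near the circle [F0] is zero, so the field is [(0, - p)]. *)
have Z0 q : liouville F0 (q, 0) = 0.
  have N : \forall b \near (q, 0), F0 b = cst 0 b.
    have I : [set a : R * R | `|a.2| < eta / 2] (q, 0) by rewrite /= normr0; lra.
    apply: (filterS _ (near_open (open2 _ (@sm_snd _ _ _ _)) I)) => b /ltW /chi_in E.
    by rewrite /F0 E mulr1 subrr mulr0.
  have [E1 E2] := near_eq_d12 N sF0; rewrite /liouville E1 E2.
  have -> : d1 (cst 0) (q, 0) = 0 :> R by apply: d1_eq; [exact: sm_cst|exact: is_derive_cst].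
  have -> : d2 (cst 0) (q, 0) = 0 :> R by apply: d2_eq; [exact: sm_cst|exact: is_derive_cst].
  by rewrite /= oppr0 addr0.
(* On the image of the circle the primitive [p dq - dF] is the pullback of [p dq] under [n], whose
   coefficient [(n a).2] vanishes there. *)
have Z1 a : (n a).2 = 0 -> liouville F1 a = 0.
  move=> na; have N : \forall b \near a, F1 b = F b.
    have I : [set a : R * R | `|(n a).2| < eta / 2] a by rewrite /= na normr0; lra.
    apply: (filterS _ (near_open (open2 _ sn2) I)) => b /ltW /chi_in E.
    by rewrite /F1 /w1 E subrr mulr0 subr0 mulr1.
  have [E1 E2] := near_eq_d12 N sF1; rewrite /liouville E1 E2 dF1 dF2 na !mul0r.
  by rewrite !oppr0 addr0 addNr.
have [psi0 [[sp0 psi00] cur0 str0 inv0 out0]] := liouville_flow sF0 pF0 far_0.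
have [psi1 [[sp1 psi10] cur1 str1 inv1 out1]] := liouville_flow sF1 pF1 far_1.
pose E z := 1 * F1 z + -1 * F0 z.
have EE z : E z = F z * chi z.2 * chi (n z).2 by rewrite /E /F1 /F0 /w1; ring.
have sE : smT E.
  by apply: smT_add; apply: smT_mul => //; exact: sm_cst.
have Eb z : `|E z| <= e1.
  rewrite EE -mulrA normrM; have c2 (x y : R) : 0 <= x <= 1 -> 0 <= y <= 1 -> `|x * y| <= 1.
    move=> /andP[x0 x1] /andP[y0 y1].
    by rewrite ger0_norm ?mulr_ge0 // mulr_ile1.
  have [zs|zb] := leP `|z.2| eta; last by rewrite chi_out // mul0r normr0 mulr0; apply: le_trans e00 (ltW e01).
  have [ns|nb] := leP `|(n z).2| eta; last first.
    by rewrite (chi_out _ nb) mulr0 normr0 mulr0; apply: le_trans e00 (ltW e01).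
  have e'e : eta <= eta' by rewrite ge_min lexx.
  have Fb := small z (le_trans zs e'e) (le_trans ns e'e).
  by rewrite -[leRHS]mulr1; apply: ler_pM => //; exact: c2.
have pE : periodic E by move=> q p; rewrite /E (pF0 q p) (pF1 q p).
have Eout z : rr < `|z.2| -> E z = 0.
  by move=> zr; rewrite EE chi_out ?mulr0 ?mul0r // (le_lt_trans _ zr) // le_max lexx orbT.
have slice0 u : smT (fun y => psi0 (u, y)).
  by apply: smT_comp sp0; apply: smT_pair; [exact: sm_cst|exact: sm_id].
have slice1 u : smT (fun y => psi1 (u, y)).
  by apply: smT_comp sp1; apply: smT_pair; [exact: sm_cst|exact: sm_id].
pose sg0 t := s * (1 - t); pose sg1 t := s * t.
pose K t z := H t (psi0 (- sg0 t, z)).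
(* The flow times [sg1] and [sg0] change at the rates [s] and [- s], which contributes [s] times the
   difference of the two Liouville fields. The terms [(0, - p)] cancel and [- s] times the
   Hamiltonian field of [E] is left. *)
pose W t z := - s * E z + expR (- sg0 t) * K t z.
pose G t y := expR (- sg1 t) * W t (psi1 (- sg1 t, y)).
pose Y x t := psi1 (sg1 t, psi0 (sg0 t, M (psi0 (- s, x)) t)).
have sK t : 0 <= t <= 1 -> smT (K t) by move=> tI; apply: smT_comp (slice0 _) (loc_slice lH tI).
have sKK t : 0 <= t <= 1 -> smT (fun z => expR (- sg0 t) * K t z).
  by move=> tI; apply: smT_mul; [exact: sm_cst|exact: sK].
have sW t : 0 <= t <= 1 -> smT (W t).
  move=> tI; apply: smT_add; last exact: sKK.
  by apply: smT_mul => //; exact: sm_cst.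
exists rr, G, Y; split; first exact: rr1.
- split.
  + have sfst : smT (fst : R * (R * R) -> R) by exact: sm_fst.
    have ssnd : smT (snd : R * (R * R) -> R * R) by exact: sm_snd.
    have sc (b : R) : smT (cst b : R * (R * R) -> R) by exact: sm_cst.
    have s1f : smT (fun x : R * (R * R) => - sg1 x.1) by apply: smT_opp; exact: smT_mul (sc s) sfst.
    have s0f : smT (fun x : R * (R * R) => - sg0 x.1).
      by apply: smT_opp; exact: smT_mul (sc s) (smT_sub (sc 1) sfst).
    have sP1 : smT (fun x : R * (R * R) => psi1 (- sg1 x.1, x.2)).
      by apply: smT_comp sp1; exact: smT_pair.
    have sP : smT (fun x : R * (R * R) => psi0 (- sg0 x.1, psi1 (- sg1 x.1, x.2))).
      by apply: smT_comp sp0; exact: smT_pair.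
    have sf1 : smT (fun x : R * (R * R) => expR (- sg1 x.1) * (- s * E (psi1 (- sg1 x.1, x.2)))).
      apply: smT_mul; first exact: smT_comp s1f sm_expR.
      by apply: smT_mul; [exact: sc|exact: smT_comp sP1 sE].
    have sf2 : smT (fun x : R * (R * R) => expR (- sg1 x.1) * expR (- sg0 x.1)).
      by apply: smT_mul; [exact: smT_comp s1f sm_expR|exact: smT_comp s0f sm_expR].
    have sop : smT (fun x : (R * R) * R => x.1.1 + x.1.2 * x.2).
      have sx1 : smT (fst : (R * R) * R -> R * R) by exact: sm_fst.
      apply: smT_add; first exact: smT_fst sx1.
      by apply: smT_mul; [exact: smT_snd sx1|exact: sm_snd].
    have := loc_postcomp (loc_pair (loc_pair (loc_sm sf1) (loc_sm sf2)) (loc_precomp lH sP)) sop.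
    congr loc; apply/funext => t; apply/funext => y /=.
    by apply: etrans (esym (mulrDr _ _ _)); rewrite /= [in RHS]mulrA.
  + move=> t tI q p; rewrite /G /W /K.
    have -> : psi1 (- sg1 t, (q + 1, p)) = shift1 (psi1 (- sg1 t, (q, p))) by exact: (inv1 _ (q, p)).2.
    move: (psi1 _) => z; rewrite (inv0 _ z).2 /shift1.
    by rewrite (pE _ _) (pH t tI _ _) -!surjective_pairing.
  + move=> t a /andP[t0 t1] ar; rewrite /G /W /K.
    (* [G] is evaluated after flowing backwards, which moves far points outwards; both [E] and [H]
       therefore vanish there. *)
    have gr (x u : R) : 0 <= u -> rr < `|x| -> rr < `|x * expR u|.
      move=> u0 xr; rewrite normrM (gtr0_norm (expR_gt0 _)); apply: lt_le_trans xr _.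
      by rewrite ler_peMr // -[leLHS]expR0 ler_expR.
    have q1 : 0 <= sg1 t by apply: mulr_ge0 => //; exact: ltW.
    have q0 : 0 <= sg0 t by apply: mulr_ge0; [exact: ltW|rewrite subr_ge0].
    rewrite (out1 _ _ q1 ar); set z := (_, _).
    have zr : rr < `|z.2| by exact: gr.
    rewrite (out0 _ _ q0 zr) Eout // suppH ?t0 //; first by rewrite !mulr0 addr0 mulr0.
    by apply: rrr; exact: gr.
- move=> x; split.
    rewrite /Y /sg1 /sg0 mulr0 psi10 subr0 mulr1 (M0 _).1.
    by have [_ [+ _]] := str0 (- s) x; rewrite opprK.
  move=> t tI; have Dz := (M0 (psi0 (- s, x))).2 t tI.
  have D0 : is_derive t 1 sg0 (- s).
    have := is_derive_mul (is_derive_cst s t 1) (is_derive_sub (is_derive_cst (1 : R) t 1) (is_derive_id t 1)).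
    by apply: is_deriveE; rewrite /cst /=; ring.
  have D1 : is_derive t 1 sg1 s.
    have := is_derive_mul (is_derive_cst s t 1) (is_derive_id t 1).
    by apply: is_deriveE; rewrite /cst /=; ring.
  have DY := cur1 _ _ _ _ _ D1 (cur0 _ _ _ _ _ D0 Dz).
  move: DY; rewrite /Y; set z := M _ t; set w := psi0 (sg0 t, z); apply: is_deriveE.
  have sHt := loc_slice lH tI.
  have inv0' b : psi0 (- sg0 t, psi0 (sg0 t, b)) = b by exact: (str0 _ b).2.1.
  have inv1' b : psi1 (- sg1 t, psi1 (sg1 t, b)) = b by exact: (str1 _ b).2.1.
  have P0 := ham_push z (slice0 (sg0 t)) (slice0 (- sg0 t)) sHt inv0'.
  rewrite (str0 _ _).2.2 in P0.
  have P1 := ham_push w (slice1 (sg1 t)) (slice1 (- sg1 t)) (sW t tI) inv1'.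
  rewrite (str1 _ _).2.2 in P1.
  have sWB : smT (fun y => W t (psi1 (- sg1 t, y))) := smT_comp (slice1 _) (sW t tI).
  have Q := etrans P1 (esym (ham_scale (expR (- sg1 t)) _ sWB)).
  apply: etrans _ Q.
  have HW : ham (W t) w = s *: liouville F1 w + (- s *: liouville F0 w + 'd (fun y => psi0 (sg0 t, y)) z (ham (H t) z)).
    apply: esym; apply: etrans (congr1 (fun u => s *: liouville F1 w + (- s *: liouville F0 w + u)) P0) _.
    rewrite (ham_linear (- s) (expR (- sg0 t)) w sE (sK t tI)).
    have -> : ham E w = 1 *: ham F1 w + -1 *: ham F0 w by exact: ham_linear.
    rewrite addrA -/(K t); congr (_ + _).
    by apply: injective_projections; rewrite /liouville /ham /= /GRing.scale /=; ring.
  have ds : 'd (fun y => psi1 (sg1 t, y)) w (s *: liouville F1 w) =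
      s *: 'd (fun y => psi1 (sg1 t, y)) w (liouville F1 w) by exact: linearZ.
  apply: esym; apply: etrans (congr1 ('d (fun y => psi1 (sg1 t, y)) w) HW) _.
  apply: etrans (linearD _ _ _) _; congr (_ + _); apply: etrans ds _.
  by congr (s *: _); exact: (str1 _ _).1.
- move=> q; rewrite /Y /sg1 /sg0 subrr mulr0 mulr1 psi00 M1.
  rewrite (inv0 _ (q, 0)).1 ?Z0 //.
  by apply: (inv1 _ _).1; apply: Z1; rewrite (symplK Hm).
move=> t a tI; have [t0 t1] := andP tI.
have D0 : 0 <= D by apply: le_trans (HD t a tI).
rewrite /G; move: (psi1 _) => z; rewrite normrM (gtr0_norm (expR_gt0 _)).
apply: (@le_trans _ _ (expR (- sg1 t) * (s * e1 + expR (- sg0 t) * D))).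
  apply: ler_wpM2l; first exact: expR_ge0.
  apply: le_trans (ler_normD _ _) _; apply: lerD.
    by rewrite normrM normrN (gtr0_norm s0); apply: ler_wpM2l; [exact: ltW|exact: Eb].
  by rewrite normrM (gtr0_norm (expR_gt0 _)); apply: ler_wpM2l; [exact: expR_ge0|exact: HD].
rewrite mulrDr [X in _ + X <= _]mulrA -expRD /sg1 /sg0.
(* The two contractions together damp [H] by the same factor at all times. *)
have -> : - (s * t) - s * (1 - t) = - s by ring.
by rewrite mulrA [expR _ * s]mulrC mulNr.
Qed.

End sliding.

(** * Hamiltonian flows in the plane *)

Definition hflow (R : realType) (r : R) (H : R -> R * R -> R) (M : R * R -> R -> R * R) :=
  pham r H /\ forall z, M z 0 = z /\ solves (fun t => ham (H t)) (M z).

(** Generates the flow run backwards, whose time-one map is the inverse. It provides the inverses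
    required by [sympl]. *)
Definition rev (R : realType) (H : R -> R * R -> R) (t : R) (a : R * R) : R :=
  -1 * H (1 - t) a.

Section planar_hamiltonians.
Context {R : realType}.
Implicit Types (a z : R * R).

Lemma loc_time (V W : normedModType R) (v : R -> V -> W) (b c : R) : loc v ->
  (forall t : R, 0 <= t <= 1 -> 0 <= b + c * t <= 1) -> loc (fun t x => v (b + c * t) x).
Proof.
move=> lv bc t x tI; have [U [g [oU Ux sg vg]]] := lv _ x (bc t tI).
have sf : smT (fun z : R * V => (b + c * z.1, z.2)).
  apply: smT_pair; last exact: sm_snd.
  by apply: smT_add; [exact: sm_cst|apply: smT_mul; [exact: sm_cst|exact: sm_fst]].
pose U' : set (R * V) := (fun z : R * V => (b + c * z.1, z.2)) @^-1` U.
have oU' : open U' by apply: open_comp => // z _; exact: smT_continuous sf _.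
exists U', (fun z : R * V => g (b + c * z.1, z.2)); split=> //.
  by apply: (sm_comp oU' oU _ (sm_sub _ sf) sg).
by move=> t' x' t'I Ux'; apply: vg => //; exact: bc.
Qed.

Lemma loc_ham (H : R -> R * R -> R) : loc H -> loc (fun t => ham (H t)).
Proof.
move=> lH; have D (h : R * R) : loc (fun t a => 'd (H t) a h).
  have := @loc_precomp _ _ _ _ _ (fun x : R * (R * R) => (x.2, h)) (loc_diff lH).
  by apply; apply: smT_pair; [exact: sm_snd|exact: sm_cst].
have := loc_pair (D (0, 1)) (loc_postcomp (D (1, 0)) (smT_opp (@sm_id _ _ setT))).
by congr loc; apply/funext => t; apply/funext => a; rewrite /ham d1.unlock d2.unlock.
Qed.

Lemma pham_ham (r : R) (H : R -> R * R -> R) (t : R) : pham r H -> 0 <= t <= 1 ->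
  periodic (ham (H t)) /\ forall a, r < `|a.2| -> ham (H t) a = 0.
Proof.
move=> [lH pH H0] tI; have sH := loc_slice lH tI; split=> [q p|a ar].
  have ph q' p' : H t (q' + 1, p') = H t (q', p') + 0 by rewrite addr0 (pH t tI).
  by rewrite /ham (d12_shift q p sH ph).1 (d12_shift q p sH ph).2.
have N : \forall b \near a, H t b = cst 0 b.
  by apply: (filterS _ (near_open (@open_far _ r) ar)) => b br; exact: H0.
have [E1 E2] := near_eq_d12 N sH; rewrite /ham E1 E2.
have -> : d1 (cst 0) a = 0 :> R by apply: d1_eq; [exact: sm_cst|exact: is_derive_cst].
have -> : d2 (cst 0) a = 0 :> R by apply: d2_eq; [exact: sm_cst|exact: is_derive_cst].
by rewrite oppr0.
Qed.

Lemma hflow_exists (r : R) (H : R -> R * R -> R) : pham r H -> exists M, hflow r H M.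
Proof.
move=> HH; have lh := loc_ham (pham_loc HH).
have [C C0 HC] := periodic_lipschitz lh (fun t tI => (pham_ham HH tI).1)
  (fun t a tI => (pham_ham HH tI).2 a).
by have [M HM] := flow_exists good_plane lh C0 HC; exists M.
Qed.

Lemma pham_rev (r : R) (H : R -> R * R -> R) : pham r H -> pham r (rev H).
Proof.
move=> [lH pH H0]; have I (t : R) : 0 <= t <= 1 -> 0 <= 1 - t <= 1.
  by move=> /andP[t0 t1]; rewrite subr_ge0 t1 gerBl.
split.
- have I' (t : R) : 0 <= t <= 1 -> 0 <= 1 + -1 * t <= 1 by rewrite mulN1r; exact: I.
  have sN : smT (fun x : R => -1 * x) by apply: smT_mul; [exact: sm_cst|exact: sm_id].
  have := loc_postcomp (loc_time lH I') sN.
  by congr loc; apply/funext => t; apply/funext => a; rewrite /rev [-1 * t]mulN1r.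
- by move=> t tI q p; rewrite /rev (pH _ (I _ tI)).
- by move=> t a tI ar; rewrite /rev H0 ?mulr0 //; exact: I.
Qed.

Lemma revK (H : R -> R * R -> R) : rev (rev H) = H.
Proof.
apply/funext => t; apply/funext => a; rewrite /rev.
by rewrite opprB addrCA subrr addr0; ring.
Qed.

Lemma hflow_rev (r : R) (H : R -> R * R -> R) M M' z :
  hflow r H M -> hflow r (rev H) M' -> M' (M z 1) 1 = z.
Proof.
move=> [HH HM] [HH' HM'].
have I1 : 0 <= (1 : R) <= 1 by rewrite ler01 lexx.
have E := @ode_unique _ _ _ (M' (M z 1)) (fun t => M z (1 - t)) (loc_ham (pham_loc HH')) (HM' _).2.
suff : M z (1 - 1) = M' (M z 1) 1 by rewrite subrr (HM z).1 => <-.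
apply: E => // [t tI|]; last by rewrite subr0 (HM' _).1.
have tI' : 0 <= 1 - t <= 1 by case/andP: tI => t0 t1; rewrite subr_ge0 t1 gerBl.
have D : is_derive t 1 (fun t => 1 - t) (- 1 : R).
  have := is_derive_sub (is_derive_cst (1 : R) t 1) (is_derive_id t 1).
  by apply: is_deriveE; rewrite sub0r.
have := is_derive_1comp (f := M z) (g := fun t : R => 1 - t) ((HM z).2 _ tI') D.
apply: is_deriveE; apply: esym; apply: ham_scale.
exact: loc_slice (pham_loc HH) tI'.
Qed.

Lemma hflow_unique (r : R) (H : R -> R * R -> R) M (c : R -> R * R) (t : R) :
  hflow r H M -> solves (fun t => ham (H t)) c -> 0 <= t <= 1 -> c t = M (c 0) t.
Proof.
move=> [HH HM] sc tI; apply/esym/(ode_unique (loc_ham (pham_loc HH)) sc) => //.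
  exact: (HM _).2.
by rewrite (HM _).1.
Qed.

Lemma hflow_id (r : R) (H : R -> R * R -> R) M z (t : R) :
  hflow r H M -> r < `|z.2| -> 0 <= t <= 1 -> M z t = z.
Proof.
move=> hM zr tI; apply/esym; apply: (hflow_unique (c := fun=> z) hM _ tI) => u uI.
by rewrite ((pham_ham hM.1 uI).2 z zr); exact: is_derive_cst.
Qed.

Lemma hflow_shift (r : R) (H : R -> R * R -> R) M q p (t : R) :
  hflow r H M -> 0 <= t <= 1 -> M (q + 1, p) t = ((M (q, p) t).1 + 1, (M (q, p) t).2).
Proof.
move=> hM tI.
pose c u := ((M (q, p) u).1 + 1, (M (q, p) u).2).
have c0 : c 0 = (q + 1, p) by rewrite /c (hM.2 _).1.
rewrite -c0; apply/esym; apply: (hflow_unique hM _ tI) => u uI.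
have D := (hM.2 (q, p)).2 u uI.
have := is_derive_pair (is_derive_add (is_derive_fst D) (is_derive_cst (1 : R) u 1)) (is_derive_snd D).
apply: is_deriveE; rewrite addr0 -surjective_pairing /c.
by rewrite ((pham_ham hM.1 uI).1) -surjective_pairing.
Qed.

Lemma hflow_sympl (r : R) (H : R -> R * R -> R) M :
  hflow r H M -> exists n, sympl r (fun z => M z 1) n.
Proof.
move=> hM; have hr := pham_rev hM.1; have [M' hM'] := hflow_exists hr.
have I1 : 0 <= (1 : R) <= 1 by rewrite ler01 lexx.
exists (fun z => M' z 1); split.
- exact: flow_sm good_plane (loc_ham (pham_loc hM.1)) hM.2.
- exact: flow_sm good_plane (loc_ham (pham_loc hr)) hM'.2.
- by move=> a; exact: hflow_rev hM hM'.
- by move=> a; apply: hflow_rev hM' _; rewrite revK.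
- move=> a; apply: etrans (jac_flow (c := 0) (loc_ham (pham_loc hM.1)) hM.2 _ a) (expR0 _) => t y tI.
  have sH := loc_slice (pham_loc hM.1) tI.
  have sh : smT (ham (H t)) by apply: smT_pair; [exact: sm_d2|apply: smT_opp; exact: sm_d1].
  apply: etrans (congr2 (fun u w : R * R => u.1 + w.2) (diff_planarE y (1, 0) sh) (diff_planarE y (0, 1) sh)) _ => /=.
  by rewrite (d2_opp y (sm_d1 sH)) (schwarz y sH) !mul0r !mul1r addr0 add0r subrr.
- by move=> q p; exact: hflow_shift hM I1.
- by move=> a ar; exact: hflow_id hM ar I1.
Qed.

Lemma hflow_strip (r : R) (H : R -> R * R -> R) M z (t : R) : r < 1 ->
  hflow r H M -> 0 <= t <= 1 -> `|z.2| < 1 -> `|(M z t).2| < 1.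
Proof.
move=> r1 hM tI z1; rewrite ltNge; apply/negP => big.
have far : r < `|(M z t).2| by apply: lt_le_trans r1 big.
have [t0 t1] := andP tI.
(* The trajectory is run backwards from time [t]. At its end point the field vanishes at all times,
   so the constant curve solves the reversed equation as well, and uniqueness contradicts the start
   inside the strip. *)
have bc (u : R) : 0 <= u <= 1 -> 0 <= t + - t * u <= 1.
  move=> /andP[u0 u1]; have -> : t + - t * u = t * (1 - u) by ring.
  by rewrite mulr_ge0 ?subr_ge0 //= mulr_ile1 ?subr_ge0 // gerBl.
have sN : smT (fun x : R * R => - t *: x).
  by apply: sm_scale; [exact: openTT|exact: sm_cst|exact: sm_id].
have lv := loc_postcomp (loc_time (loc_ham (pham_loc hM.1)) bc) sN.
have I1 : 0 <= (1 : R) <= 1 by rewrite ler01 lexx.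
have E := @ode_unique _ _ _ (fun u => M z (t + - t * u)) (fun=> M z t) lv.
suff Ez : M z t = M z (t + - t * 1).
  by move: big; rewrite Ez mulr1 subrr (hM.2 z).1 leNgt z1.
apply: E => // [u uI|u uI|]; last by rewrite mulr0 addr0.
  have D : is_derive u 1 (fun u => t + - t * u) (- t).
    have := is_derive_add (is_derive_cst t u 1) (is_derive_mul (is_derive_cst (- t) u 1) (is_derive_id u 1)).
    by apply: is_deriveE; rewrite /cst /=; ring.
  have := is_derive_1comp (f := M z) (g := fun u : R => t + - t * u) ((hM.2 z).2 _ (bc u uI)) D.
  exact: is_deriveE.
rewrite ((pham_ham hM.1 (bc u uI)).2 _ far) scaler0; exact: is_derive_cst.
Qed.

Lemma sympl_inv (r : R) (m n : R * R -> R * R) : sympl r m n -> sympl r n m.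
Proof.
move=> Hm; have [sm sn nm mn J sh mid] := Hm; split=> //.
- move=> a; rewrite -[a]mn /jac.
  have [-> -> -> ->] := inverse_derivatives sm sn nm (J (n a)).
  by have := J (n a); rewrite /jac; move: (d1 _ _) (d2 _ _) (d1 _ _) (d2 _ _) => x y z w <-; ring.
- by move=> q p; exact: sympl_shiftV Hm.
- by move=> a; exact: sympl_idV Hm.
Qed.

Lemma hflow_conj (r r' : R) (H : R -> R * R -> R) M (A B : R * R -> R * R) :
  hflow r H M -> sympl r' A B ->
  hflow (Num.max r r') (fun t a => H t (B a)) (fun z t => A (M (B z) t)).
Proof.
move=> hM HA; have [[lH pH H0] HM] := hM; have HB := sympl_inv HA.
have sA := sympl_sm HA; have sB := sympl_sm HB.
split=> [|z].
  split.
  - have sB2 : smT (fun x : R * (R * R) => B x.2) by apply: smT_comp sB; exact: sm_snd.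
    exact: loc_precomp lH sB2.
  - by move=> t tI q p; rewrite (sympl_shift HB) (pH t tI) -surjective_pairing.
  - move=> t a tI; rewrite gt_max => /andP[ar ar'].
    by rewrite (sympl_id HB) //; exact: H0.
split; first by rewrite (HM _).1 (symplK HB).
move=> t tI; have D := (HM (B z)).2 t tI.
have dA := smT_differentiable (M (B z) t) sA.
have := is_derive_comp dA D; apply: is_deriveE.
apply: etrans (ham_push _ sA sB (loc_slice lH tI) (symplK HA)) _.
by rewrite (sympl_jac HA) scale1r.
Qed.

Lemma pham_bound (r : R) (H : R -> R * R -> R) : r < 1 -> pham r H ->
  exists2 D, 0 <= D & forall (t : R) a, 0 <= t <= 1 -> `|H t a| <= D.
Proof.
move=> r1 [lH pH H0].
(* [H] is viewed as a planar field to obtain a Lipschitz constant; a point of the support is then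
   compared with the point [(a.1, 1)], where [H] is zero, at distance at most 2. *)
have l2 : loc (fun t a => (H t a, 0 : R)).
  by apply: loc_pair => //; exact: (loc_sm (@sm_cst R (R * (R * R))%type R setT 0)).
have p2 (t : R) : 0 <= t <= 1 -> periodic (fun a => (H t a, 0 : R)).
  by move=> tI q p; rewrite (pH t tI).
have z2 (t : R) a : 0 <= t <= 1 -> r < `|a.2| -> (H t a, 0 : R) = 0.
  by move=> tI ar; rewrite (H0 t a tI ar).
have [C C0 HC] := periodic_lipschitz l2 p2 z2.
exists (C * 2) => [|t a tI]; first by rewrite mulr_ge0.
have [ar|ar] := leP `|a.2| r; last by rewrite (H0 t a tI ar) normr0 mulr_ge0.
have := HC t a (a.1, 1) tI; rewrite (H0 t (a.1, 1) tI) /= ?normr1 // => h.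
apply: le_trans (_ : `|(H t a, 0 : R) - (0, 0)| <= _).
  by rewrite -[_ - _]/(H t a - 0, 0 - 0) !subr0 prod_normE le_max lexx.
apply: le_trans h _; apply: ler_wpM2l => //.
rewrite -[a - _]/(a.1 - a.1, a.2 - 1) subrr norm_pair_le normr0 ler0n /=.
by apply: le_trans (ler_normB _ _) _; rewrite normr1; move: ar r1; clear; lra.
Qed.

Lemma sympl_lipschitz (r : R) (m n : R * R -> R * R) : sympl r m n ->
  exists2 C, 0 <= C & forall x y, `|m x - m y| <= C * `|x - y|.
Proof.
move=> Hm; have sv : smT (fun z : R * (R * R) => m z.2 - z.2).
  apply: smT_sub; last exact: sm_snd.
  by apply: smT_comp (sympl_sm Hm); exact: sm_snd.
have p2 (t : R) : 0 <= t <= 1 -> periodic (fun a => m a - a).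
  move=> tI q p; rewrite (sympl_shift Hm); apply: injective_projections => //=.
  by rewrite opprD addrACA subrr addr0.
have z2 (t : R) a : 0 <= t <= 1 -> r < `|a.2| -> m a - a = 0.
  by move=> tI ar; rewrite (sympl_id Hm ar) subrr.
have [C C0 HC] := periodic_lipschitz (loc_sm sv) p2 z2.
exists (C + 1) => [|x y]; first by rewrite addr_ge0.
have -> : m x - m y = (m x - x - (m y - y)) + (x - y) by rewrite opprB addrAC !subrKA.
apply: le_trans (ler_normD _ _) _; rewrite mulrDl mul1r; apply: lerD => //.
by apply: (HC 0); rewrite lexx ler01.
Qed.

End planar_hamiltonians.

Section planar_interpolation.
Context {R : realType}.
Implicit Types (a z : R * R).

Lemma planar_interpolation (r : R) (H : R -> R * R -> R) M (N : nat) (eps e1 D s : R) :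
  r < 1 -> hflow r H M ->
  (forall z, `|(M z 1).1 - z.1| <= 1) -> (forall z, `|(M z 1).2 - z.2| <= eps) ->
  0 < eps -> eps <= 1 / 4 ->
  (forall x, (M (x, 0) 1).2 = 0 -> d1 (fun z => (M z 1).2) (x, 0) != 0) ->
  (forall u : seq R, uniq u ->
    (forall x, x \in u -> 0 <= x < 1 /\ (M (x, 0) 1).2 = 0) -> (size u <= N)%N) ->
  14 * eps * 2 ^+ N < e1 ->
  (forall (t : R) a, 0 <= t <= 1 -> `|H t a| <= D) -> 0 < s ->
  exists r' G Y, [/\ r' < 1, hflow r' G Y,
    forall q, Y (q, 0) 1 = M (q, 0) 1 &
    forall (t : R) a, 0 <= t <= 1 ->
      `|G t a| <= s * expR (- s * t) * e1 + expR (- s) * D].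
Proof.
move=> r1 hM disp thin eps0 eps4 tr cnt e1b HD s0.
have [n Hm] := hflow_sympl hM; set m := (fun z => M z 1) in Hm.
have sm' := sympl_sm Hm; have sQ := smT_fst sm'; have sP := smT_snd sm'.
have [F [sF pF dF1 dF2 far]] := exact_primitive r1 Hm.
(* On the circle [p dq] vanishes, so [F] pulled back by [m] is a primitive of the pullback of
   [p dq]: it is the action of the image curve. *)
pose S x := F (m (x, 0)).
have dS (x : R) : is_derive x 1 S ((m (x, 0)).2 * d1 (pr1 m) (x, 0)).
  have := is_derive_planar sF (is_derive_pair (is_derive_d1 x 0 sQ) (is_derive_d1 x 0 sP)).
  rewrite /= -surjective_pairing dF1 dF2 (symplK Hm) /= !mul0r subr0 oppr0 mulr0 addr0 mulrC.
  by congr (is_derive _ _ _ _); apply/funext => y; rewrite /S -surjective_pairing.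
have pS x : S (x + 1) = S x.
  by rewrite /S (sympl_shift Hm) (pF _ _) -surjective_pairing.
have AB := action_bound Hm r1 disp thin eps0 eps4 tr cnt dS pS.
have [c0 Hc0] : exists c0, forall x, (m (x, 0)).2 = 0 -> `|S x - c0| <= 14 * eps * 2 ^+ N.
  have [[x0 x00]|no] := pselect (exists x, (m (x, 0)).2 = 0).
    by exists (S x0) => x x0'; exact: AB.
  by exists 0 => x x00; exfalso; apply: no; exists x.
(* Only the differential of [F] matters for the Liouville fields; subtracting the common approximate
   value makes it small at the intersection points. *)
pose F' a := F a - c0.
have sF' : smT F' by apply: smT_sub => //; exact: sm_cst.
have dc a : d1 F' a = d1 F a /\ d2 F' a = d2 F a.
  case: a => q p; split; [apply: (d1_eq sF')|apply: (d2_eq sF')] => /=.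
    have := is_derive_sub (is_derive_d1 q p sF) (is_derive_cst c0 q 1).
    by apply: is_deriveE; rewrite subr0.
  have := is_derive_sub (is_derive_d2 q p sF) (is_derive_cst c0 p 1).
  by apply: is_deriveE; rewrite subr0.
have pF' : periodic F' by move=> q p; rewrite /F' pF.
have [r' [G [Y [r'1 HG HY Y1 GB]]]] := @sliding _ r m n H M F' (14 * eps * 2 ^+ N) e1 D s r1 Hm hM.1 hM.2
  (fun=> erefl) HD sF' pF'
  (fun a => etrans (dc a).1 (dF1 a)) (fun a => etrans (dc a).2 (dF2 a))
  (fun a ar => conj (etrans (dc a).1 (far a ar).1) (etrans (dc a).2 (far a ar).2))
  ltac:(move=> q; case E: (n (q, 0)) => [x p] /= p0; rewrite p0 in E;
    by have := Hc0 x; rewrite /S -E (symplVK Hm); apply)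
  ltac:(by rewrite !mulr_ge0 ?exprn_ge0 // ltW) e1b s0.
by exists r', G, Y; split.
Qed.

End planar_interpolation.

(** * From the plane to the cylinder *)

Section smoothness.
Context {R : realType}.

(** [Ck] differentiates in one fixed direction at a time; the expansion of a variable direction in
    the standard basis recovers the joint differential. *)
Lemma Ck_Cn k (U : set (R * (R * R))) (f : R * (R * R) -> R) : open U ->
  Ck k U f -> Cn k U f.
Proof.
move=> oU; elim: k f => // k IH f [df Df]; split=> //.
have oUU : open (U `*` [set: R * (R * R)]) by exact: open_setXT.
pose v1 : R * (R * R) := (1, (0, 0)); pose v2 : R * (R * R) := (0, (1, 0)).
pose v3 : R * (R * R) := (0, (0, 1)).
have CD v : Cn k (U `*` [set: R * (R * R)]) (fun z => 'D_v f z.1).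
  apply: (Cn_comp oUU oU (g := fst) (f := fun x => 'D_v f x)) => [z []//||].
    exact: Cn_fst.
  exact: IH (Df v).
have sT1 : sm [set: R * (R * R)] (fun z => z.1) by exact: sm_fst.
have sT2 : smT (fun z : R * (R * R) => z.2.1) by exact: smT_fst (@sm_snd _ _ _ _).
have sT3 : smT (fun z : R * (R * R) => z.2.2) by exact: smT_snd (@sm_snd _ _ _ _).
have cc (g : R * (R * R) -> R) : smT g -> Cn k (U `*` [set: R * (R * R)]) (fun z => g z.2).
  by move=> sg; apply: (Cn_comp oUU (@openTT _ _) (g := snd) (f := g)) => //; exact: Cn_snd.
have := Cn_add oUU (Cn_mul oUU (cc _ sT1) (CD v1))
  (Cn_add oUU (Cn_mul oUU (cc _ sT2) (CD v2)) (Cn_mul oUU (cc _ sT3) (CD v3))).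
apply: Cn_eq => // -[x [h1 [h2 h3]]] [/= Ux _].
rewrite !deriveE; try exact: df.
have -> : (h1, (h2, h3)) = h1 *: v1 + (h2 *: v2 + h3 *: v3).
  by apply: injective_projections => /=; [|apply: injective_projections => /=];
    rewrite /GRing.scale /=; ring.
by rewrite !linearD !linearZ.
Qed.

Lemma Cn_Ck k (V W : normedModType R) (U : set V) (f : V -> W) : open U ->
  Cn k U f -> Ck k U f.
Proof.
move=> oU; elim: k f => // k IH f [df Cf]; split=> // v; apply: IH.
have H : Cn k U (fun x => 'd f x v).
  apply: (Cn_comp oU (open_setXT oU) (g := fun x => (x, v)) (f := fun z => 'd f (z.1) z.2)) => //.
  by apply: Cn_pair => //; [exact: Cn_id|exact: Cn_cst].
by apply: Cn_eq oU _ H => x Ux; rewrite deriveE //; exact: df.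
Qed.

End smoothness.

Section cylinder.
Context {R : realType}.
Implicit Types (a b : R * R) (x : cylinder R).

Lemma to_circleP (q q' : R) :
  to_circle q = to_circle q' <-> exists k : int, q = q' + k%:~R.
Proof.
have E : reflect (to_circle q = to_circle q') (q - q' \in integers R).
  by rewrite (Quotient.idealrBE (integers R)); exact: eqP.
split=> [h|[k qk]].
  by have /Num.int_num_subproof[k Ek] := introT E h; exists k; rewrite -Ek addrC subrK.
rewrite qk in E *; by apply/E/Num.int_num_subproof; exists k; rewrite addrC addKr.
Qed.

Lemma to_circle_surj (c : circle R) : exists q, 0 <= q <= 1 /\ to_circle q = c.
Proof.
have [k kI] := floor_shift (repr c); exists (repr c + k%:~R); split=> //.
rewrite -[RHS]reprK; apply/to_circleP.
by exists k.
Qed.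

Lemma strip_norm a : strip a <-> `|a.2| < 1.
Proof. by rewrite ltr_norml. Qed.

Lemma proj_snd a : strip a -> val (Defs.proj a).2 = a.2.
Proof. by move=> sa; rewrite /Defs.proj /= insubdK. Qed.

Lemma proj_eq a b : strip a -> strip b -> Defs.proj a = Defs.proj b ->
  exists k : int, a = (b.1 + k%:~R, b.2).
Proof.
move=> sa sb E; have E2 : a.2 = b.2 by rewrite -(proj_snd sa) -(proj_snd sb) E.
have /to_circleP[k Ek] : to_circle a.1 = to_circle b.1 by case: E.
by exists k; rewrite -Ek -E2; case: (a).
Qed.

Lemma proj_shift q p (k : int) : Defs.proj (q + k%:~R, p) = Defs.proj (q, p) :> cylinder R.
Proof. by rewrite /Defs.proj /=; congr (_, _); apply/to_circleP; exists k. Qed.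

Lemma proj_surj x : exists a, strip a /\ Defs.proj a = x.
Proof.
case: x => c [p pI]; have [q [_ <-]] := to_circle_surj c.
by exists (q, p); split=> //; rewrite /Defs.proj /=; congr (_, _); apply: val_inj; rewrite /= insubdK.
Qed.

End cylinder.

(** The value 0 beyond the strip continues [H] smoothly, since [H] already vanishes for
    [r < |p| < 1]. *)
Definition hlift (R : realType) (H : R -> cylinder R -> R) (t : R) (a : R * R) : R :=
  if `|a.2| < 1 then H t (Defs.proj a) else 0.

Section transfer.
Context {R : realType}.
Implicit Types (a b : R * R) (x : cylinder R).

Lemma open_strip : open (@strip R).
Proof.
have -> : @strip R = [set a | `|a.2| < 1].
  by apply/seteqP; split=> a /=; rewrite /strip /= ltr_norml.
apply: (@open_comp _ _ (fun a : R * R => `|a.2|) [set x | x < 1]); last exact: open_lt.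
by move=> a _; apply: cvg_norm; exact: smT_continuous (@sm_snd _ _ _ _) a.
Qed.

Lemma shift_int (m : R * R -> R * R) q p (k : int) :
  (forall q p, m (q + 1, p) = ((m (q, p)).1 + 1, (m (q, p)).2)) ->
  m (q + k%:~R, p) = ((m (q, p)).1 + k%:~R, (m (q, p)).2).
Proof.
move=> sh; pose f a := ((m a).1 - a.1, (m a).2).
have pf : periodic f by move=> q' p'; rewrite /f sh /= opprD addrACA subrr addr0.
have := periodic_int pf k q p; rewrite /f /=; case: (m (q + _, p)) => x y [E ->].
by congr (_, _); rewrite -[LHS](subrK (q + k%:~R)) E addrA subrK.
Qed.

Lemma hflow_shift_int (r : R) (H : R -> R * R -> R) M q p (k : int) (t : R) :
  hflow r H M -> 0 <= t <= 1 ->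
  M (q + k%:~R, p) t = ((M (q, p) t).1 + k%:~R, (M (q, p) t).2).
Proof.
by move=> hM tI; apply: (shift_int (m := fun z => M z t)) => q' p'; exact: hflow_shift hM tI.
Qed.

Lemma hlift_pham (H : R -> cylinder R -> R) : is_hamiltonian H ->
  exists2 r, r < 1 & pham r (hlift H).
Proof.
move=> [sH [r r1 H0]]; exists r => //.
have far (t : R) a : 0 <= t <= 1 -> r < `|a.2| -> hlift H t a = 0.
  rewrite /hlift; case: ifP => // a1 tI ar; apply: H0 => //.
  by rewrite proj_snd //; apply/strip_norm.
split=> // [t a tI|t tI q p]; last first.
  by rewrite /hlift /=; case: ifP => // _; congr (H t _); exact: (proj_shift q p 1).
have [a1|a1] := ltP `|a.2| 1; last first.
  exists (snd @^-1` [set b : R * R | r < `|b.2|]), (cst 0); split.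
  - apply: open_comp; last exact: open_far.
    by move=> z _; exact: smT_continuous (@sm_snd _ _ _ _) z.
  - exact: lt_le_trans r1 a1.
  - exact: sm_cst.
  - by move=> t' x' t'I; exact: far.
have [U [g [oU Ut sg Hg]]] := sH (t, a) (conj tI ((strip_norm a).2 a1)).
pose S : set (R * (R * R)) := snd @^-1` (@strip R).
have oS : open S.
  apply: open_comp; last exact: open_strip.
  by move=> z _; exact: smT_continuous (@sm_snd _ _ _ _) z.
exists (U `&` S), g; split.
- exact: openI.
- by split=> //; exact/strip_norm.
- apply: sm_sub (_ : sm U g); first exact: subIsetl.
  by move=> k; exact: Ck_Cn oU (sg k).
- move=> t' x' t'I [Ux Sx]; rewrite /hlift (strip_norm x').1 //.
  by apply: (Hg (t', x')).
Qed.

Lemma ham_vf_eq (h : cylinder R -> R) (K : R * R -> R) a : smT K ->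
  (forall b, strip b -> h (Defs.proj b) = K b) -> strip a -> ham_vf h a = ham K a.
Proof.
move=> sK hK sa; have N : \forall b \near a, h (Defs.proj b) = K b.
  exact: (filterS hK (near_open open_strip sa)).
rewrite /ham_vf !(near_eq_derive _ N) /ham d1.unlock d2.unlock.
by rewrite !deriveE //; exact: smT_differentiable.
Qed.

(** The flow on the cylinder comes with no regularity in the initial point. Each of its lifted
    integral curves solves the planar equation, so by uniqueness it is a trajectory of the smooth
    planar flow, up to an integer translation. *)
Lemma Ham_lift (phi : cylinder R -> cylinder R) : Ham phi ->
  exists r H M, [/\ r < 1, hflow r H M &
    forall a, strip a -> phi (Defs.proj a) = Defs.proj (M a 1)].
Proof.
move=> [H [hH [Phi flow <-]]]; have [r r1 pH] := hlift_pham hH.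
have [M hM] := hflow_exists pH; exists r, (hlift H), M; split=> // a sa.
have [_ [g Hg]] := flow (Defs.proj a).
have I0 : 0 <= (0 : R) <= 1 by rewrite lexx ler01.
have I1 : 0 <= (1 : R) <= 1 by rewrite lexx ler01.
have sg : solves (fun t => ham (hlift H t)) g.
  move=> t tI; have [[sgt _] D] := Hg t tI.
  rewrite -(ham_vf_eq (h := H t)) //; first exact: loc_slice (pham_loc pH) tI.
  by move=> b /strip_norm b1; rewrite /hlift b1.
have [[sg1 <-] _] := Hg 1 I1; rewrite (hflow_unique hM sg I1).
have [[sg0 E0] _] := Hg 0 I0; rewrite (flow _).1 in E0.
have [k ->] := proj_eq sg0 sa E0.
rewrite (hflow_shift_int _ _ _ hM I1) proj_shift.
by rewrite -!surjective_pairing.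
Qed.

Lemma osc_le (h : cylinder R -> R) (B : R) : (forall x, `|h x| <= B) ->
  0 <= osc h <= 2 * B.
Proof.
move=> hB; have [x0 _] : exists x0 : cylinder R, True.
  by exists (Defs.proj (0, 0)).
have ub : ubound (range h) B by move=> _ [x _ <-]; have := hB x; rewrite ler_norml => /andP[].
have lb : lbound (range h) (- B) by move=> _ [x _ <-]; have := hB x; rewrite ler_norml => /andP[].
have ne : range h !=set0 by exists (h x0), x0.
have hs : h x0 <= sup (range h) by apply: ub_le_sup; [exists B|exists x0].
have hi : inf (range h) <= h x0 by apply: ge_inf; [exists (- B)|exists x0].
have s1 : sup (range h) <= B by exact: ge_sup.
have s2 : - B <= inf (range h) by exact: lb_le_inf.
rewrite /osc; apply/andP; split; first by move: hs hi; clear; lra.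
by move: s1 s2; clear; lra.
Qed.

(* No measurability is needed: the integral of a nonnegative function is a
   supremum over the simple functions below it. *)
Lemma integral_le (f g : R -> \bar R) (D : set R) :
  (forall t, D t -> 0 <= f t)%E -> (forall t, D t -> f t <= g t)%E ->
  (\int[lebesgue_measure]_(t in D) f t <= \int[lebesgue_measure]_(t in D) g t)%E.
Proof.
move=> f0 fg; rewrite !ge0_integralE //; last by move=> t Dt; exact: le_trans (f0 t Dt) (fg t Dt).
apply: le_ereal_sup => _ [h hf <-]; exists h => // t; apply: le_trans (hf t) _.
by rewrite /patch; case: ifPn => // /set_mem; exact: fg.
Qed.

Lemma hflow_generates (r : R) (H : R -> R * R -> R) M (B : R -> R) :
  r < 1 -> hflow r H M ->
  (forall (t : R) a, 0 <= t <= 1 -> `|H t a| <= B t) ->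
  exists phi : cylinder R -> cylinder R, [/\ Ham phi,
    forall a, strip a -> phi (Defs.proj a) = Defs.proj (M a 1) &
    (hofer_norm phi <= \int[lebesgue_measure]_(t in `[0%R, 1%R]) (2 * B t)%:E)%E].
Proof.
move=> r1 hM HB; have [[lH pH H0] HM] := hM.
(* An arbitrary section of the covering; periodicity makes [h] and the projected flow independent of
   the choice. *)
pose lft x : R * R := sval (cid (proj_surj x)).
have lftP x : strip (lft x) /\ Defs.proj (lft x) = x by rewrite /lft; case: cid.
pose h t x := H t (lft x).
have hE (t : R) a : 0 <= t <= 1 -> strip a -> h t (Defs.proj a) = H t a.
  move=> tI sa; have [sl pl] := lftP (Defs.proj a).
  have [k E] := proj_eq sl sa pl.
  by rewrite /h E (periodic_int (pH t tI)) -surjective_pairing.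
have ish : is_hamiltonian h.
  split; last first.
    exists r => // t x tI xr; apply: H0 => //; have [sl pl] := lftP x.
    by rewrite -(proj_snd sl) pl.
  move=> [t a] [/= tI sa]; have [U [g [oU Ut sg Hg]]] := lH t a tI.
  exists U, g; split=> // [k|[t' a'] [[/= t'I sa'] Ut']]; first exact: Cn_Ck oU (sg k).
  by rewrite hE //; exact: Hg.
pose Phi t x := Defs.proj (M (lft x) t).
have strM a (t : R) : 0 <= t <= 1 -> strip a -> strip (M a t).
  by move=> tI /strip_norm a1; apply/strip_norm; exact: hflow_strip r1 hM tI a1.
have flow : is_flow h Phi.
  move=> x; have [sl pl] := lftP x; split; first by rewrite /Phi (HM _).1.
  exists (M (lft x)) => t tI; split; first by split=> //; exact: strM.
  rewrite (ham_vf_eq (K := H t)) //; first exact: (HM _).2.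
  - exact: loc_slice lH tI.
  - by move=> b; exact: hE.
  - exact: strM.
have gen : generates h (Phi 1) by split=> //; exists Phi.
exists (Phi 1); split; first by exists h.
  move=> a sa; have I1 : 0 <= (1 : R) <= 1 by rewrite lexx ler01.
  have [sl pl] := lftP (Defs.proj a); have [k E] := proj_eq sl sa pl.
  rewrite /Phi E (hflow_shift_int _ _ _ hM I1) proj_shift.
  by rewrite -!surjective_pairing.
apply: le_trans (_ : \int[lebesgue_measure]_(t in `[0%R, 1%R]) (osc (h t))%:E <= _)%E.
  by apply: ereal_inf_lbound; exists h.
have oscB (t : R) : `[0%R, 1%R]%classic t -> 0 <= osc (h t) <= 2 * B t.
  rewrite /= in_itv /= => tI; apply: osc_le => x; exact: HB.
by apply: integral_le => t /oscB; rewrite lee_fin => /andP[].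
Qed.

Lemma Ham_osc_ge0 (H : R -> cylinder R -> R) (t : R) : is_hamiltonian H ->
  0 <= t <= 1 -> 0 <= osc (H t).
Proof.
move=> hH tI; have [r r1 pH] := hlift_pham hH.
have [D D0 HD] := pham_bound r1 pH.
have [] := andP (@osc_le (H t) D _) => // x.
have [a [sa <-]] := proj_surj x; have := HD t a tI.
by rewrite /hlift (strip_norm a).1.
Qed.

Lemma hofer_dist_ge0 (L L' : set (cylinder R)) : (0 <= hofer_dist L L')%E.
Proof.
apply/ereal_infP => _ [phi _ <-]; apply/ereal_infP => _ [H [hH _] <-].
by apply: integral_ge0 => t /=; rewrite in_itv /= => tI; rewrite lee_fin; exact: Ham_osc_ge0.
Qed.

End transfer.

(** * Displacement of lifted maps *)

Definition lifts (R : realType) (m : R * R -> R * R) (phi : cylinder R -> cylinder R) :=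
  forall a, strip a -> strip (m a) /\ phi (Defs.proj a) = Defs.proj (m a).

Section displacement.
Context {R : realType}.
Implicit Types (a z : R * R) (x : cylinder R).

Lemma circle_dist_ge0 (c c' : circle R) : 0 <= circle_dist c c'.
Proof.
apply: lb_le_inf; last by move=> _ [a [b [_ _ ->]]].
have [a [_ Ea]] := to_circle_surj c; have [b [_ Eb]] := to_circle_surj c'.
by exists `|a - b|, a, b.
Qed.

Lemma circle_dist_le1 (c c' : circle R) : circle_dist c c' <= 1.
Proof.
have [a [aI Ea]] := to_circle_surj c; have [b [bI Eb]] := to_circle_surj c'.
apply: le_trans (_ : `|a - b| <= _).
  by apply: ge_inf; [exists 0 => _ [? [? [_ _ ->]]]|exists a, b].
by rewrite ler_norml; move: aI bI; clear; lra.
Qed.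

Lemma circle_dist_lift (q q' e : R) : circle_dist (to_circle q) (to_circle q') < e ->
  exists k : int, `|q - q' - k%:~R| < e.
Proof.
have ne : [set r | exists a b : R, [/\ to_circle a = to_circle q,
    to_circle b = to_circle q' & r = `|a - b|]] !=set0 by exists `|q - q'|, q, q'.
move=> lte; have [_ [a [b [Ea Eb ->]]] abe] := inf_lt ne lte.
have /to_circleP[k ak] := Ea; have /to_circleP[l bl] := Eb.
exists (l - k); move: abe; rewrite ak bl rmorphB /=.
by have -> : q + k%:~R - (q' + l%:~R) = q - q' - (l%:~R - k%:~R) by ring.
Qed.

Lemma cyl_dist_le_C0 (phi : cylinder R -> cylinder R) x :
  cyl_dist (phi x) x <= C0_dist_id phi.
Proof.
apply: ub_le_sup; last by exists x.
(* The supremum needs an upper bound: the circle distance is at most 1 and the vertical one at most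
   2. *)
exists (Num.sqrt 5) => _ [y _ <-]; apply: ler_wsqrtr.
have := circle_dist_ge0 (phi y).1 y.1; have := circle_dist_le1 (phi y).1 y.1.
case: (phi y).2 y.2 => [u uI] [v vI] /=; move: (circle_dist _ _) => d d1 d0.
have h1 : d ^+ 2 <= 1 by rewrite expr2; move: d0 d1; clear; nra.
have h2 : (u - v) ^+ 2 <= 4 by rewrite expr2; move: uI vI; clear; nra.
by move: h1 h2; clear; lra.
Qed.

Lemma near_int_eq0 (e f : R) (k : int) : `|f| <= 1 / 2 -> e < 1 / 2 ->
  `|f - k%:~R| < e -> `|f| < e.
Proof.
move=> f2 e2 fk.
have kb : `|k%:~R : R| < 1.
  have -> : k%:~R = f - (f - k%:~R) by ring.
  by apply: le_lt_trans (ler_normB _ _) _; move: f2 e2 fk; clear; lra.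
have k0 : k = 0.
  by apply/eqP/negPn/negP; rewrite -normr_gt0 gtz0_ge1 -(@ler1z R) intr_norm leNgt kb.
by move: fk; rewrite k0 subr0.
Qed.

(* The displacement in the circle direction is within [e] of an integer, and
   that integer vanishes far away in the vertical direction. *)
Lemma displacement (r : R) (m n : R * R -> R * R) (phi : cylinder R -> cylinder R) (e : R) :
  r < 1 -> sympl r m n ->
  lifts m phi ->
  C0_dist_id phi < e -> e < 1 / 2 -> forall z, `|m z - z| <= e.
Proof.
move=> r1 Hm lift phie e2.
have e0 : 0 <= e.
  apply: le_trans (ltW phie); apply: le_trans (cyl_dist_le_C0 _ (Defs.proj (0, 0))).
  exact: sqrtr_ge0.
have base z : `|(m z).2 - z.2| <= e /\ exists k : int, `|(m z).1 - z.1 - k%:~R| < e \/ (m z).1 = z.1.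
  have [z1|z1] := ltP `|z.2| 1; last first.
    by rewrite (sympl_id Hm) ?(lt_le_trans r1) // subrr normr0; split=> //; exists 0; right.
  have sz := (strip_norm z).2 z1; have [smz E] := lift z sz.
  have := le_lt_trans (cyl_dist_le_C0 phi (Defs.proj z)) phie.
  rewrite E /cyl_dist !proj_snd //= => H.
  have sq (u v : R) : Num.sqrt (u ^+ 2 + v ^+ 2) < e -> `|u| < e /\ `|v| < e.
    move=> h; split; apply: le_lt_trans h; rewrite -sqrtr_sqr; apply: ler_wsqrtr.
      by rewrite lerDl sqr_ge0.
    by rewrite lerDr sqr_ge0.
  have [h1 h2] := sq _ _ H; split; first exact: ltW.
  rewrite ger0_norm in h1; last exact: circle_dist_ge0.
  by have [k kE] := circle_dist_lift h1; exists k; left.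
have small z : `|(m z).1 - z.1| < 1 / 2.
  rewrite ltNge; apply/negP => big.
  (* Along a vertical ray the horizontal displacement is continuous and eventually zero, so from
     [1 / 2] or more it would pass through the value [1 / 2], which lies at distance at least
     [1 / 2 > e] from every integer. *)
  pose f (p : R) := `|(m (z.1, p)).1 - z.1|.
  have cf : continuous f.
    move=> p; apply: cvg_norm; apply: cvgB; last exact: cvg_cst.
    apply: (@continuous_comp _ _ _ (fun p : R => (z.1, p)) (fun a => (m a).1)).
      exact: pair_continuous.
    exact: smT_continuous (smT_fst (sympl_sm Hm)) _.
  have far : r < `|(z.1, `|z.2| + 1).2|.
    rewrite /= ger0_norm ?addr_ge0 //; apply: lt_le_trans r1 _.
    by rewrite lerDr.
  have f0 : f (`|z.2| + 1) = 0 by rewrite /f (sympl_id Hm far) subrr normr0.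
  have fz : 1 / 2 <= f z.2 by rewrite /f -surjective_pairing.
  have le : z.2 <= `|z.2| + 1 by have := ler_norm z.2; lra.
  have [p _ fp] : exists2 p, p \in `[z.2, `|z.2| + 1] & f p = 1 / 2.
    apply: IVT => //; first by apply: continuous_subspaceT.
    rewrite f0 ge_min le_max; apply/andP; split; apply/orP; last by left.
    by right; lra.
  have [_ [k [kE|kE]]] := base (z.1, p).
    have fp' : `|(m (z.1, p)).1 - z.1| = 1 / 2 := fp.
    have := near_int_eq0 _ e2 kE; rewrite /= fp' => /(_ (lexx _)).
    by move: e2; clear; lra.
  by move: fp; rewrite /f kE /= subrr normr0; lra.
move=> z; have [h2 [k kE]] := base z.
rewrite norm_pair_le /= h2 andbT.
case: kE => [kE|->]; last by rewrite subrr normr0.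
exact: ltW (near_int_eq0 (ltW (small z)) e2 kE).
Qed.

End displacement.

(** * Transversality and intersection points on the cover *)

Section intersections.
Context {R : realType}.
Implicit Types (a b : R * R) (x : cylinder R).

Lemma sympl_strip (r : R) (m n : R * R -> R * R) a : r < 1 -> sympl r m n ->
  strip a -> strip (m a).
Proof.
move=> r1 Hm /strip_norm a1; apply/strip_norm; rewrite ltNge; apply/negP => big.
have E := sympl_idV Hm (lt_le_trans r1 big); rewrite (symplK Hm) in E.
by move: big; rewrite -E leNgt a1.
Qed.

Lemma sympl_shift_int (r : R) (m n : R * R -> R * R) a (k : int) : sympl r m n ->
  m (a.1 + k%:~R, a.2) = ((m a).1 + k%:~R, (m a).2).
Proof. by case: a => q p Hm; apply: shift_int; exact: sympl_shift Hm. Qed.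

Lemma image_lift (r : R) (m n : R * R -> R * R) (phi : cylinder R -> cylinder R)
    (S : set (cylinder R)) a : sympl r m n -> lifts m phi -> strip a ->
  (phi @` S) (Defs.proj a) -> exists b, [/\ strip b, S (Defs.proj b) & a = m b].
Proof.
move=> Hm lm sa [x Sx xa]; have [b [sb bx]] := proj_surj x.
have [smb E] := lm b sb; rewrite -bx E in xa.
have [k Ek] := proj_eq sa smb (esym xa).
exists (b.1 + k%:~R, b.2); split=> //; last by rewrite (sympl_shift_int _ _ Hm).
by rewrite proj_shift -surjective_pairing bx.
Qed.

Lemma zero_sectionP a : strip a -> zero_section (Defs.proj a) <-> a.2 = 0.
Proof. by move=> sa; rewrite /zero_section /= (proj_snd sa). Qed.

Lemma tangent_annihilated (L : set (cylinder R)) (f : R * R -> R) b u :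
  smT f -> periodic f -> (forall a, strip a -> L (Defs.proj a) -> f a = 0) ->
  strip b -> tangent L (Defs.proj b) u -> u.1 * d1 f b + u.2 * d2 f b = 0.
Proof.
move=> sf pf fL sb [U [g [[oU U0] _ gL [sg0 g0] Dg]]].
have N : \forall t \near (0 : R), f (g t) = cst 0 t.
  apply: (filterS _ (near_open oU U0)) => t Ut; have [y Ly [sgt gty]] := gL t Ut.
  by apply: fL => //; rewrite gty.
have := near_eq_is_derive N (is_derive_planar sf Dg).
have [k Ek] := proj_eq sg0 sb g0.
have p0 q p : f (q + 1, p) = f (q, p) + 0 by rewrite addr0 (pf q p).
have E1 : d1 f (g 0) = d1 f b.
  rewrite Ek (periodic_int (f := d1 f)) -?surjective_pairing // => q p.
  exact: (d12_shift q p sf p0).1.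
have E2 : d2 f (g 0) = d2 f b.
  rewrite Ek (periodic_int (f := d2 f)) -?surjective_pairing // => q p.
  exact: (d12_shift q p sf p0).2.
by rewrite E1 E2 => D; exact: is_derive_unique D (is_derive_cst _ _ _).
Qed.

Context (r rA rP : R) (A B P Q m n : R * R -> R * R) (phi psi : cylinder R -> cylinder R).
Hypotheses (HA : sympl rA A B) (HP : sympl rP P Q) (Hm : sympl r m n).
Hypotheses (lA : lifts A phi) (lP : lifts P psi) (mE : forall a, m a = B (P (A a))).
Let L := phi @` @zero_section R.

Lemma intersection_lift (x : R) : (m (x, 0)).2 = 0 ->
  P (A (x, 0)) = A ((m (x, 0)).1, 0) /\
  (L `&` psi @` L) (Defs.proj (P (A (x, 0)))).
Proof.
move=> m0; have s0 (y : R) : strip (y, 0) by apply/strip_norm; rewrite /= normr0.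
have E : P (A (x, 0)) = A ((m (x, 0)).1, 0).
  have -> : ((m (x, 0)).1, 0) = m (x, 0) by rewrite [RHS]surjective_pairing m0.
  by rewrite mE (symplVK HA).
have z0 (y : R) : zero_section (Defs.proj (y, 0)) by apply/zero_sectionP.
split=> //; split.
  rewrite E; have [_ <-] := lA (s0 (m (x, 0)).1).
  by exists (Defs.proj ((m (x, 0)).1, 0)).
have [sA EA] := lA (s0 x); have [_ EP] := lP sA.
exists (phi (Defs.proj (x, 0))); last by rewrite EA EP.
by exists (Defs.proj (x, 0)).
Qed.

(** The second components of [B] and of [n] after [B] vanish on the lifts of the two Lagrangians. If
    the derivative were zero, their differentials at the intersection point would be proportional,
    and both tangent spaces would lie in the kernel of the first, a proper subspace because
    [jac B = 1]. *)
Lemma transverse_derivative (x : R) : transverse L (psi @` L) ->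
  (m (x, 0)).2 = 0 -> d1 (pr2 m) (x, 0) != 0.
Proof.
move=> tr m0; apply/eqP => dm0.
have [E [LX L'X]] := intersection_lift m0.
set b := P (A (x, 0)) in E LX L'X.
have s0 (y : R) : strip (y, 0) by apply/strip_norm; rewrite /= normr0.
have sb : strip b by rewrite E; exact: (lA (s0 _)).1.
have sB := sympl_smV HA; have sB2 := smT_snd sB; have HB := sympl_inv HA.
have HQ := sympl_inv HP.
have Bb : B b = m (x, 0) by rewrite mE.
have nE a : n (B a) = B (Q a).
  have h : m (B (Q a)) = B a by rewrite mE (symplVK HA) (symplVK HP).
  by rewrite -h (symplK Hm).
have tL u : tangent L (Defs.proj b) u -> u.1 * d1 (pr2 B) b + u.2 * d2 (pr2 B) b = 0.
  apply: tangent_annihilated => // [q p|a sa La]; first by rewrite (sympl_shift HB).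
  have [a0 [sa0 z ->]] := image_lift HA lA sa La.
  by rewrite (symplK HA); apply/zero_sectionP.
have sn2 : smT (pr2 n) by exact: smT_snd (sympl_smV Hm).
pose f a := (n (B a)).2.
have sf : smT f by exact: smT_comp sB sn2.
have tL' u : tangent (psi @` L) (Defs.proj b) u -> u.1 * d1 f b + u.2 * d2 f b = 0.
  apply: tangent_annihilated => // [q p|a sa La]; first by rewrite /f (sympl_shift HB) (sympl_shiftV _ _ Hm) -surjective_pairing.
  have [a1 [sa1 La1 ->]] := image_lift HP lP sa La.
  have [a0 [sa0 z ->]] := image_lift HA lA sa1 La1.
  by rewrite /f nE (symplK HP) (symplK HA); apply/zero_sectionP.
have Jm := sympl_jac Hm (x, 0); rewrite /jac dm0 mul0r subr0 in Jm.
have [_ _ n1 n2] := inverse_derivatives (sympl_sm Hm) (sympl_smV Hm) (symplK Hm) (sympl_jac Hm (x, 0)).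
rewrite dm0 oppr0 in n1.
have c0 : d2 (pr2 n) (m (x, 0)) != 0.
  by rewrite n2; apply/eqP => z; move: Jm; rewrite z mul0r => /eqP; rewrite eq_sym oner_eq0.
have f1 : d1 f b = d1 (pr2 B) b * d2 (pr2 n) (m (x, 0)).
  by rewrite (d1_comp b sn2 sB) Bb n1 mulr0 add0r.
have f2 : d2 f b = d2 (pr2 B) b * d2 (pr2 n) (m (x, 0)).
  by rewrite (d2_comp b sn2 sB) Bb n1 mulr0 add0r.
have tL'' u : tangent (psi @` L) (Defs.proj b) u -> u.1 * d1 (pr2 B) b + u.2 * d2 (pr2 B) b = 0.
  move=> /tL'; rewrite f1 f2 !mulrA -mulrDl => /eqP.
  by rewrite mulf_eq0 (negPf c0) orbF => /eqP.
have all0 w : w.1 * d1 (pr2 B) b + w.2 * d2 (pr2 B) b = 0.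
  have [u [v [/tL hu /tL'' hv ->]]] := tr _ LX L'X w.
  by move: hu hv; case: u => u1 u2; case: v => v1 v2 /= hu hv; rewrite -[RHS]addr0 -{1}hu -hv; ring.
have := all0 (1, 0); have := all0 (0, 1); rewrite /= !mul1r !mul0r addr0 add0r => b2 b1.
have := sympl_jac HB b; rewrite /jac b1 b2 mulr0 mul0r subrr => /eqP.
by rewrite eq_sym oner_eq0.
Qed.

(** The lifts commute with integer translations, so distinct zeros in [[0, 1)] give distinct
    intersection points on the cylinder. *)
Lemma zero_count (N : nat) (u : seq R) : (L `&` psi @` L #<= `I_N)%card -> uniq u ->
  (forall y, y \in u -> 0 <= y < 1 /\ (m (y, 0)).2 = 0) -> (size u <= N)%N.
Proof.
move=> LN uu zu; pose g (i : nat) := Defs.proj (P (A (nth 0 u i, 0))).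
have inj : {in `I_(size u) &, injective g}.
  move=> i j; rewrite !inE /= => iu ju gij.
  have s0 (y : R) : strip (y, 0) by apply/strip_norm; rewrite /= normr0.
  have sPA y : strip (P (A (y, 0))) by exact: (lP (lA (s0 y)).1).1.
  have [k] := proj_eq (sPA _) (sPA _) gij.
  rewrite -(sympl_shift_int _ _ HP) -(sympl_shift_int _ _ HA) /= => E.
  have E' := congr1 (fun a => B (Q a)) E; rewrite /= !(symplK HP) !(symplK HA) in E'.
  have [i0 i1] := andP (zu _ (mem_nth 0 iu)).1.
  have [j0 j1] := andP (zu _ (mem_nth 0 ju)).1.
  case: E' => E'; apply/eqP; rewrite -(nth_uniq 0 iu ju uu); apply/eqP.
  have kb : `|k%:~R : R| < 1.
    have -> : k%:~R = nth 0 u i - nth 0 u j by rewrite E'; ring.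
    by rewrite ltr_norml; lra.
  have k0 : k = 0.
    by apply/eqP/negPn/negP; rewrite -normr_gt0 gtz0_ge1 -(@ler1z R) intr_norm leNgt kb.
  by rewrite E' k0 addr0.
rewrite -card_le_II; apply: card_le_trans LN.
have := inj_card_eq inj; rewrite card_eq_le => /andP[_ H]; apply: card_le_trans H _.
apply: subset_card_le => _ [i iu <-].
by apply: (intersection_lift _).2; exact: (zu _ (mem_nth 0 iu)).2.
Qed.

End intersections.

(** * The estimate of the Hofer distance *)

Section estimate.
Context {R : realType}.

Lemma integral_derivative (f F : R -> R) : continuous f ->
  (forall t : R, is_derive t 1 F (f t)) ->
  (\int[lebesgue_measure]_(t in `[0%R, 1%R]) (f t)%:E = (F 1 - F 0)%:E)%E.
Proof.
move=> cf dF; have cF t : {for t, continuous F} by exact: is_derive_continuous (dF t).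
rewrite EFinB; apply: continuous_FTC2 => //.
- exact: continuous_subspaceT.
- split=> [x _||].
  + by have [] := dF x.
  + by apply: cvg_at_right_filter; exact: cF.
  + by apply: cvg_at_left_filter; exact: cF.
- by move=> x _; rewrite derive1E; exact: (@derive_val _ _ _ _ _ _ _ (dF x)).
Qed.

(** The radius [e] depends on [L], [N] and [d] only, whereas the Hamiltonian of [psi] may be
    arbitrarily large. *)
Lemma hofer_dist_small (L : set (cylinder R)) (N : nat) (d : R) : Lag L -> 0 < d ->
  exists2 e, 0 < e & forall psi : cylinder R -> cylinder R, Ham psi ->
    C0_dist_id psi < e -> transverse L (psi @` L) -> (L `&` psi @` L #<= `I_N)%card ->
    (hofer_dist L (psi @` L) <= d%:E)%E.
Proof.
move=> [phi hphi ->] d0.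
have [rA [HA [MA [rA1 hA lA]]]] := Ham_lift hphi.
have [B symA] := hflow_sympl hA; set A := (fun z => MA z 1) in symA.
have symB := sympl_inv symA; have [C C0 HC] := sympl_lipschitz symB.
pose K : R := 14 * 2 ^+ N; have K0 : 0 < K by rewrite mulr_gt0 ?exprn_gt0.
(* [K * eps] is the oscillation of the action at the intersection points; this choice makes it at
   most [d / 8], below the value [d / 4] given to [e1]. *)
pose eps : R := Num.min (1 / 4) (d / (8 * K)).
have dK : 0 < d / (8 * K) by rewrite divr_gt0 // mulr_gt0.
have eps0 : 0 < eps by rewrite lt_min dK andbT; lra.
(* Closeness of [psi] to the identity passes to its conjugate at the cost of the Lipschitz constant
   [C] of [B], since [m z - z] is a difference of values of [B]. *)
have eps4 : eps <= 1 / 4 by rewrite ge_min lexx.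
have C1 : 0 < C + 1 by clear - C0; lra.
have e0 : 0 < eps / (C + 1) by rewrite divr_gt0.
have e2 : eps / (C + 1) < 1 / 2.
  rewrite ltr_pdivrMr //; clear - eps4 C0 eps0; nra.
have Ce : C * (eps / (C + 1)) <= eps.
  rewrite mulrCA ler_piMr ?(ltW eps0) // ler_pdivrMr // mul1r; clear; lra.
exists (eps / (C + 1)) => // psi hpsi psie tr cnt.
have [rP [HP [MP [rP1 hP lP]]]] := Ham_lift hpsi.
have [Q symP] := hflow_sympl hP; set P := (fun z => MP z 1) in symP.
have liA : lifts A phi by move=> a sa; split; [exact: sympl_strip rA1 symA sa|exact: lA].
have liP : lifts P psi by move=> a sa; split; [exact: sympl_strip rP1 symP sa|exact: lP].
have near_id := displacement rP1 symP liP psie e2.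
have hm := hflow_conj hP symB.
set r := Num.max rP rA in hm; have r1 : r < 1 by rewrite gt_max rP1.
have [n symm] := hflow_sympl hm; set m := (fun z => B (MP (A z) 1)) in symm.
have mE a : m a = B (P (A a)) by [].
have mid z : `|m z - z| <= eps.
  rewrite -{2}[z](symplK symA); apply: le_trans (HC _ _) _.
  by apply: le_trans Ce; apply: ler_wpM2l => //; exact: near_id.
have mid' z := mid z; have {}mid z : `|(m z).1 - z.1| <= eps /\ `|(m z).2 - z.2| <= eps.
  by have := mid' z; rewrite norm_pair_le => /andP[].
have [D D0 HD] := pham_bound r1 hm.1.
(* Chosen after [D], the bound on the Hamiltonian: by [expR s >= 1 + s], the damped term is at most
   [d / 4]. *)
pose s : R := 4 * D / d + 1.
have s0 : 0 < s by rewrite ltr_wpDl // divr_ge0 ?mulr_ge0 // ltW.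
have sD : expR (- s) * D <= d / 4.
  rewrite expRN mulrC ler_pdivrMr ?expR_gt0 //.
  apply: (@le_trans _ _ (d / 4 * (1 + s))); last first.
    by apply: ler_wpM2l; [rewrite divr_ge0 // ltW|exact: expR_ge1Dx].
  have -> : d / 4 * (1 + s) = D + d / 2 by rewrite /s; field; rewrite gt_eqF.
  by rewrite lerDl divr_ge0 // ltW.
have e1b : 14 * eps * 2 ^+ N < d / 4.
  have -> : 14 * eps * 2 ^+ N = K * eps by rewrite /K; ring.
  apply: (@le_lt_trans _ _ (K * (d / (8 * K)))).
    by apply: ler_wpM2l; [exact: ltW|rewrite ge_min lexx orbT].
  have -> : K * (d / (8 * K)) = d / 8 by field; rewrite gt_eqF.
  by clear - d0; lra.
have q1 : (1 / 4 : R) <= 1 by clear; lra.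
have [r' [G [Y [r'1 hG Y1 GB]]]] := @planar_interpolation R r _ _ N eps (d / 4) D s r1 hm
  (fun z => le_trans (mid z).1 (le_trans eps4 q1))
  (fun z => (mid z).2) eps0 eps4
  (fun x => transverse_derivative symA symP symm liA liP mE tr)
  (fun u uu zu => zero_count symA symP liA liP mE cnt uu zu) e1b HD s0.
have hY := hflow_conj hG symA.
have r2 : Num.max r' rA < 1 by rewrite gt_max r'1.
have [chi [hchi lchi normchi]] := @hflow_generates R _ _ _ (fun t => s * expR (- s * t) * (d / 4) + expR (- s) * D)
  r2 hY (fun t a tI => GB t (B a) tI).
(* The new map [chi] agrees with [psi] on [L], as the distance between Lagrangians requires, but not
   necessarily elsewhere. *)
have chiE : chi @` (phi @` @zero_section R) = psi @` (phi @` @zero_section R).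
  have E x : (phi @` @zero_section R) x -> chi x = psi x.
    move=> [x0 z0 <-]; have [[q p] [sa ax]] := proj_surj x0.
    have p0 : p = 0 by apply/(zero_sectionP sa); rewrite ax.
    rewrite -ax (liA _ sa).2 lchi; last exact: (liA _ sa).1.
    rewrite (liP _ (liA _ sa).1).2 (symplK symA) p0 Y1 -/A.
    by rewrite -[B _]/(m (q, 0)) mE (symplVK symA).
  by apply/seteqP; split=> _ [x Lx <-]; [exists x => //; rewrite E|exists x => //; rewrite -E].
apply: le_trans (_ : hofer_norm chi <= _)%E.
  by apply: ereal_inf_lbound; exists chi.
apply: le_trans normchi _.
pose f (t : R) := 2 * (s * expR (- s * t) * (d / 4) + expR (- s) * D).
(* An explicit primitive of the bound. Its increment over [0, 1] is [d / 2 * (1 - expR (- s)) + 2 *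
   expR (- s) * D], where either term is at most [d / 2]. *)
pose F (t : R) := - (d / 2) * expR (- s * t) + t * (2 * (expR (- s) * D)).
have dF (t : R) : is_derive t 1 F (f t).
  have := is_derive_add (is_derive_expM (- (d / 2)) (- s) t)
    (is_derive_mul (is_derive_id t 1) (is_derive_cst (2 * (expR (- s) * D)) t 1)).
  by apply: is_deriveE; rewrite /f /cst /=; field.
have cf : continuous f.
  have df (t : R) : is_derive t 1 f (- s * (d / 2 * s * expR (- s * t)) + 0).
    have -> : f = (fun t => d / 2 * s * expR (- s * t) + 2 * (expR (- s) * D)).
      by apply/funext => u; rewrite /f; field.
    exact: is_derive_add (is_derive_expM _ _ _) (is_derive_cst _ _ _).
  by move=> t; exact: is_derive_continuous (df t).
rewrite (integral_derivative cf dF) lee_fin /F mulr0 mulr1 expR0 mulr1 mul0r mul1r addr0.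
have := expR_gt0 (- s); move: (expR (- s)) sD => E ED E0.
have : 0 <= d / 2 * E by rewrite mulr_ge0 ?ltW // divr_gt0.
by clear - ED; lra.
Qed.

Lemma cvge_to0 (u : nat -> \bar R) : (forall n, 0 <= u n)%E ->
  (forall d : R, 0 < d -> \forall n \near \oo, (u n <= d%:E)%E) -> u n @[n --> \oo] --> (0 : \bar R)%E.
Proof.
move=> u0 ud; apply/fine_cvgP; split.
  apply: filterS (ud 1 ltr01) => n un; rewrite ge0_fin_numE //.
  exact: le_lt_trans un (ltry _).
apply/cvgrPdist_le => e e0; apply: filterS (ud e e0) => n un.
rewrite sub0r normrN /=; have := u0 n; move: un.
by case: (u n) => [x| |] //=; rewrite !lee_fin => xe x0; rewrite ger0_norm.
Qed.

End estimate.

Local Open Scope card_scope.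

Theorem corollary1p4 (R : realType) (L : set (cylinder R))
    (Ln : nat -> set (cylinder R))
    (hL : Lag L) (hLn : forall n : nat, Lag (Ln n))
    (htransverse : forall n : nat, transverse L (Ln n))
    (hC0 : C0_converges Ln L)
    (hbounded : exists N : nat, forall n : nat, L `&` Ln n #<= `I_N) :
  hofer_dist L (Ln n) @[n --> \oo] --> (0%R%:E : \bar R).
Proof.
have [N LN] := hbounded; have [psi [Hpsi psi0]] := hC0.
apply: cvge_to0 => [n|d d0]; first exact: hofer_dist_ge0.
have [e e0 He] := hofer_dist_small N hL d0.
have : \forall n \near \oo, `|0 - C0_dist_id (psi n)| < e by move/cvgrPdist_lt: psi0; apply.
apply: filterS => n; rewrite sub0r normrN => /(le_lt_trans (ler_norm _)) en.
have [hn E] := Hpsi n; rewrite -E; apply: He => //; rewrite E; first exact: htransverse.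
exact: LN.
Qed.
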